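(* Let $U_r(\Sigma)$ be a valid, bounded and complete Cantor algebra, and let $n\ge 1$ be such that $Z^n$ is simply connected. Then there is a finite presentation of $V_r(\Sigma)$ involving only strict generators $(i,k,t)$ with $i+n_t-1\le n$, permutations $(i,\sigma)$ with $i\le n$, and relators involving these generators only, and which is obtained by truncating the presentation $$\langle W_s\cup W_p\mid R_D\cup R_\Sigma\cup R_{PD}\cup R_P\rangle$$ of $V_r(\Sigma)$ described in the context.
   Context: **Cantor algebras.** Let $S=\{1,\dots,s\}$ be a finite set of colours, each $i\in S$ having an arity $n_i>1$. Consider sets $U$ with, for each $i\in S$, an $n_i$-ary operation $\lambda_i:U^{n_i}\to U$ (ascending operation, or contraction) and $n_i$ unary operations $\alpha_i^1,\dots,\alpha_i^{n_i}:U\to U$, all written on the right; put $v\alpha_i=(v\alpha_i^1,\dots,v\alpha_i^{n_i})$ (descending operation, or expansion). The set of laws is $\Sigma=\Sigma_1\cup\Sigma_2$. $\Sigma_1$ consists of $u\alpha_i\lambda_i=u$ and $(u_1,\dots,u_{n_i})\lambda_i\alpha_i=(u_1,\dots,u_{n_i})$ for all $i$. $\Sigma_2=\bigcup_{i<i'}\Sigma_2^{i,i'}$, where each $\Sigma_2^{i,i'}$ is either empty or is of the following form: there are maps $f:\{1,\dots,n_i\}\to S$ and $f':\{1,\dots,n_{i'}\}\to S$ such that the sets of words $\Lambda_i=\{\alpha_i^j\alpha_{f(j)}^l: 1\le j\le n_i,\,1\le l\le n_{f(j)}\}$ and $\Lambda_{i'}=\{\alpha_{i'}^j\alpha_{f'(j)}^l: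 1\le j\le n_{i'},\,1\le l\le n_{f'(j)}\}$ have the same cardinality, there is a fixed bijection $\phi:\Lambda_i\to\Lambda_{i'}$, and the laws are $u\nu=u\phi(\nu)$ for $\nu\in\Lambda_i$, $u\in U$. $U_r(\Sigma)$ is the free object on a fixed set $X_r$ of $r$ elements in the class of such algebras satisfying $\Sigma$. It is complete if for all $i\ne i'$ the set $\Sigma_2^{i,i'}$ is non-empty, $f(j)=i'$ for all $j=1,\dots,n_i$ and $f'(j')=i$ for all $j'=1,\dots,n_{i'}$. A simple expansion of a subset $B$ replaces some $b\in B$ by $b\alpha_i^1,\dots,b\alpha_i^{n_i}$; a simple contraction replaces pairwise distinct $b_1,\dots,b_{n_i}\in B$ by $(b_1,\dots,b_{n_i})\lambda_i$. An expansion is a finite chain of simple expansions; $A\le A_1$ means that $A_1$ is obtained from $A$ by an expansion. The expansion is elementary if there are no repeated colours in the paths from elements of $A$ to their descendants in $A_1$. A subset is admissible if it is obtained from $X_r$ by finitely many expansions or contractions. $U_r(\Sigma)$ is valid if for every admissible set $Y$ in the word algebra on $X_r$ (the absolutely free algebra for these operations, with no laws imposed) the image $\overline Y$ of $Y$ in $U_r(\Sigma)$ satisfies $|\overline Y|=|Y|$. $U_r(\Sigma)$ is bounded if any admissible $Y,Z$ having some admissible $A\le Y,Z$ have a unique least upper bound with respect to $\le$ among admissible sets. If $\Sigma$ is valid and bounded, the admissible sets are exactly the bases of $U_r(\Sigma)$. With $d=\gcd\{n_i-1: i\in S\}$, all bases have cardinality congruent to $r$ mod $d$, and one may assume $r\le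 d$. Let $I=\{i\ge 1: i\equiv r \bmod d\}$. **The group and the complexes $Z$, $Z^n$.** $G=V_r(\Sigma)$ is the group of algebra automorphisms of $U_r(\Sigma)$, acting on the left. A tuple is an ordered tuple $A$ whose underlying set $u(A)$ is a basis; for two tuples of the same length, $(A,A')$ denotes the element of $G$ mapping the entries of $A$ to those of $A'$ in order. Write $A_1\precsim A_2$ if $u(A_1)\le u(A_2)$ is an elementary expansion (this includes $u(A_1)=u(A_2)$). $Z$ is the $\Delta$-complex whose vertices are the tuples and which has an oriented $k$-simplex, attached at the vertices $A_0,\dots,A_k$ (repetitions allowed), for each chain $A_0\precsim\dots\precsim A_k$. $Z^n$ is the truncated version of $Z$ in which the tuples have at most $n$ elements. $G$ acts freely on $Z$, and the vertices of $Z/G$ are the $\overline X_i$, $i\in I$, where $\overline X_i$ is the orbit of all tuples of length $i$. Applying the descending operation of colour $t$ to the $k$-th entry of $(x_1,\dots,x_i)$ gives $(x_1,\dots,x_{k-1},x_k\alpha_t^1,\dots,x_k\alpha_t^{n_t},x_{k+1},\dots,x_i)$; this is called a very elementary strict operation. Applying a permutation $\sigma$ to a tuple $A$ gives the tuple $A\sigma$ whose $\sigma(k)$-th entry is the $k$-th entry of $A$. **Tree and tuples.** $\mathcal T$ is a maximal tree in $Z/G$ constructed as follows. One first takes a directed tree with root $\overline X_r$ whose vertices are the $\overline X_i$ with $i\in r+\sum_{t=1}^s\mathbb N(n_t-1)$; only finitely many vertices of $Z/G$ are missed, and these are then joined to the tree one after the other by adding paths. This is done so that every edge is a single descending operation of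 some colour applied to the last entry of the tuple, and the resulting tree has only finitely many roots. $\mathcal T$ lifts to $Z$ starting from a tuple with underlying set $X_r$ (again denoted $X_r$), and $X_i$ denotes the resulting lift of $\overline X_i$. **The infinite presentation.** $W_s$ is the set of strict generators: for $i\in I$, $1\le k\le i$ and a colour $t$, $(i,k,t)$ is the element $(X_{i+n_t-1},X_i\epsilon)\in G$, where $X_i\epsilon$ is obtained from $X_i$ by applying the descending operation of colour $t$ to its $k$-th entry. Strict generators coming from edges of $\mathcal T$ represent $(X_j,X_j)=1$; they are set equal to $1$, i.e. may be deleted. $W_p$ is the set of permutations: for $i\in I$ and $\sigma$ a permutation of $\{1,\dots,i\}$, $(i,\sigma)$ is the element $(X_i,X_i\sigma)$. A chain of operations (strict ones and permutations) applied successively to a tuple of length $i$ corresponds to the product, in the same order, of the generators associated to the single operations; two chains giving the same tuple give a relator. The sets of relators are: - $R_D$ (disjoint type): $(i,k_1,t)\,(i+n_t-1,k_2+n_t-1,t')=(i,k_2,t')\,(i+n_{t'}-1,k_1,t)$ for $k_1<k_2$ and colours $t,t'$; - $R_\Sigma$: the relators between products of strict generators, possibly followed by a permutation, coming from different chains of strict descending operations which, up to a permutation, give the same result when applied to any element of any tuple, and which come from the defining laws of the algebra encoded in $\Sigma$; - $R_{PD}$ (permutation-descending): $(i,\sigma)\,(i,\sigma(k),t)=(i,k,t)\,(i+n_t-1,\sigma')$, where $\sigma'$ is the permutation such that applying $\sigma$ to $X_i$ and then the descending operation of colour $t$ to the $\sigma(k)$-th entry gives the same tuple as applying the descending operation of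 colour $t$ to the $k$-th entry and then $\sigma'$; - $R_P$ (permutation): $(i,\sigma)=(i,\sigma_1)(i,\sigma_2)$ whenever $\sigma$ is the composition of $\sigma_1$ followed by $\sigma_2$. *)

(* Defs.v *)
From HB Require Import structures.
From Stdlib Require Import Relation_Operators.
From mathcomp Require Import all_boot all_order all_algebra all_fingroup.
From mathcomp Require Import all_classical all_reals all_analysis.

Set Implicit Arguments.
Unset Strict Implicit.
Unset Printing Implicit Defensive.

Import Order.TTheory GRing.Theory Num.Theory.
Import numFieldNormedType.Exports.
Local Open Scope classical_set_scope.

(* The set of words Lambda_i attached to f is represented by the type of pairs
   (j, l) standing for alpha_i^j alpha_(f j)^l. *)
Record law (s : nat) (ar : 'I_s -> nat) (i i' : 'I_s) := Law {
  law_f : 'I_(ar i) -> 'I_s;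
  law_f' : 'I_(ar i') -> 'I_s;
  law_phi : {j : 'I_(ar i) & 'I_(ar (law_f j))} ->
            {j : 'I_(ar i') & 'I_(ar (law_f' j))};
  law_phi_bij : bijective law_phi }.

(* Only the values [sigma2 i i'] with i < i' are ever used; [None] means that
   Sigma_2^(i,i') is empty. *)
Record signature := Signature {
  colours : nat;
  arity : 'I_colours -> nat;
  arity_gt1 : forall i, (1 < arity i)%N;
  sigma2 : forall i i', option (law arity i i') }.

Record algebra (S : signature) := Algebra {
  carrier :> Type;
  lam : forall i : 'I_(colours S), ('I_(arity i) -> carrier) -> carrier;
  alp : forall i : 'I_(colours S), 'I_(arity i) -> carrier -> carrier }.
Arguments lam {S a} i _.
Arguments alp {S a} i _ _.

HB.instance Definition _ S (A : algebra S) := gen_eqMixin (carrier A).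
HB.instance Definition _ S (A : algebra S) := gen_choiceMixin (carrier A).

Definition satisfies S (A : algebra S) : Prop :=
  [/\ forall (i : 'I_(colours S)) (u : A), lam i (fun j => alp i j u) = u,
      forall (i : 'I_(colours S)) (us : 'I_(arity i) -> A) j,
        alp i j (lam i us) = us j
    & forall (i i' : 'I_(colours S)) (L : law (@arity S) i i'),
        (i < i')%N -> sigma2 i i' = Some L ->
        forall (p : {j : 'I_(arity i) & 'I_(arity (law_f L j))}) (u : A),
          alp _ (tagged p) (alp i (tag p) u) =
          alp _ (tagged (law_phi p)) (alp i' (tag (law_phi p)) u)].

Definition complete S : Prop :=
  forall i i' : 'I_(colours S), (i < i')%N ->
    exists L : law (@arity S) i i',
      [/\ sigma2 i i' = Some L, forall j, law_f L j = i'
        & forall j', law_f' L j' = i].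

Definition is_hom S (A B : algebra S) (f : A -> B) : Prop :=
  (forall (i : 'I_(colours S)) (us : 'I_(arity i) -> A),
     f (lam i us) = lam i (fun j => f (us j))) /\
  (forall (i : 'I_(colours S)) (j : 'I_(arity i)) (u : A),
     f (alp i j u) = alp i j (f u)).

Definition is_free S (A : algebra S) (I : Type) (x : I -> A) : Prop :=
  satisfies A /\
  forall B : algebra S, satisfies B -> forall h : I -> B,
    exists phi : A -> B,
      [/\ is_hom phi, forall a, phi (x a) = h a
        & forall psi : A -> B, is_hom psi -> (forall a, psi (x a) = h a) ->
            psi =1 phi].

Definition is_basis S (A : algebra S) (B : set A) : Prop :=
  is_free (fun b : {b : A | B b} => sval b).

Inductive term (S : signature) (r : nat) : Type :=
| Var of 'I_r
| Lam (i : 'I_(colours S)) of ('I_(arity i) -> term S r)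
| Alp (i : 'I_(colours S)) of 'I_(arity i) & term S r.
Arguments Var {S r} _.
Arguments Lam {S r} i _.
Arguments Alp {S r} i _ _.

Definition word_algebra S r : algebra S :=
  @Algebra S (term S r) (@Lam S r) (@Alp S r).

Fixpoint interp S r (A : algebra S) (x : 'I_r -> A) (w : term S r) : A :=
  match w with
  | Var a => x a
  | Lam i ws => lam i (fun j => interp x (ws j))
  | Alp i j w' => alp i j (interp x w')
  end.

Definition expand_at S (A : algebra S) (B : set A) (b : A)
    (i : 'I_(colours S)) : set A :=
  (B `\ b) `|` [set alp i j b | j in [set: 'I_(arity i)]].

Definition simple_expansion S (A : algebra S) (B B' : set A) : Prop :=
  exists b i, B b /\ B' = expand_at B b i.

Definition simple_contraction S (A : algebra S) (B B' : set A) : Prop :=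
  exists (i : 'I_(colours S)) (bs : 'I_(arity i) -> A),
    [/\ injective bs, forall j, B (bs j)
      & B' = (B `\` range bs) `|` [set lam i bs]].

Definition expands S (A : algebra S) : set A -> set A -> Prop :=
  clos_refl_trans (set A) (@simple_expansion S A).

Definition admissible S (A : algebra S) r (x : 'I_r -> A) : set A -> Prop :=
  clos_refl_trans (set A)
    (fun B B' => simple_expansion B B' \/ simple_contraction B B') (range x).

Definition valid S r (U : algebra S) (x : 'I_r -> U) : Prop :=
  forall Y : set (word_algebra S r),
    admissible (fun a : 'I_r => Var a : word_algebra S r) Y ->
    (interp x @` Y #= Y)%card.

Definition is_lub S r (U : algebra S) (x : 'I_r -> U) (Y Z L : set U) : Prop :=
  [/\ admissible x L, expands Y L, expands Z L
    & forall M, admissible x M -> expands Y M -> expands Z M -> expands L M].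

Definition is_bounded S r (U : algebra S) (x : 'I_r -> U) : Prop :=
  forall Y Z : set U, admissible x Y -> admissible x Z ->
    (exists A, [/\ admissible x A, expands A Y & expands A Z]) ->
    exists! L, is_lub x Y Z L.

(* [coloured_expansion A B c]: B is reached from A by a chain of simple
   expansions, and c b is the list of the colours met on the path from an
   element of A to its descendant b in B. *)
Inductive coloured_expansion S (U : algebra S) (A : set U) :
    set U -> (U -> seq 'I_(colours S)) -> Prop :=
| CE_refl c : (forall a, A a -> c a = [::]) -> coloured_expansion A A c
| CE_step B c b i c' :
    coloured_expansion A B c -> B b ->
    (forall j : 'I_(arity i), c' (alp i j b) = rcons (c b) i) ->
    (forall u, B u -> u <> b -> c' u = c u) ->
    coloured_expansion A (expand_at B b i) c'.

Definition elementary S (U : algebra S) (A A1 : set U) : Prop :=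
  exists c, coloured_expansion A A1 c /\ forall u, A1 u -> uniq (c u).

Record algebra_aut S (U : algebra S) := Aut {
  autf :> U -> U;
  autV : U -> U;
  aut_hom : is_hom autf;
  autK : cancel autf autV;
  autVK : cancel autV autf }.

HB.instance Definition _ S (U : algebra S) := gen_eqMixin (algebra_aut U).
HB.instance Definition _ S (U : algebra S) := gen_choiceMixin (algebra_aut U).

Lemma aut_eq S (U : algebra S) (g h : algebra_aut U) : autf g =1 autf h -> g = h.
Proof.
case: g h => f f' Hf fK f'K [k k' Hk kK k'K] /= /funext fk; subst k.
have E : f' = k' by apply/funext => u; rewrite -[in LHS](k'K u) fK.
by subst k'; congr Aut; exact: Prop_irrelevance.
Qed.

Section AutGroup.
Variables (S : signature) (U : algebra S).
Implicit Types g h : algebra_aut U.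

Lemma aut_one_hom : is_hom (@id U). Proof. by []. Qed.
Definition aut_one : algebra_aut U :=
  Aut aut_one_hom (fun=> erefl) (fun=> erefl).

Lemma aut_mul_hom g h : is_hom (g \o h).
Proof.
by case: (aut_hom g) (aut_hom h) => g1 g2 [h1 h2]; split=> *;
   rewrite /= ?h1 ?g1 ?h2 ?g2.
Qed.
Definition aut_mul g h : algebra_aut U :=
  Aut (aut_mul_hom g h) (can_comp (autK g) (autK h))
      (can_comp (autVK h) (autVK g)).

Lemma aut_inv_hom g : is_hom (autV g).
Proof.
case: (aut_hom g) => g1 g2; split=> [i us|i j u].
  apply: (can_inj (autK g)); rewrite autVK g1; congr lam.
  by apply/funext => j; rewrite autVK.
by apply: (can_inj (autK g)); rewrite autVK g2 autVK.
Qed.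
Definition aut_inv g : algebra_aut U := Aut (aut_inv_hom g) (autVK g) (autK g).

Lemma aut_mulA : associative aut_mul. Proof. by move=> *; apply: aut_eq. Qed.
Lemma aut_mul1g : left_id aut_one aut_mul.
Proof. by move=> *; apply: aut_eq. Qed.
Lemma aut_mulg1 : right_id aut_one aut_mul.
Proof. by move=> *; apply: aut_eq. Qed.
Lemma aut_mulVg : left_inverse aut_one aut_inv aut_mul.
Proof. by move=> g; apply: aut_eq => u /=; rewrite autK. Qed.
Lemma aut_mulgV : right_inverse aut_one aut_inv aut_mul.
Proof. by move=> g; apply: aut_eq => u /=; rewrite autVK. Qed.

HB.instance Definition _ := isGroup.Build (algebra_aut U)
  aut_mulA aut_mul1g aut_mulg1 aut_mulVg aut_mulgV.
End AutGroup.

Definition is_tuple S (U : algebra S) (A : seq U) : Prop :=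
  uniq A /\ is_basis [set` A].

(* The entries are numbered from 0. *)
Definition expand S (U : algebra S) (t : 'I_(colours S)) (k : nat)
    (A : seq U) : seq U :=
  if drop k A is a :: tl
  then take k A ++ [seq alp t j a | j <- enum 'I_(arity t)] ++ tl
  else A.

(* For A of size i, the tuple whose sigma(k)-th entry is the k-th entry of A. *)
Definition permute (T : Type) (i : nat) (sigma : 'S_i) (A : seq T) : seq T :=
  pmap (fun k : 'I_i => onth A ((sigma^-1)%g k)) (enum 'I_i).

(* The element written (A, A'). *)
Definition tuple_aut S (U : algebra S) (A A' : seq U) : algebra_aut U :=
  xget 1%g [set g : algebra_aut U | map g A = A'].

Definition precedes S (U : algebra S) (A B : seq U) : Prop :=
  elementary [set` A] [set` B].

Record complex (V : Type) := Complex {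
  simplex : set (seq V);
  simplex_face : forall c m, simplex c -> mask m c <> [::] ->
    simplex (mask m c) }.

Lemma truncated_Z_face S (U : algebra S) (n : nat) (c : seq (seq U))
    (m : bitseq) :
  [/\ c <> [::],
      all (fun A : seq U => `[< is_tuple A /\ (size A <= n)%N >]) c
    & pairwise (fun A B => `[< precedes A B >]) c] -> mask m c <> [::] ->
  [/\ mask m c <> [::],
      all (fun A : seq U => `[< is_tuple A /\ (size A <= n)%N >]) (mask m c)
    & pairwise (fun A B => `[< precedes A B >]) (mask m c)].
Proof. by move=> [_ h1 h2] h3; split=> //; [apply: all_mask|apply: pairwise_mask]. Qed.

(* The truncation Z^n. Since [precedes] is not transitive, the requirement
   A_i precedes A_j for all i < j is what makes the faces of a simplex
   simplices. *)
Definition truncated_Z S (U : algebra S) (n : nat) : complex (seq U) :=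
  Complex (@truncated_Z_face S U n).

Section Realization.
Local Open Scope ring_scope.
Variables (R : realType) (V : Type) (K : complex V).

(* A point of the geometric realization lies in a unique open simplex: it is
   given by that simplex together with positive barycentric coordinates. *)
Record realization := Realization {
  rpoint : seq (V * R);
  rpoint_simplex : simplex K (unzip1 rpoint);
  rpoint_gt0 : all (fun p => 0 < p.2) rpoint;
  rpoint_sum : \sum_(p <- rpoint) p.2 = 1 }.

Definition std_simplex (k : nat) : set 'rV[R]_k :=
  [set t | (forall i, 0 <= t ord0 i) /\ \sum_i t ord0 i = 1].

Definition weights (c : seq V) (t : 'rV[R]_(size c)) : seq (V * R) :=
  zip c [seq t ord0 i | i <- enum 'I_(size c)].

Definition support_weights (c : seq V) (t : 'rV[R]_(size c)) : seq (V * R) :=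
  [seq p <- weights t | 0 < p.2].

Lemma size_weights (c : seq V) (t : 'rV[R]_(size c)) :
  size c = size [seq t ord0 i | i <- enum 'I_(size c)].
Proof. by rewrite size_map size_enum_ord. Qed.

Lemma unzip1_weights (c : seq V) (t : 'rV[R]_(size c)) :
  unzip1 (weights t) = c.
Proof. by apply: unzip1_zip; rewrite -size_weights. Qed.

Lemma unzip2_weights (c : seq V) (t : 'rV[R]_(size c)) :
  unzip2 (weights t) = [seq t ord0 i | i <- enum 'I_(size c)].
Proof. by apply: unzip2_zip; rewrite -size_weights. Qed.

Lemma support_weights_gt0 (c : seq V) (t : 'rV[R]_(size c)) :
  all (fun p => 0 < p.2) (support_weights t).
Proof. exact: filter_all. Qed.

Lemma support_weights_sum (c : seq V) (t : 'rV[R]_(size c)) :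
  std_simplex t -> \sum_(p <- support_weights t) p.2 = 1.
Proof.
move=> [t0 t1]; rewrite big_filter -[RHS]t1.
have -> : \sum_i t ord0 i = \sum_(p <- weights t) p.2.
  rewrite -(big_map snd predT id) -/(unzip2 _) unzip2_weights.
  by rewrite big_map big_enum.
have : all (fun w => 0 <= w) (unzip2 (weights t)).
  by rewrite unzip2_weights all_map; apply/allP => i _ /=.
elim: (weights t) => [|p s IH] /=; first by rewrite !big_nil.
move=> /andP[p0 /IH {}IH]; rewrite !big_cons IH; case: ltP => // p0'.
by rewrite (_ : p.2 = 0) ?add0r //; apply/le_anti/andP.
Qed.

Lemma support_weights_simplex (c : seq V) (t : 'rV[R]_(size c)) :
  simplex K c -> std_simplex t -> simplex K (unzip1 (support_weights t)).
Proof.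
move=> Kc tD.
have E : unzip1 (support_weights t) = mask (map (fun p => 0 < p.2) (weights t)) c.
  rewrite /support_weights filter_mask /unzip1 map_mask; congr mask.
  exact: unzip1_weights.
rewrite E; apply: simplex_face => //; rewrite -E => E0.
have := support_weights_sum tD.
case: (support_weights t) E0 => // _; rewrite big_nil => /eqP.
by rewrite eq_sym oner_eq0.
Qed.

Definition characteristic_map (c : seq V) (Kc : simplex K c)
    (t : 'rV[R]_(size c)) (tD : std_simplex t) : realization :=
  Realization (support_weights_simplex Kc tD) (support_weights_gt0 t)
    (support_weights_sum tD).

(* The weak topology: a set is open iff its preimage under the characteristic
   map of each closed simplex is relatively open. *)
Definition realization_open (O : set realization) : Prop :=
  forall (c : seq V) (Kc : simplex K c), exists2 W : set 'rV[R]_(size c),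
    open W & forall t (tD : std_simplex t), O (characteristic_map Kc tD) <-> W t.

Lemma realization_openT : realization_open setT.
Proof. by move=> c Kc; exists setT => //; exact: openT. Qed.

Lemma realization_openI : setI_closed realization_open.
Proof.
move=> A B oA oB c Kc; have [W1 o1 h1] := oA c Kc; have [W2 o2 h2] := oB c Kc.
by exists (W1 `&` W2); [exact: openI|move=> t tD; rewrite /setI /= h1 h2].
Qed.

Lemma realization_open_bigU (I : Type) (f : I -> set realization) :
  (forall i, realization_open (f i)) -> realization_open (\bigcup_i f i).
Proof.
move=> of_ c Kc; have /choice[W HW] : forall i, exists W : set 'rV[R]_(size c),
    open W /\ forall t (tD : std_simplex t),
      f i (characteristic_map Kc tD) <-> W t.
  by move=> i; have [W oW hW] := of_ i c Kc; exists W.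
exists (\bigcup_i W i) => [|t tD].
  by apply: bigcup_open => i _; case: (HW i).
by split=> -[i _ h]; exists i => //; apply/(proj2 (HW i) t tD).
Qed.

HB.instance Definition _ := gen_eqMixin realization.
HB.instance Definition _ := gen_choiceMixin realization.
HB.instance Definition _ := isOpenTopological.Build realization
  realization_openT realization_openI realization_open_bigU.
End Realization.

Definition simply_connected (R : realType) (T : topologicalType) : Prop :=
  [/\ exists x : T, True,
      forall x y : T, exists f : R -> T,
        [/\ {within `[0%R, 1%R], continuous f}, f 0%R = x & f 1%R = y]
    & forall f : R -> T, {within `[0%R, 1%R], continuous f} -> f 0%R = f 1%R ->
        exists H : R * R -> T,
          [/\ {within `[0%R, 1%R] `*` `[0%R, 1%R], continuous H},
              forall a, `[0%R, 1%R] a -> H (a, 0%R) = f a,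
              forall a, `[0%R, 1%R] a -> H (a, 1%R) = f 0%R
            & forall b, `[0%R, 1%R] b -> H (0%R, b) = f 0%R /\
                                         H (1%R, b) = f 0%R]].

(* The vertices of Z/G are identified with the lengths i in I, and the pair
   (i, t) stands for the edge from i to i + n_t - 1 given by the descending
   operation of colour t applied to the last entry. *)
Section Tree.
Variables (S : signature) (r : nat).
Notation edge := (nat * 'I_(colours S))%type.

Definition up (i : nat) (t : 'I_(colours S)) : nat := (i + arity t).-1.

Definition lengths : set nat :=
  [set i | (0 < i)%N /\
           i = r %[mod \big[gcdn/0%N]_(t < colours S) (arity t).-1]].

(* A walk is a list of edges, each with [true] if it is followed in its own
   direction. *)
Fixpoint walk (E : set edge) (u : nat) (p : seq (edge * bool)) (v : nat)
    : Prop :=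
  match p with
  | [::] => u = v
  | (e, true) :: p' => [/\ E e, u = e.1 & walk E (up e.1 e.2) p' v]
  | (e, false) :: p' => [/\ E e, u = up e.1 e.2 & walk E e.1 p' v]
  end.

Definition reduced (p : seq (edge * bool)) : bool :=
  sorted (fun a b => ~~ ((a.1 == b.1) && (a.2 != b.2))) p.

Definition is_tree (V : set nat) (E : set edge) : Prop :=
  (forall e, E e -> V e.1 /\ V (up e.1 e.2)) /\
  (forall u v, V u -> V v -> exists! p, walk E u p v /\ reduced p).

Definition reachable : set nat :=
  [set m | exists c : 'I_(colours S) -> nat,
      m = (r + \sum_t c t * (arity t).-1)%N].

Definition maximal_tree (E : set edge) : Prop :=
  [/\ is_tree lengths E,
      forall m, reachable m ->
        exists p, walk E r p m /\ all (fun a : edge * bool => a.2) p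
    & finite_set [set i | lengths i /\ forall e, E e -> up e.1 e.2 <> i]].

Definition truncated_tree (n : nat) (E : set edge) : Prop :=
  is_tree (lengths `&` [set i | (i <= n)%N])
          (E `&` [set e | (up e.1 e.2 <= n)%N]).

Definition is_lift (U : algebra S) (x : 'I_r -> U) (E : set edge)
    (X : nat -> seq U) : Prop :=
  [/\ forall i, lengths i -> is_tuple (X i) /\ size (X i) = i,
      [set` X r] = range x
    & forall e, E e -> X (up e.1 e.2) = expand e.2 e.1.-1 (X e.1)].

End Tree.

Section Presentation.
Local Open Scope group_scope.
Variable Gam : Type.

(* The letter (g, b) is g if b is false and the inverse of g if b is true. *)
Definition word := seq (Gam * bool).

Definition word_over (W : set Gam) (w : word) : Prop :=
  all (fun l : Gam * bool => `[< W l.1 >]) w.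

Inductive word_equiv (W : set Gam) (Rel : set (word * word)) :
    word -> word -> Prop :=
| WE_refl w : word_equiv W Rel w w
| WE_sym w w' : word_equiv W Rel w w' -> word_equiv W Rel w' w
| WE_trans w1 w2 w3 : word_equiv W Rel w1 w2 -> word_equiv W Rel w2 w3 ->
    word_equiv W Rel w1 w3
| WE_cancel u v g b : W g ->
    word_equiv W Rel (u ++ [:: (g, b); (g, ~~ b)] ++ v) (u ++ v)
| WE_rel u v l1 l2 : Rel (l1, l2) ->
    word_equiv W Rel (u ++ l1 ++ v) (u ++ l2 ++ v).

Definition word_eval (G : groupType) (ev : Gam -> G) (w : word) : G :=
  \prod_(l <- w) (if l.2 then (ev l.1)^-1 else ev l.1).

Definition presents (G : groupType) (ev : Gam -> G) (W : set Gam)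
    (Rel : set (word * word)) : Prop :=
  [/\ forall p, Rel p -> word_over W p.1 /\ word_over W p.2,
      forall g : G, exists2 w, word_over W w & word_eval ev w = g
    & forall w w', word_over W w -> word_over W w' ->
        (word_eval ev w = word_eval ev w' <-> word_equiv W Rel w w')].

Definition finitely_presents (G : groupType) (ev : Gam -> G) (W : set Gam)
    (Rel : set (word * word)) : Prop :=
  [/\ finite_set W, finite_set Rel & presents ev W Rel].

End Presentation.

(* Strict i k t is (i, k+1, t) in 1-based numbering. *)
Inductive gen (S : signature) : Type :=
| Strict of nat & nat & 'I_(colours S)
| Perm (i : nat) of 'S_i.
Arguments Strict {S} _ _ _.
Arguments Perm {S} i _.

Definition pos S (ws : seq (gen S)) : word (gen S) :=
  [seq (g, false) | g <- ws].

Definition gens S (r : nat) : set (gen S) :=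
  [set g | match g with
           | Strict i k _ => lengths S r i /\ (k < i)%N
           | Perm i _ => lengths S r i
           end].

Definition gen_le S (n : nat) : set (gen S) :=
  [set g | match g with
           | Strict i _ t => (up i t <= n)%N
           | Perm i _ => (i <= n)%N
           end].

(* A chain of strict operations is a list of pairs (position, colour), to be
   applied successively. *)
Fixpoint chain_gens S (i : nat) (c : seq (nat * 'I_(colours S))) : seq (gen S) :=
  if c is (k, t) :: c' then Strict i k t :: chain_gens (up i t) c' else [::].

Fixpoint chain_len S (i : nat) (c : seq (nat * 'I_(colours S))) : nat :=
  if c is (k, t) :: c' then chain_len (up i t) c' else i.

Definition chain_apply S (U : algebra S) (c : seq (nat * 'I_(colours S)))
    (A : seq U) : seq U :=
  foldl (fun B (o : nat * 'I_(colours S)) => expand o.2 o.1 B) A c.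

(* After the k-th entry has been expanded with colour t, expand its children in
   the order [todo], the j-th one with colour f j; [done] lists the children
   already expanded. *)
Fixpoint children_chain S (t : 'I_(colours S)) (f : 'I_(arity t) -> 'I_(colours S))
    (k : nat) (done todo : seq 'I_(arity t)) : seq (nat * 'I_(colours S)) :=
  if todo is j :: todo' then
    ((k + \sum_(j' < arity t | (j' < j)%N)
            (if j' \in done then arity (f j') else 1))%N, f j)
      :: children_chain f k (j :: done) todo'
  else [::].

(* The chains turning the k-th entry u into the entries u nu, nu in Lambda_t. *)
Definition law_chain S (t : 'I_(colours S)) (f : 'I_(arity t) -> 'I_(colours S))
    (k : nat) (c : seq (nat * 'I_(colours S))) : Prop :=
  exists2 todo, perm_eq todo (enum 'I_(arity t))
              & c = (k, t) :: children_chain f k [::] todo.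

Section Relators.
Variables (S : signature) (r : nat) (U : algebra S).
Variables (E : set (nat * 'I_(colours S))) (X : nat -> seq U).
Notation relator := (word (gen S) * word (gen S))%type.
Local Open Scope group_scope.

(* The strict generators coming from edges of the tree are trivial. *)
Inductive R_T : set relator :=
| In_R_T i t : E (i, t) -> R_T (pos [:: Strict i i.-1 t], [::]).

Inductive R_D : set relator :=
| In_R_D i k1 k2 t t' : lengths S r i -> (k1 < k2)%N -> (k2 < i)%N ->
    R_D (pos [:: Strict i k1 t; Strict (up i t) (up k2 t) t'],
         pos [:: Strict i k2 t'; Strict (up i t') k1 t]).

(* As X i has distinct entries, sigma is determined by the two chains. *)
Inductive R_Sigma : set relator :=
| In_R_Sigma i k (t t' : 'I_(colours S)) (L : law (@arity S) t t') c c'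
    (sigma : 'S_(chain_len i c')) :
    lengths S r i -> (k < i)%N -> (t < t')%N -> sigma2 t t' = Some L ->
    law_chain (law_f L) k c -> law_chain (law_f' L) k c' ->
    chain_apply c (X i) = permute sigma (chain_apply c' (X i)) ->
    R_Sigma (pos (chain_gens i c),
             pos (rcons (chain_gens i c') (Perm _ sigma))).

Inductive R_PD : set relator :=
| In_R_PD i (sigma : 'S_i) (k : 'I_i) (t : 'I_(colours S))
    (sigma' : 'S_(up i t)) :
    lengths S r i ->
    expand t (sigma k) (permute sigma (X i)) =
      permute sigma' (expand t k (X i)) ->
    R_PD (pos [:: Perm i sigma; Strict i (sigma k) t],
          pos [:: Strict i k t; Perm (up i t) sigma']).

(* In MathComp, s1 * s2 is s1 followed by s2. *)
Inductive R_P : set relator :=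
| In_R_P i (s1 s2 : 'S_i) : lengths S r i ->
    R_P (pos [:: Perm i (s1 * s2)], pos [:: Perm i s1; Perm i s2]).

Definition relators : set relator :=
  R_T `|` R_D `|` R_Sigma `|` R_PD `|` R_P.

Definition truncated_gens (n : nat) : set (gen S) := gens r `&` @gen_le S n.

Definition truncated_relators (n : nat) : set relator :=
  relators `&` [set p | word_over (truncated_gens n) p.1 /\
                        word_over (truncated_gens n) p.2].

Definition gen_eval (g : gen S) : algebra_aut U :=
  match g with
  | Strict i k t => tuple_aut (X (up i t)) (expand t k (X i))
  | Perm i sigma => tuple_aut (X i) (permute sigma (X i))
  end.

End Relators.

(* Main.v *)
(* Topology enters only through a Cech argument. A rule sending the edges of a
   complex K to a group, multiplicative on the simplices, gives locally constant
   transition functions between the open stars of the vertices of |K|. By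
   Lebesgue's lemma a contraction of an edge loop can be cut into a grid of small
   squares, each lying in one star; hence when |K| is simply connected such a rule
   is a coboundary.

   For K = Z^n the rule takes values in the group Gam defined by the truncated
   presentation: an edge from A to B is sent to the class of any chain of
   operations leading from A to B. That this class does not depend on the chain is
   a diamond argument by induction on |B| - |A|. Two first steps at different
   entries commute (R_D); for two colours at the same entry, boundedness gives a
   least common expansion, and comparing multidegrees identifies it with the double
   expansion supplied by completeness, so R_Sigma applies; R_PD and R_P move the
   permutations out of the way.

   Write the rule as the coboundary of h. Since it is invariant under G, the map
   g |-> h(X_m)^-1 h(g X_m) is a morphism from G to Gam, and since h is constant
   along the tree it sends each generator to its class. It inverts the evaluation
   of words, which is therefore faithful; the connectedness of Z^n makes it onto.

   A tree as required is obtained by Kruskal's algorithm applied to the edges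
   ordered by their upper end: its truncations are spanning forests of the
   truncated graphs. *)

From HB Require Import structures.
From Stdlib Require Import Relation_Operators Operators_Properties.
From mathcomp Require Import all_boot all_order all_algebra all_fingroup.
From mathcomp Require Import zify.
From mathcomp Require Import all_classical all_reals all_analysis.
Require Import Defs.

Set Implicit Arguments.
Unset Strict Implicit.
Unset Printing Implicit Defensive.

Import Order.TTheory GRing.Theory Num.Theory.
Import numFieldNormedType.Exports.
Local Open Scope classical_set_scope.

(** What the truncation threatens is the diamond: a relator is available only if all the tuples it
    passes through have at most n entries. Sizes grow along expansions, so it is enough that the
    tuple where two first steps meet still expands to their common end B. This is why a least common
    expansion is needed, and not merely some common one. Bases are handled through the two halves of
    freeness, both tested on algebras that satisfy the laws. Validity supplies such an algebra with
    two distinct elements; homomorphisms to it, or to a variant that records how often each colour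
    is used, tell descending words of U apart. Completeness allows the colours of a descending word
    to be put in any order. Hence any two bases have a common expansion, which makes every basis
    admissible and fixes its cardinality modulo the gcd. *)

Lemma sval_eq (T : Type) (P : T -> Prop) (a b : {u | P u}) : sval a = sval b -> a = b.
Proof. by case: a b => [a Pa] [b Pb] /= ab; subst b; congr exist; exact: Prop_irrelevance. Qed.

(** * Trees of lengths *)

Section Walks.
Variable S : signature.
Notation edge := (nat * 'I_(colours S))%type.
Implicit Types (E F : set edge) (p q : seq (edge * bool)).

Definition top (e : edge) : nat := up e.1 e.2.
Definition src (a : edge * bool) : nat := if a.2 then a.1.1 else top a.1.
Definition dst (a : edge * bool) : nat := if a.2 then top a.1 else a.1.1.
Definition flip (a : edge * bool) : edge * bool := (a.1, ~~ a.2).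

Lemma up_gt (i : nat) (t : 'I_(colours S)) : (i < up i t)%N.
Proof. by rewrite /up; have := arity_gt1 t; lia. Qed.

Lemma up_add (i : nat) (t : 'I_(colours S)) : up i t = (i + (arity t).-1)%N.
Proof. by rewrite /up; have := arity_gt1 t; lia. Qed.

Lemma walk_cons E u a p v :
  walk E u (a :: p) v <-> [/\ E a.1, u = src a & walk E (dst a) p v].
Proof. by case: a => -[i t] []. Qed.

Lemma walk_cat E u p q v :
  walk E u (p ++ q) v <-> exists w, walk E u p w /\ walk E w q v.
Proof.
elim: p u => [|a p IH] u /=; first by split=> [|[w [-> //]]]; exists u.
rewrite -!/(walk E u (a :: _) _); split.
  by move=> /walk_cons[Ea -> /IH[w [h1 h2]]]; exists w; split=> //; apply/walk_cons.
move=> [w [/walk_cons[Ea -> h1] h2]]; apply/walk_cons; split=> //.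
by apply/IH; exists w.
Qed.

Lemma walk_sub E F u p v :
  (forall e, e \in map fst p -> E e -> F e) -> walk E u p v -> walk F u p v.
Proof.
elim: p u => [//|a p IH] u EF /walk_cons[Ea -> h]; apply/walk_cons; split=> //.
  by apply: EF => //; rewrite inE eqxx.
by apply: IH h => e ep; apply: EF; rewrite inE ep orbT.
Qed.

Lemma walk_edge E u p v : walk E u p v -> forall e, e \in map fst p -> E e.
Proof.
elim: p u => [//|a p IH] u /walk_cons[Ea _ h] e.
by rewrite inE => /orP[/eqP-> //|/(IH _ h)].
Qed.

Lemma walk_rev E u p v : walk E u p v -> walk E v (rev (map flip p)) u.
Proof.
elim: p u => [|a p IH] u; first by move=> /= ->.
move=> /walk_cons[Ea -> /IH h]; rewrite /= rev_cons -cats1; apply/walk_cat.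
by exists (dst a); split=> //; apply/walk_cons; case: a Ea {h} => e [].
Qed.

Definition turn : rel (edge * bool) := fun a b => ~~ ((a.1 == b.1) && (a.2 != b.2)).

Lemma reduced_rev p : reduced p -> reduced (rev (map flip p)).
Proof.
rewrite /reduced rev_sorted sorted_map; apply: sub_sorted => a b /=.
by rewrite eq_sym; case: a b => e [] [e' []].
Qed.

Lemma not_reducedP p : ~~ reduced p ->
  exists p1 a p2, p = p1 ++ [:: a, flip a & p2].
Proof.
elim: p => [//|a [//|b p] IH]; rewrite /reduced /= negb_and.
case/orP => [|/IH [p1 [c [p2 ->]]]]; last by exists (a :: p1), c, p2.
rewrite negbK => /andP[/eqP h1 h2]; exists [::], a, p; rewrite /= /flip.
by case: a b {IH} h1 h2 => e [] [e' []] //= ->.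
Qed.

Lemma walk_reduce E u p v : walk E u p v -> exists2 q, walk E u q v & reduced q.
Proof.
have [n] := ubnP (size p); elim: n p => // n IH p sp w.
have [|/not_reducedP[p1 [a [p2 pE]]]] := boolP (reduced p); first by exists p.
apply: (IH (p1 ++ p2)); first by move: sp; rewrite pE !size_cat /=; lia.
move: w; rewrite pE => /walk_cat[w [h1 /walk_cons[_ wE /walk_cons[_ _ h2]]]].
apply/walk_cat; exists w; split=> //; rewrite wE.
by case: a h2 {wE pE} => e [].
Qed.

Lemma first_occurrence e p : e \in map fst p ->
  exists p1 b p2, p = p1 ++ (e, b) :: p2 /\ e \notin map fst p1.
Proof.
elim: p => [//|[e' b] p IH]; rewrite inE /=.
have [<- _|ne /IH [p1 [b' [p2 [-> h]]]]] := eqVneq e e'; first by exists [::], b, p.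
by exists ((e', b) :: p1), b', p2; rewrite /= inE negb_or ne h.
Qed.

(** Used with a Boolean [chi], the side of a cut, and with [chi] the potential of the lifted
    tuples. *)
Lemma walk_constant (T : Type) E u p v (chi : nat -> T) :
  (forall e, e \in map fst p -> E e -> chi e.1 = chi (top e)) ->
  walk E u p v -> chi u = chi v.
Proof.
elim: p u => [_ _ -> //|[e b] p IH] u h /walk_cons[Ea -> w].
rewrite -(IH _ _ w) => [|e' e'p]; last by apply: h; rewrite inE e'p orbT.
by have := h e; rewrite inE eqxx => /(_ isT Ea); clear; case: b.
Qed.

(* Testing each edge against the edges whose top is not above its own is enough
   for acyclicity: apply it to the highest edge of a closed walk. *)
Definition cuts E : Prop := forall e, E e -> exists chi : nat -> bool,
  chi e.1 != chi (top e) /\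
  forall e', E e' -> e' <> e -> (top e' <= top e)%N -> chi e'.1 = chi (top e').

Lemma max_top p : p != [::] -> exists2 e, e \in map fst p &
  forall e', e' \in map fst p -> (top e' <= top e)%N.
Proof.
elim: p => [//|[e b] [|a p] IH] _.
  by exists e; rewrite ?inE ?eqxx // => e'; rewrite inE => /eqP->.
have [//|e1 e1p h] := IH; have [le|lt] := leqP (top e) (top e1).
  exists e1; first by rewrite inE e1p orbT.
  by move=> e'; rewrite [_ \in _]inE => /orP[/eqP->//|/h].
exists e; first by rewrite inE eqxx.
move=> e'; rewrite [_ \in _]inE => /orP[/eqP->//|/h h'].
exact: leq_trans h' (ltnW lt).
Qed.

(* A closed walk crosses the cut of its highest edge twice, and between two
   consecutive crossings it is a shorter closed walk. *)
Lemma closed_reduced E u p : cuts E -> walk E u p u -> reduced p -> p = [::].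
Proof.
move=> cE; have [n] := ubnP (size p); elim: n p u => // n IH p u sp w red.
apply: contrapT => /eqP pN; have [e ep emax] := max_top pN.
have [chi [chie chiE]] := cE e (walk_edge w ep).
have cst q : e \notin map fst q -> {subset map fst q <= map fst p} ->
    forall x y, walk E x q y -> chi x = chi y.
  move=> eq qp x y; apply: walk_constant => e' e'q Ee'; apply: chiE => //.
    by move=> e'e; rewrite -e'e e'q in eq.
  exact/emax/qp.
have [p1 [b [p2 [pE e1]]]] := first_occurrence ep.
move: w; rewrite pE => /walk_cat[x [w1 /walk_cons[_ xE w2]]].
have chiu : chi u = chi (src (e, b)).
  by rewrite -xE; apply: cst w1 => // z; rewrite pE map_cat mem_cat => ->.
have sub2 : {subset map fst p2 <= map fst p}.
  by move=> z; rewrite pE map_cat mem_cat inE => ->; rewrite !orbT.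
have chine : chi (src (e, b)) != chi (dst (e, b)).
  by rewrite /src /dst /=; case: (b) => //; rewrite eq_sym.
have [e2|e2] := boolP (e \in map fst p2); last first.
  by move: chine; rewrite -chiu (cst _ e2 sub2 _ _ w2) eqxx.
have [q [b' [q' [p2E eq]]]] := first_occurrence e2.
move: w2; rewrite p2E => /walk_cat[y [w2 /walk_cons[_ yE w3]]].
have chiq : chi (dst (e, b)) = chi (src (e, b')).
  rewrite -yE; apply: cst w2 => // z zq; apply: sub2.
  by rewrite p2E map_cat mem_cat zq.
have bb' : b' = ~~ b.
  move: chine chiq; rewrite /src /dst /=.
  by case: (b) (b') => [] [] //= /eqP h h'; case: h.
(* The walk [q] is closed at one end of [e] and shorter than [p], hence empty; then [e] is followed
   by its own reversal, against [red]. *)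
have q0 : q = [::].
  apply: (IH q (dst (e, b))).
  - by move: sp; rewrite pE p2E !size_cat /= !size_cat /=; clear; lia.
  - by move: w2; rewrite yE bb'; case: (b).
  - move: red; rewrite pE p2E /reduced => /cat_sorted2[_ /=].
    by rewrite cat_path => /andP[/path_sorted].
move: red; rewrite pE p2E q0 bb' /reduced => /cat_sorted2[_ /=].
by rewrite eqxx; case: (b).
Qed.

(** Where two reduced walks with the same ends part, one reversed and followed by the other is a
    nonempty closed reduced walk, against [closed_reduced]. *)
Lemma reduced_walk_uniq E u v p q : cuts E ->
  walk E u p v -> walk E u q v -> reduced p -> reduced q -> p = q.
Proof.
move=> cE; elim: p u q => [|a p IH] u q wp wq rp rq.
  by move: wp => /= uv; rewrite (@closed_reduced E u q) // {2}uv.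
case: q wq rq => [|a' q] wq rq.
  by move: wq => /= uv; apply: (@closed_reduced E u) => //; rewrite {2}uv.
have [aa'|/eqP aa'] := eqVneq a a'.
  subst a'; move/walk_cons: wp => [_ _ wp]; move/walk_cons: wq => [_ _ wq].
  by congr cons; apply: (IH (dst a)) => //; apply: path_sorted; [exact: rp|exact: rq].
have w := walk_rev wp.
suff /(congr1 size) : rev (map flip (a :: p)) ++ a' :: q = [::].
  by rewrite size_cat /= addnS.
apply: (@closed_reduced E v) => //; first by apply/walk_cat; exists u.
have := reduced_rev rp; rewrite /reduced /= rev_cons.
case sE : (rcons _ _) => [|y s]; first by move/(congr1 size): sE; rewrite size_rcons.
rewrite /= cat_path => -> /=.
have -> : last y s = flip a by move/(congr1 (last y)): sE; rewrite last_rcons.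
rewrite -/(reduced (a' :: q)) andbC; apply/andP; split; first exact: rq.
apply/negP => /andP[/eqP h1 h2]; apply: aa'; move: h1 h2; rewrite /flip.
by case: (a) (a') => e [] [e' []] //= ->.
Qed.

End Walks.

(** * Kruskal's tree on the set of lengths *)

Section SpanningTree.
Variables (S : signature) (r : nat).
Notation edge := (nat * 'I_(colours S))%type.
Notation L := (lengths S r).

Definition below (m : nat) : set edge := [set e : edge | L e.1 /\ (top e < m)%N].

Definition conn (m u v : nat) : Prop := exists p, walk (below m) u p v.

Lemma lengths_add (i a : nat) :
  (\big[gcdn/0%N]_(t < colours S) (arity t).-1 %| a)%N -> L i -> L (i + a)%N.
Proof.
move=> da [i0 ir]; split; first by rewrite ltn_addr.
by rewrite -ir -modnDmr (eqP da) addn0.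
Qed.

Lemma lengths_up (i : nat) (t : 'I_(colours S)) : L i -> L (up i t).
Proof. by rewrite up_add; apply/lengths_add/biggcdn_inf/dvdnn. Qed.

Lemma conn_refl m u : conn m u u. Proof. by exists [::]. Qed.

Lemma conn_sym m u v : conn m u v -> conn m v u.
Proof. by move=> [p /walk_rev h]; eexists; exact: h. Qed.

Lemma conn_trans m u v w : conn m u v -> conn m v w -> conn m u w.
Proof. by move=> [p hp] [q hq]; exists (p ++ q); apply/walk_cat; exists v. Qed.

Lemma conn_edge m (e : edge) : L e.1 -> (top e < m)%N -> conn m e.1 (top e).
Proof. by move=> Le em; exists [:: (e, true)]; apply/walk_cons. Qed.

Lemma conn_le m m' u v : (m <= m')%N -> conn m u v -> conn m' u v.
Proof.
move=> mm' [p h]; exists p; apply: walk_sub h => e _ [? ?]; split=> //.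
exact: leq_trans mm'.
Qed.

(** Colours are smaller than [colours S], so this offset separates the two classes of edges;
    together with the top, the key determines the edge. *)
Definition key (i : nat) (t : 'I_(colours S)) : nat :=
  ((if `[< reachable S r i >] then 0 else colours S) + t)%N.

(* Kruskal's algorithm, with the edges ordered by their top vertex and, for a
   given top vertex, those with a reachable bottom vertex first. *)
Definition kruskal : set edge := [set e : edge | L e.1 /\
  forall e' : edge, L e'.1 -> top e' = top e -> (key e'.1 e'.2 < key e.1 e.2)%N ->
    ~ conn (top e) e'.1 e.1].

Lemma top_inj (i i' : nat) (t : 'I_(colours S)) : up i t = up i' t -> i = i'.
Proof. by rewrite !up_add => /addIn. Qed.

Lemma key_inj (e e' : edge) : top e = top e' -> key e.1 e.2 = key e'.1 e'.2 -> e = e'.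
Proof.
case: e e' => [i t] [i' t']; rewrite /top /key /= => E kE.
have /val_inj tt' : val t = val t'.
  by move: kE (ltn_ord t) (ltn_ord t') => /=; do 2 case: asboolP => _; lia.
by subst t'; rewrite (top_inj E).
Qed.

(** The cut of [e] is the component of its bottom in the graph of the edges with a lower top. No
    edge with a lower top crosses it. Another accepted edge with the same top cannot start in it:
    whichever of the two has the larger key would have been rejected. *)
Lemma kruskal_cuts : cuts kruskal.
Proof.
move=> e [Le eK]; have lt_e e' : (e'.1 < top e')%N by exact: up_gt.
exists (fun v => `[< (v < top e)%N /\ conn (top e) v e.1 >]); split.
  rewrite (_ : `[< _ >] = true); last first.
    by apply/asboolP; split; [exact: lt_e|exact: conn_refl].
  by apply/eqP => /esym/asboolP[]; rewrite ltnn.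
move=> e' [Le' eK'] e'e; rewrite leq_eqVlt => /orP[/eqP ee'|lt].
  apply/asboolP/asboolP => -[h1 h2]; exfalso; last by rewrite ee' ltnn in h1.
  have [lt|lt|eq] := ltngtP (key e'.1 e'.2) (key e.1 e.2).
  - exact: eK lt h2.
  - by apply: eK' lt _ => //; rewrite ee'; exact: conn_sym.
  - exact/e'e/key_inj.
have c := conn_edge Le' lt; apply/asboolP/asboolP => -[h1 h2]; split=> //.
- exact: conn_trans (conn_sym c) h2.
- by apply: ltn_trans lt; exact: lt_e.
- exact: conn_trans h2.
Qed.

Lemma walk_glue (E F : set edge) u p v :
  (forall e, E e -> exists q, walk F e.1 q (top e)) ->
  walk E u p v -> exists q, walk F u q v.
Proof.
move=> EF; elim: p u => [|[e b] p IH] u; first by exists [::].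
move=> /walk_cons[/= /EF[q hq] -> /IH[q' hq']]; case: b hq' => hq'.
  by exists (q ++ q'); apply/walk_cat; exists (top e).
by exists (rev (map (@flip S) q) ++ q'); apply/walk_cat; exists e.1; split=> //;
  apply: walk_rev.
Qed.

(** Induction on the bound: an edge is replaced by the edge of least key among those with the same
    top whose bottom lies in the same component. That edge is accepted, and the two bottoms are
    joined by edges with a lower top. *)
Lemma kruskal_conn m u v : conn m u v ->
  exists p, walk (kruskal `&` [set e : edge | (top e < m)%N]) u p v.
Proof.
move=> [p]; apply: walk_glue => e [Le]; elim/ltn_ind: m e Le => m IH e Le em.
pose P k := `[< exists e', [/\ k = key e'.1 e'.2, L e'.1, top e' = top e
  & conn (top e) e'.1 e.1] >].
have exP : exists k, P k.
  by exists (key e.1 e.2); apply/asboolP; exists e; split=> //; exact: conn_refl.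
case: (ex_minnP exP) => k /asboolP[e' [-> Le' te' ce']] kmin.
have Ke' : kruskal e'.
  split=> // e2 Le2 te2 lt c2; suff /kmin : P (key e2.1 e2.2) by rewrite leqNgt lt.
  apply/asboolP; exists e2; split=> //; first by rewrite te2.
  by apply: conn_trans ce'; rewrite -te'.
have [q hq] : exists q, walk (kruskal `&` [set e : edge | (top e < m)%N]) e.1 q e'.1.
  case: (conn_sym ce') => q; apply: walk_glue => e2 [Le2 te2].
  have [q' hq'] := IH _ em _ Le2 te2; exists q'; apply: walk_sub hq' => e3 _ [? h].
  by split=> //; exact: ltn_trans h em.
exists (q ++ [:: (e', true)]); apply/walk_cat; exists e'.1; split=> //.
by apply/walk_cons; split=> //=; rewrite te'.
Qed.

Lemma kruskal_top e : kruskal e -> L e.1 /\ L (top e).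
Proof. by move=> [Le _]; split=> //; exact: lengths_up. Qed.

Lemma kruskal_is_tree (V : set nat) (F : set edge) :
  (forall e, (kruskal `&` F) e -> V e.1 /\ V (top e)) ->
  (forall u v, V u -> V v -> exists p, walk (kruskal `&` F) u p v) ->
  is_tree V (kruskal `&` F).
Proof.
move=> VF cV; split=> // u v Vu Vv; have [p /walk_reduce[q wq rq]] := cV u v Vu Vv.
exists q; split=> // q' [wq' rq'].
apply: (reduced_walk_uniq kruskal_cuts _ _ rq rq').
  by apply: walk_sub wq => e _ [].
by apply: walk_sub wq' => e _ [].
Qed.

Lemma kruskal_truncated n :
  (forall u v, L u -> L v -> (u <= n)%N -> (v <= n)%N -> conn n.+1 u v) ->
  truncated_tree r n kruskal.
Proof.
move=> c; apply: kruskal_is_tree.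
  move=> e [/kruskal_top[L1 L2] /= en]; do !split=> //.
  exact: leq_trans (ltnW (up_gt _ _)) en.
move=> u v [Lu un] [Lv vn]; have [p hp] := kruskal_conn (c u v Lu Lv un vn).
by exists p.
Qed.

(** * Non-negative combinations of the numbers n_t - 1 *)

Notation gcd := (\big[gcdn/0%N]_(t < colours S) (arity t).-1).
Definition combination : set nat :=
  [set m | exists c : 'I_(colours S) -> nat, m = (\sum_t c t * (arity t).-1)%N].

Lemma combination0 : combination 0.
Proof. by exists (fun=> 0%N); rewrite big1. Qed.

Lemma combinationD a b : combination a -> combination b -> combination (a + b).
Proof.
move=> [c ->] [c' ->]; exists (fun t => c t + c' t)%N.
by rewrite -big_split; apply: eq_bigr => t _; rewrite mulnDl.
Qed.

Lemma combinationM k a : combination a -> combination (k * a).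
Proof.
move=> [c ->]; exists (fun t => k * c t)%N.
by rewrite big_distrr; apply: eq_bigr => t _ /=; rewrite mulnA.
Qed.

Lemma combination1 (t : 'I_(colours S)) : combination (arity t).-1.
Proof.
exists (fun t' => (t' == t) : nat); rewrite (bigD1 t) //= eqxx mul1n big1 ?addn0 //.
by move=> t' /negPf ->.
Qed.

(** Bezout without subtraction: the gcd is a difference of two combinations, a property which passes
    from two numbers to their gcd. *)
Lemma combination_gcd : exists y, combination y /\ combination (y + gcd).
Proof.
apply: (big_ind (fun g => exists y, combination y /\ combination (y + g))).
- by exists 0%N; split; exact: combination0.
- move=> g g' [y [hy hyg]] [y' [hy' hyg']].
  have [->|g0] := posnP g; first by rewrite gcd0n; exists y'.
  case: (egcdnP g' g0) => u v E _.
  exists (u * y + v * (y' + g'))%N; split.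
    by apply: combinationD; apply: combinationM.
  rewrite (_ : (_ + gcdn g g' = u * (y + g) + v * y')%N); last first.
    by rewrite !mulnDr E; lia.
  by apply: combinationD; apply: combinationM.
- by move=> t _; exists 0%N; split; [exact: combination0|exact: combination1].
Qed.

Lemma gcd_combination a : combination a -> (gcd %| a)%N.
Proof.
move=> [c ->]; apply: dvdn_sum => t _; apply: dvdn_mull.
exact: biggcdn_inf (dvdnn _).
Qed.

(** Let y and y + gcd be combinations, with y = q gcd. If M is at least q^2, then M gcd is the sum
    of M mod q copies of y + gcd and of M div q - M mod q copies of y; the latter number is not
    negative because M div q is at least q. *)
Lemma large_combination : exists N, forall m, (N <= m)%N -> (gcd %| m)%N ->
  combination m.
Proof.
have [y [hy hyg]] := combination_gcd.
have [g0|g0] := posnP gcd.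
  by exists 0%N => m _; rewrite g0 dvd0n => /eqP->; exact: combination0.
have /dvdnP[q yE] := gcd_combination hy.
have [q0|q0] := posnP q.
  exists 0%N => m _ /dvdnP[k ->]; apply: combinationM.
  by move: hyg; rewrite yE q0.
exists (q * q * gcd)%N => m hm /dvdnP[M mE].
have Mq : (q * q <= M)%N by move: hm; rewrite mE leq_pmul2r.
have rq := ltn_pmod M q0.
have qM : (M %% q <= M %/ q)%N.
  by rewrite (leq_trans (ltnW rq)) // leq_divRL.
have -> : m = ((M %/ q - M %% q) * y + (M %% q) * (y + gcd))%N.
  rewrite mulnDr addnA -mulnDl subnK // yE mulnA -mulnDl.
  by rewrite mE; congr muln; exact: divn_eq.
by apply: combinationD; apply: combinationM.
Qed.

Lemma combination_conn i a : L i -> combination a -> conn (i + a).+1 i (i + a).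
Proof.
move=> Li [c ->]; move: {2}(\sum_t c t)%N (erefl (\sum_t c t)%N) => n.
elim: n c => [|n IH] c cn.
  rewrite big1 ?addn0; first exact: conn_refl.
  move=> t _; have /eqP := cn; rewrite sum_nat_eq0 => /forallP/(_ t)/eqP -> //.
have [t ct] : exists t, (0 < c t)%N.
  apply: contrapT => h; have : (\sum_t c t = 0)%N.
    apply: big1 => t _; apply/eqP; rewrite -leqn0 leqNgt; apply/negP => ct.
    by apply: h; exists t.
  by rewrite cn.
pose c' t' := (c t' - (t' == t))%N.
have cE t' : c t' = (c' t' + (t' == t))%N.
  by rewrite /c' subnK //; case: eqP => [->|].
have sE f : (\sum_t' c t' * f t' = \sum_t' c' t' * f t' + f t)%N.
  under eq_bigr => t' _ do rewrite cE mulnDl.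
  rewrite big_split /=; congr addn; rewrite (bigD1 t) //= eqxx mul1n big1 ?addn0 //.
  by move=> t' /negPf ->.
rewrite sE addnA; apply: conn_trans (conn_le _ (IH c' _)) _.
- by rewrite ltnS leq_addr.
- by have := sE (fun=> 1%N); rewrite -!big_distrl /= !muln1 cn addn1 => -[].
rewrite -up_add; apply: (conn_edge (e := (_, t))) => //=.
by apply: lengths_add => //; apply: gcd_combination; exists c'.
Qed.

Lemma reachableE (m : nat) : reachable S r m <-> exists2 a, combination a & m = (r + a)%N.
Proof.
by split=> [[c ->]|[_ [c ->] ->]]; [eexists; first by exists c|exists c].
Qed.

Lemma large_reachable : exists N, forall m, (N <= m)%N -> L m -> reachable S r m.
Proof.
have [N hN] := large_combination; exists (N + r)%N => m Nm [_ mr].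
have rm : (r <= m)%N by apply: leq_trans Nm; rewrite leq_addl.
apply/reachableE; exists (m - r)%N; last by rewrite subnKC.
apply: hN; first by rewrite leq_subRL // addnC.
by rewrite -eqn_mod_dvd // mr.
Qed.

Lemma reachable_lengths m : (0 < r)%N -> reachable S r m -> L m.
Proof.
by move=> r0 /reachableE[a /gcd_combination ha ->]; exact: lengths_add.
Qed.

(** Both lengths lead upwards to u + (v + N) gcd: it is congruent to both, and the factor v + N
    makes it exceed each of them by at least N. *)
Lemma lengths_conn u v : L u -> L v -> exists m, conn m u v.
Proof.
move=> Lu Lv; have [N hN] := large_combination.
have uv : u = v %[mod gcd] by rewrite Lu.2 Lv.2.
have [g0|g0] := posnP gcd.
  by exists 0%N; move: uv; rewrite g0 !modn0 => ->; exact: conn_refl.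
have le : (v + N <= u + (v + N) * gcd)%N by rewrite (leq_trans _ (leq_addl _ _)) ?leq_pmulr.
exists (u + (v + N) * gcd).+1; apply: conn_trans (combination_conn Lu _) _.
  by apply: hN; [rewrite (leq_trans (leq_addl v N)) ?leq_pmulr|exact: dvdn_mull].
apply: conn_sym; rewrite -(@subnKC v (u + _)); last exact: leq_trans (leq_addr _ _) le.
apply: combination_conn => //; apply: hN.
  by rewrite leq_subRL // (leq_trans (leq_addr _ _) le).
by rewrite -eqn_mod_dvd ?(leq_trans (leq_addr _ _) le) // addnC modnMDl uv.
Qed.

(** Among the edges with top [m] and a reachable bottom, the one of least colour precedes every
    other edge with this top, so Kruskal's algorithm accepts it. The first component of [key] is
    there for this. *)
Lemma reachable_edge m : (0 < r)%N -> reachable S r m -> m != r ->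
  exists e : edge, [/\ kruskal e, top e = m & reachable S r e.1].
Proof.
move=> r0 [c mE] mr.
pose P k := `[< exists e : edge, [/\ val e.2 = k, top e = m & reachable S r e.1] >].
have exP : exists k, P k.
  have [t ct] : exists t, (0 < c t)%N.
    apply: contrapT => h; have : (\sum_t c t * (arity t).-1 = 0)%N.
      apply: big1 => t _; rewrite (_ : c t = 0)%N //.
      by apply/eqP; rewrite -leqn0 leqNgt; apply/negP => ct; apply: h; exists t.
    by move=> s0; move: mr; rewrite mE s0 addn0 eqxx.
  exists (val t); apply/asboolP; exists ((r + \sum_t' (c t' - (t' == t)) * (arity t').-1)%N, t).
  split=> //=; last by exists (fun t' => c t' - (t' == t))%N.
  rewrite /top up_add /= mE -addnA; congr addn.
  rewrite (bigD1 t) //= [RHS](bigD1 t) //= eqxx addnAC -[X in _ + X + _ = _]mul1n -mulnDl subnK //.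
  by congr addn; apply: eq_bigr => t' /negPf ->; rewrite subn0.
case: (ex_minnP exP) => k /asboolP[e [ek em er]] kmin; exists e; split=> //.
have kE : key e.1 e.2 = k by rewrite /key (introT (asboolP _) er).
split=> [|e' _ te']; first exact: reachable_lengths.
rewrite kE /key; case: asboolP => [re' /= lt|_ lt].
  suff /kmin : P (val e'.2) by rewrite leqNgt lt.
  by apply/asboolP; exists e'; rewrite te'.
by have := ltn_ord e.2; move: lt; rewrite -ek /=; clear; lia.
Qed.

Lemma reachable_walk m : (0 < r)%N -> reachable S r m ->
  exists p, walk kruskal r p m /\ all (fun a : edge * bool => a.2) p.
Proof.
move=> r0; elim/ltn_ind: m => m IH rm.
have [->|mr] := eqVneq m r; first by exists [::].
have [e [Ke em re]] := reachable_edge r0 rm mr.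
have [|p [wp ap]] := IH e.1 _ re; first by rewrite -em; exact: up_gt.
exists (p ++ [:: (e, true)]); split; last by rewrite all_cat ap.
by apply/walk_cat; exists e.1; split=> //; apply/walk_cons; split=> //=; rewrite em.
Qed.

Lemma kruskal_maximal : (0 < r)%N -> maximal_tree r kruskal.
Proof.
move=> r0; split.
- rewrite -[kruskal]setIT; apply: kruskal_is_tree => [e [/kruskal_top //]|u v Lu Lv].
  have [m /kruskal_conn[p hp]] := lengths_conn Lu Lv.
  by exists p; apply: walk_sub hp => e _ [].
- by move=> m; exact: reachable_walk.
(* Beyond this bound a length is reachable and different from [r], hence the top of a tree edge and
   not a root. *)
have [N hN] := large_reachable; apply: (@sub_finite_set _ _ `I_(maxn N r.+1)).
  move=> i [Li hi] /=; rewrite ltnNge; apply/negP; rewrite geq_max => /andP[Ni ri].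
  have [|e [Ke ei _]] := reachable_edge r0 (hN i Ni Li).
    by rewrite neq_ltn ri orbT.
  exact: hi ei.
exact: finite_II.
Qed.

End SpanningTree.
(** * Cocycles on simply connected complexes *)

Lemma within_comp (R : realType) (T : topologicalType) (A B : set R)
    (f : R -> R) (g : R -> T) :
  continuous f -> (forall x, A x -> B (f x)) -> {within B, continuous g} ->
  {within A, continuous (g \o f)}.
Proof.
move=> cf AB /subspace_continuousP cg; apply/subspace_continuousP => x Ax W.
move=> /(cg _ (AB _ Ax)); rewrite /within /= !nbhs_nearE => h.
have /(_ _ h) := cf x; rewrite nbhs_simpl /=.
by apply: filterS => z hz /AB; exact: hz.
Qed.

(** * Open stars and edges in the realization *)

Section Stars.
Local Open Scope ring_scope.
Variables (R : realType) (V : eqType) (K : complex V).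
Notation T := (realization R K).
Notation I01 := (`[0, 1]%classic).

Definition supp (p : T) : seq V := unzip1 (rpoint p).

Lemma realization_eq (p q : T) : rpoint p = rpoint q -> p = q.
Proof.
by case: p q => [p p1 p2 p3] [q q1 q2 q3] /= pq; subst q; congr Realization;
  exact: Prop_irrelevance.
Qed.

Lemma supp_neq0 (p : T) : exists v, v \in supp p.
Proof.
have := rpoint_sum p; rewrite /supp; case: (rpoint p) => [|[v w] s] /=.
  by rewrite big_nil => /esym/eqP; rewrite oner_eq0.
by exists v; rewrite inE eqxx.
Qed.

Lemma weightsE (c : seq V) (t : 'rV[R]_(size c)) :
  weights t = [seq (tnth (in_tuple c) i, t ord0 i) | i <- enum 'I_(size c)].
Proof.
have {1}-> : weights t = zip (map (tnth (in_tuple c)) (enum 'I_(size c)))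
    [seq t ord0 i | i <- enum 'I_(size c)] by rewrite map_tnth_enum.
by rewrite zip_map.
Qed.

Lemma mem_support_weights (c : seq V) (t : 'rV[R]_(size c)) v :
  v \in unzip1 (support_weights t) <->
  exists i, tnth (in_tuple c) i = v /\ 0 < t ord0 i.
Proof.
rewrite /support_weights weightsE; split.
  move=> /mapP[p]; rewrite mem_filter => /andP[p0 /mapP[i _ pE]] ->.
  by exists i; move: p0; rewrite pE.
move=> [i [<- ti]]; apply/mapP; exists (tnth (in_tuple c) i, t ord0 i) => //.
by rewrite mem_filter ti; apply/mapP; exists i; rewrite ?mem_enum.
Qed.

Lemma star_open v : open [set p : T | v \in supp p].
Proof.
(* A vertex may occur several times in [c]; one of its coordinates has to be positive. *)
move=> c Kc; exists (\bigcup_(i in [set i | tnth (in_tuple c) i = v])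
  [set t : 'rV[R]_(size c) | 0 < t ord0 i]).
  apply: bigcup_open => i _.
  apply: (@open_comp _ _ (fun t : 'rV[R]_(size c) => t ord0 i) [set x | 0 < x]).
    by move=> t _; exact: coord_continuous.
  exact: open_gt.
move=> t tD; rewrite /= /supp /=; split=> [/mem_support_weights[i [iv ti]]|[i iv ti]].
  by exists i.
by apply/mem_support_weights; exists i.
Qed.

(** Compactness of the square in its near-covering form: around [q0] a ball is mapped into one star,
    and half of its radius is kept for the step from [q] to [q']. *)
Lemma lebesgue_stars (H : R * R -> T) :
  {within I01 `*` I01, continuous H} ->
  \forall N \near \oo, forall q, (I01 `*` I01) q -> exists v,
    forall q', (I01 `*` I01) q' -> `|q.1 - q'.1| <= N.+1%:R^-1 ->
    `|q.2 - q'.2| <= N.+1%:R^-1 -> v \in supp (H q').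
Proof.
move=> /subspace_continuousP cH.
have cpt : compact (I01 `*` I01 : set (R * R)).
  by apply: compact_setX; exact: segment_compact.
move/compact_near_coveringP/near_covering_withinP : cpt; apply => q0 q0s.
have [v vq0] := supp_neq0 (H q0).
have /(cH _ q0s) : nbhs (H q0) [set p : T | v \in supp p].
  by apply: open_nbhs_nbhs; split=> //; exact: star_open.
move=> /nbhs_ballP[e /= e0 he].
have e20 : 0 < e / 2 by rewrite divr_gt0.
exists (ball q0 (e / 2), [set N | N.+1%:R^-1 < e / 2 :> R]).
  by split; [exact: nbhsx_ballx|exact: (near_infty_natSinv_lt (PosNum e20))].
move=> [q N] [[h1 h2] hN] _; exists v => q' q's l1 l2; apply: he q's.
by split; rewrite [e]splitr; [apply: (ball_triangle h1)|apply: (ball_triangle h2)];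
  rewrite /ball /=; exact: le_lt_trans hN.
Qed.

Definition adjacent u v : Prop := exists2 c, simplex K c & (u \in c) /\ (v \in c).

Lemma simplex_subseq c d : simplex K c -> subseq d c -> d <> [::] -> simplex K d.
Proof. by move=> Kc /subseqP[m _ ->]; exact: simplex_face. Qed.

Lemma vertex_point c u : simplex K c -> u \in c -> exists p : T, rpoint p = [:: (u, 1)].
Proof.
move=> Kc uc; have K1 : simplex K (unzip1 [:: (u, 1 : R)]).
  by apply: simplex_subseq Kc _ _ => //; rewrite sub1seq.
have p0 : all (fun p => 0 < p.2) [:: (u, 1 : R)] by rewrite /= ltr01.
have p1 : \sum_(p <- [:: (u, 1 : R)]) p.2 = 1 by rewrite big_seq1.
by exists (Realization K1 p0 p1).
Qed.

Definition is_segment u v (e : R -> T) : Prop :=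
  [/\ {within I01, continuous e}, rpoint (e 0) = [:: (u, 1)],
      rpoint (e 1) = [:: (v, 1)]
    & forall s : R, I01 s -> {subset supp (e s) <= [:: u; v]}].

Lemma segment_rev u v e : is_segment u v e -> is_segment v u (e \o (fun s => 1 - s)).
Proof.
move=> [ce e0 e1 es].
have I (s : R) : I01 s -> I01 (1 - s).
  by rewrite /= !in_itv /= subr_ge0 lerBlDr lerDl andbC.
split; rewrite /= ?subr0 ?subrr //; last first.
  by move=> s /I /es h x /h; rewrite !inE orbC.
by apply: (within_comp _ I) => // s; apply: continuousB; [exact: cvg_cst|exact: cvg_id].
Qed.

Lemma segment_simplex u v : simplex K [:: u; v] -> exists e, is_segment u v e.
Proof.
move=> Kc; pose c := [:: u; v].
pose w (s : R) : 'rV[R]_(size c) := \row_i (if i == ord0 then 1 - s else s).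
have wE (s : R) : I01 s -> std_simplex (w s).
  rewrite /= in_itv /= => /andP[s0 s1]; split=> [i|].
    by rewrite mxE; case: ifP; rewrite ?subr_ge0.
  by rewrite !big_ord_recl big_ord0 !mxE /= addr0 subrK.
have [p0 _] := vertex_point (u := u) Kc (mem_head _ _).
(* Outside of [0, 1] the weights are not barycentric coordinates, and the constant [p0] is a
   default. *)
pose e s : T := if pselect (std_simplex (w s)) is left h
  then characteristic_map Kc h else p0.
have eE s (h : std_simplex (w s)) : e s = characteristic_map Kc h.
  by rewrite /e; case: pselect => // h'; congr characteristic_map; exact: Prop_irrelevance.
have I0 : I01 (0 : R) by rewrite /= in_itv /= lexx ler01.
have I1 : I01 (1 : R) by rewrite /= in_itv /= lexx ler01.
have wtE s : weights (w s) = [:: (u, 1 - s); (v, s)].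
  rewrite weightsE !enum_ordSl /= enum_ord0 /= !mxE /=.
  by rewrite !(tnth_nth u).
exists e; split.
- apply/subspace_continuousP => s sI A [B [oB Bs BA]].
  have [W oW hW] := oB _ Kc; have ws := wE _ sI.
  have : W (w s) by apply/(hW _ ws); rewrite -eE.
  move=> Ww; have : nbhs (w s) W by apply: open_nbhs_nbhs.
  move=> /nbhs_ballP[d /= d0 dW]; rewrite /within /= nbhs_simpl /=.
  apply/nbhs_ballP; exists d => //= z zs zI; apply: BA; change (B (e z)).
  rewrite (eE _ (wE _ zI)); apply/hW/dW; split=> // i j; rewrite !mxE; case: ifP => // _.
  move: zs; rewrite /ball /= (_ : 1 - s - (1 - z) = - (s - z)) ?normrN //.
  by rewrite opprB opprB addrC addrA subrK.
- rewrite (eE _ (wE _ I0)) /= /support_weights wtE /= subr0 ltr01 ltxx //.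
- rewrite (eE _ (wE _ I1)) /= /support_weights wtE /= subrr ltr01 ltxx //.
- move=> s sI; rewrite /supp (eE _ (wE _ sI)) /= /support_weights wtE => x.
  by move=> /mapP[y]; rewrite mem_filter => /andP[_]; rewrite !inE => /orP[]/eqP-> ->;
    rewrite eqxx ?orbT.
Qed.

(** Simplices are sequences, and two distinct vertices of one may occur in either order only; in the
    wrong order the segment is run backwards. *)
Lemma segment_exists u v : adjacent u v -> exists e, is_segment u v e.
Proof.
move=> [c Kc [uc vc]]; have [<-|uv] := eqVneq u v.
  have [p pE] := vertex_point Kc uc; exists (fun=> p); split=> //.
    by apply: continuous_subspaceT => ?; exact: cvg_cst.
  by move=> s _ x; rewrite /supp pE /= !inE orbb.
have [sub|sub] : subseq [:: u; v] c \/ subseq [:: v; u] c.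
- case/splitPr: uc vc => p1 p2; rewrite mem_cat inE eq_sym (negPf uv) /=.
  case/orP => h; [right|left].
    by rewrite -[[:: v; u]]/([:: v] ++ [:: u]) cat_subseq ?sub1seq ?inE ?eqxx.
  by rewrite -[[:: u; v]]/([::] ++ [:: u; v]) cat_subseq ?sub0seq //= eqxx sub1seq.
- by apply: segment_simplex; apply: simplex_subseq sub _.
- have [e he] : exists e, is_segment v u e.
    by apply: segment_simplex; apply: simplex_subseq sub _.
  by eexists; exact: segment_rev he.
Qed.

End Stars.

(** * Holonomy of a cocycle along closed walks *)

Section Holonomy.
Local Open Scope ring_scope.
Variables (R : realType) (V : eqType) (K : complex V).
Notation T := (realization R K).
Notation I01 := (`[0, 1]%classic).

(** The vertices sit at the integer times: with the domain [0, m] a further segment is appended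
    without rescaling. *)
Lemma polygon (u : nat -> V) (m : nat) :
  (forall k, (k < m)%N -> adjacent K (u k) (u k.+1)) -> adjacent K (u 0%N) (u 0%N) ->
  exists F : R -> T, [/\ {within `[0, m%:R]%classic, continuous F},
    forall k, (k <= m)%N -> rpoint (F k%:R) = [:: (u k, 1)]
  & forall k t, (k < m)%N -> k%:R <= t <= k.+1%:R ->
      {subset supp (F t) <= [:: u k; u k.+1]}].
Proof.
move=> + [c Kc [u0 _]]; elim: m => [_|m IH adj].
  have [p pE] := vertex_point R Kc u0; exists (fun=> p); split=> //.
    by apply: continuous_subspaceT => ?; exact: cvg_cst.
  by move=> k; rewrite leqn0 => /eqP->.
have [k km|F [cF Fk Fs]] := IH; first by apply: adj; rewrite ltnW.
have [e [ce e0 e1 es]] := segment_exists R (adj m (leqnn _)).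
pose F' t := if t <= m%:R then F t else e (t - m%:R).
have F'F t : t <= m%:R -> F' t = F t by rewrite /F' => ->.
have F'e t : m%:R <= t -> F' t = e (t - m%:R).
  rewrite le_eqVlt => /orP[/eqP<-|]; last by rewrite /F' ltNge => /negPf->.
  by rewrite F'F // subrr; apply: realization_eq; rewrite e0 Fk.
exists F'; split.
- have -> : `[0, m.+1%:R]%classic = `[0, m%:R]%classic `|` `[m%:R, m.+1%:R]%classic :> set R.
    apply/seteqP; split=> x /=; rewrite !in_itv /=.
      by move=> /andP[x0 xm]; have [xm'|/ltW xm'] := leP x m%:R; [left|right];
        rewrite ?x0 ?xm' ?xm.
    case=> /andP[h1 h2]; first by rewrite h1 (le_trans h2) // ler_nat.
    by rewrite h2 (le_trans _ h1).
  apply: withinU_continuous; try exact: interval_closed.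
    apply: (@subspace_eq_continuous _ _ _ F) => // x; rewrite inE /= in_itv /=.
    by move=> /andP[_ /F'F].
  apply: (@subspace_eq_continuous _ _ _ (e \o (fun t => t - m%:R))) => //.
    by move=> x; rewrite inE /= in_itv /= => /andP[/F'e].
  have cs : continuous (fun t : R => t - m%:R).
    by move=> t; apply: cvgB; [exact: cvg_id|exact: cvg_cst].
  apply: (within_comp cs _ ce) => x /=; rewrite !in_itv /= subr_ge0 lerBlDr => /andP[-> /=].
  by rewrite -natr1 addrC.
- move=> k; rewrite leq_eqVlt => /orP[/eqP->|km]; last by rewrite F'F ?Fk ?ler_nat.
  by rewrite F'e ?ler_nat // -natr1 addrAC subrr add0r e1.
- move=> k t; rewrite ltnS leq_eqVlt => /orP[/eqP->|km] /andP[h1 h2].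
    rewrite F'e //; apply: es; rewrite /= in_itv /= subr_ge0 h1 /=.
    by rewrite lerBlDr addrC natr1.
  by rewrite F'F; [apply: Fs => //; apply/andP|rewrite (le_trans h2) // ler_nat].
Qed.

Section Cocycle.
Local Open Scope group_scope.
Variables (G : groupType) (g : V -> V -> G).
Hypothesis gM : forall c u v w, simplex K c -> u \in c -> v \in c -> w \in c ->
  g u v * g v w = g u w.

Lemma cocycleM (p : T) u v w : u \in supp p -> v \in supp p -> w \in supp p ->
  g u v * g v w = g u w.
Proof. exact: gM (rpoint_simplex p). Qed.

Lemma cocycle1 c u : simplex K c -> u \in c -> g u u = 1.
Proof.
by move=> Kc uc; apply: (mulgI (g u u)); rewrite mulg1; exact: (gM Kc uc uc uc).
Qed.

Fixpoint holonomy (u : nat -> V) (n : nat) : G :=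
  if n is n'.+1 then holonomy u n' * g (u n') (u n) else 1.

Section Grid.
Variables (n : nat) (v : nat -> nat -> V) (q : nat -> nat -> T).
(* [v i j] is a vertex of the supports of the images of the four corners of the
   (i, j) cell of the grid. *)
Hypothesis vq : forall i j i' j', (i <= n)%N -> (j <= n)%N ->
  (i <= i' <= i.+1)%N -> (j <= j' <= j.+1)%N -> v i j \in supp (q i' j').

(** Row [j] is pushed to row [j.+1] cell by cell. The four labels around the corner (i+1, j+1) lie
    in the support of the image of that corner, so the cocycle rule applies to them. *)
Lemma holonomy_step i j : (i <= n)%N -> (j < n)%N ->
  holonomy (v^~ j) i * g (v i j) (v i j.+1) =
  g (v 0%N j) (v 0%N j.+1) * holonomy (v^~ j.+1) i.
Proof.
move=> + jn; have jn' := ltnW jn; elim: i => [_|i IH iN]; first by rewrite mul1g mulg1.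
have iN' := ltnW iN; rewrite /= -mulgA.
have h i' j' : (i <= i' <= i.+1)%N -> (j <= j' <= j.+1)%N ->
    v i' j' \in supp (q i.+1 j.+1).
  move=> /andP[h1 h2] /andP[h3 h4]; apply: vq; first exact: leq_trans iN.
  - exact: leq_trans jn.
  - by rewrite h2 ltnS.
  - by rewrite h4 ltnS.
rewrite (cocycleM (p := q i.+1 j.+1)) ?h ?leqnn ?leqnSn //.
by rewrite mulgA -IH // -mulgA (cocycleM (p := q i.+1 j.+1)) ?h ?leqnn ?leqnSn.
Qed.

(** Closed up at [o], all rows have the same product: this is [holonomy_step], since the labels of
    the left and right sides lie in the support of [p0]. In the top row every label lies there, and
    the product telescopes to 1. *)
Lemma holonomy_boundary o p0 : o \in supp p0 ->
  (forall j, (j <= n.+1)%N -> [/\ q 0%N j = p0, q n.+1 j = p0 & q j n.+1 = p0]) ->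
  g o (v 0%N 0%N) * holonomy (v^~ 0%N) n * g (v n 0%N) o = 1.
Proof.
move=> op0 qb.
have h0 j : (j <= n)%N -> v 0%N j \in supp p0.
  by move=> jn; have [<- _ _] := qb j (leqW jn); rewrite vq ?leqnn ?leqnSn.
have hn j : (j <= n)%N -> v n j \in supp p0.
  by move=> jn; have [_ <- _] := qb j (leqW jn); rewrite vq ?leqnn ?leqnSn.
have ht i : (i <= n)%N -> v i n \in supp p0.
  by move=> jn; have [_ _ <-] := qb i (leqW jn); rewrite vq ?leqnn ?leqnSn.
suff h j : (j <= n)%N ->
    g o (v 0%N (n - j)%N) * holonomy (v^~ (n - j)%N) n * g (v n (n - j)%N) o = 1.
  by have := h n (leqnn n); rewrite subnn.
elim: j => [_|j IH jn].
  have hrow i : (i <= n)%N -> holonomy (v^~ n) i = g (v 0%N n) (v i n).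
    elim: i => [_|i IH iN] /=; first by rewrite (cocycle1 (rpoint_simplex p0)) // ht.
    by rewrite IH 1?ltnW // (cocycleM (p := p0)) ?ht // ltnW.
  rewrite subn0 hrow //.
  rewrite !(cocycleM (p := p0)) ?ht //.
  by rewrite (cocycle1 (rpoint_simplex p0)).
rewrite -(IH (ltnW jn)); set k := (n - j.+1)%N.
have kE : (n - j = k.+1)%N by rewrite /k subnS prednK // subn_gt0.
have kn : (k < n)%N by rewrite -kE leq_subr.
have kn' := ltnW kn; rewrite kE.
rewrite -(cocycleM (p := p0) op0 (h0 _ kn') (h0 _ kn)).
rewrite -(cocycleM (p := p0) (hn _ kn') (hn _ kn) op0) !mulgA.
by rewrite -[in LHS](mulgA (g o _)) holonomy_step // !mulgA.
Qed.

End Grid.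

Lemma natr_div_le (n1 i i' : nat) : (0 < n1)%N -> (i <= i' <= i.+1)%N ->
  (`|i%:R / n1%:R - i'%:R / n1%:R| <= n1%:R^-1 :> R)%R.
Proof.
move=> n0 /andP[h1 h2]; rewrite -mulrBl normrM distrC -natrB // normr_nat.
rewrite (ger0_norm (_ : (0 <= n1%:R^-1)%R)) ?invr_ge0 ?ler0n //.
by rewrite ler_piMl ?invr_ge0 ?ler0n // lern1 leq_subLR addn1.
Qed.

Lemma natr_div_I01 (n1 i : nat) : (0 < n1)%N -> (i <= n1)%N ->
  I01 (i%:R / n1%:R : R)%R.
Proof.
move=> n0 h; rewrite /= in_itv /= divr_ge0 ?ler0n //=.
by rewrite ler_pdivrMr ?ltr0n // mul1r ler_nat.
Qed.

Lemma grid_labels (H : R * R -> T) : {within I01 `*` I01, continuous H} ->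
  exists N0, forall n, (N0 <= n)%N -> exists v : nat -> nat -> V,
    forall i j i' j', (i <= n)%N -> (j <= n)%N ->
      (i <= i' <= i.+1)%N -> (j <= j' <= j.+1)%N ->
      v i j \in supp (H (i'%:R / n.+1%:R, j'%:R / n.+1%:R)%R).
Proof.
move=> /lebesgue_stars[N0 _ hN0]; exists N0 => n Nn.
have /choice[v hv] : forall ij : nat * nat, exists v : V,
    (ij.1 <= n)%N -> (ij.2 <= n)%N -> forall i' j',
    (ij.1 <= i' <= ij.1.+1)%N -> (ij.2 <= j' <= ij.2.+1)%N ->
    v \in supp (H (i'%:R / n.+1%:R, j'%:R / n.+1%:R)%R).
  move=> [i j] /=.
  have [/andP[im jn]|] := boolP ((i <= n) && (j <= n))%N; last first.
    move=> h; have [v _] := supp_neq0 (H (0, 0)%R); exists v => h1 h2.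
    by rewrite h1 h2 in h.
  have [|v hv] := hN0 n Nn (i%:R / n.+1%:R, j%:R / n.+1%:R)%R.
    by split; apply: natr_div_I01 => //; exact: leqW.
  exists v => _ _ i' j' hi hj; apply: hv; try exact: natr_div_le.
  case/andP: hi => _ hi; case/andP: hj => _ hj.
  by split; apply: natr_div_I01 => //; [apply: leq_trans hi _|apply: leq_trans hj _];
    rewrite ltnS.
by exists (fun i j => v (i, j)) => i j i' j' ? ? ? ?; apply: (hv (i, j)).
Qed.

Lemma closed_walk_holonomy (u : nat -> V) (m : nat) :
  simply_connected R T -> (0 < m)%N ->
  (forall k, (k < m)%N -> adjacent K (u k) (u k.+1)) -> u m = u 0%N ->
  holonomy u m = 1.
Proof.
move=> [_ _ sc] m0 adj u0m.
have adj0 : adjacent K (u 0%N) (u 0%N).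
  by have [c Kc [uc _]] := adj 0%N m0; exists c.
have [F [cF Fk Fs]] := polygon adj adj0.
pose f (t : R) := F (m%:R * t)%R.
have cf : {within I01, continuous f}.
  have cm : continuous (fun t : R => m%:R * t)%R.
    by move=> t; apply: cvgM; [exact: cvg_cst|exact: cvg_id].
  apply: (within_comp cm _ cF) => t /=; rewrite !in_itv /= => /andP[t0 t1].
  by rewrite mulr_ge0 ?ler0n //= ler_piMr ?ler0n.
have f01 : f 0%R = f 1%R.
  rewrite /f mulr0 mulr1; apply: realization_eq.
  by have := Fk 0%N (leq0n m); rewrite -u0m => ->; rewrite Fk.
have [H [cH H0 H1 Hb]] := sc f cf f01.
have [N0 hN0] := grid_labels cH.
(* A number of cells divisible by [m] puts each vertex of the polygon on a grid point of the bottom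
   row, with [M] cells to each edge; [M] exceeds [N0] so that the grid is fine enough. *)
pose M := N0.+1; pose n := (m * M).-1.
have M0 : (0 < M)%N by [].
have nE : n.+1 = (m * M)%N by rewrite prednK // muln_gt0 m0.
have [|v hv] := hN0 n.
  by rewrite -ltnS nE (leq_trans _ (leq_pmull _ m0)).
pose q i j := H (i%:R / n.+1%:R, j%:R / n.+1%:R)%R.
have n1 : (n.+1%:R / n.+1%:R = 1 :> R)%R by rewrite divff // pnatr_eq0.
have qb j : (j <= n.+1)%N -> [/\ q 0%N j = f 0%R, q n.+1 j = f 0%R & q j n.+1 = f 0%R].
  move=> jn; have I := natr_div_I01 (ltn0Sn n) jn.
  by rewrite /q n1 mul0r; case: (Hb _ I) => -> ->; rewrite (H1 _ I).
have f0 : rpoint (f 0%R) = [:: (u 0%N, 1%R)] by rewrite /f mulr0 (Fk 0%N).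
have u0f : u 0%N \in supp (f 0%R) by rewrite /supp f0 inE.
have := holonomy_boundary hv u0f qb; set w := v^~ 0%N => bd.
have qF i : (i <= n.+1)%N -> q i 0%N = F (i%:R / M%:R)%R.
  move=> im; rewrite /q mul0r H0; last exact: natr_div_I01.
  rewrite /f nE natrM; congr F; rewrite invfM mulrCA mulVKf //.
  by rewrite pnatr_eq0 -lt0n.
have wF i : (i <= n)%N -> w i \in supp (F (i%:R / M%:R)%R).
  by move=> im; rewrite -qF ?leqW // hv // ?leqnn ?leqnSn.
have wF1 i : (i <= n)%N -> w i \in supp (F (i.+1%:R / M%:R)%R).
  by move=> im; rewrite -qF ?ltnS // hv // ?leqnn ?leqnSn.
have km i : (i <= n)%N -> (i %/ M < m)%N.
  by move=> im; rewrite ltn_divLR // -nE ltnS.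
have wS i : (i <= n)%N -> w i \in [:: u (i %/ M)%N; u (i %/ M).+1].
  move=> im; apply: (Fs (i %/ M)%N _ (km i im) _ _ (wF i im)).
  rewrite ler_pdivlMr ?ltr0n // ler_pdivrMr ?ltr0n // -!natrM !ler_nat leq_trunc_div.
  by rewrite ltnW // -ltn_divLR.
(* At a grid point over a vertex of the polygon the support is this single vertex, which forces the
   label. *)
have w1 i : (i <= n)%N -> (M %| i.+1)%N -> w i = u (i %/ M).+1.
  move=> im Mi; have := wF1 i im; rewrite -[i.+1](divnK Mi) natrM mulfK ?pnatr_eq0 //.
  rewrite divnS // Mi add1n /supp Fk ?inE => [/eqP->|] //.
  exact: km.
have w2 i : (i <= n)%N -> (M %| i)%N -> w i = u (i %/ M)%N.
  move=> im Mi; have iE : (i%:R = (i %/ M)%:R * M%:R :> R)%R by rewrite -natrM divnK.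
  have := wF i im; rewrite iE mulfK ?pnatr_eq0 //.
  by rewrite /supp Fk ?inE => [/eqP->|] //; exact/ltnW/km.
have gu k : (k < m)%N -> exists2 c, simplex K c & (u k \in c) /\ (u k.+1 \in c) by exact: adj.
(* The labels follow the walk [u]: inside an edge the cocycle rule absorbs each step in the last
   factor, and at its end this factor completes the edge. *)
have key i : (i <= n)%N -> holonomy w i = holonomy u (i %/ M)%N * g (u (i %/ M)%N) (w i).
  elim: i => [_|i IH im].
    by rewrite w2 ?dvdn0 // div0n /= mul1g; case: adj0 => c Kc [uc _]; rewrite (cocycle1 Kc).
  have im' := ltnW im; have [c Kc [c1 c2]] := gu _ (km i im').
  rewrite /= IH // -mulgA divnS //; have [Mi|Mi] := boolP (M %| i.+1)%N.
    rewrite add1n /= (w1 i) // (w2 i.+1) // divnS // Mi add1n.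
    by rewrite !mulgA.
  have sub : {subset [:: u (i %/ M)%N; u (i %/ M).+1] <= c}.
    by move=> x; rewrite !inE => /orP[]/eqP->.
  rewrite add0n (gM Kc) //; first by apply/sub/wS.
  by apply: sub; have := wS i.+1 im; rewrite divnS // (negPf Mi) add0n.
have nM : (n %/ M)%N.+1 = m.
  by rewrite -add1n -[1%N]/(nat_of_bool true) -(dvdn_mull m (dvdnn M)) -nE -divnS // nE mulnK.
have Mn : (M %| n.+1)%N by rewrite nE dvdn_mull.
move: bd; rewrite -[v 0%N 0%N]/(w 0%N) -[v n 0%N]/(w n) key // (w1 n (leqnn n) Mn) nM u0m (w2 0%N (leq0n n)) ?dvdn0 // div0n.
case: adj0 => c Kc [uc _]; rewrite (cocycle1 Kc) // mul1g mulg1.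
by move=> <-; rewrite -u0m -[in LHS]nM /= nM.
Qed.

(** Some walk from [u] has holonomy [a]. As a relation this is easily composed and reversed;
    [hol_rel_walk] goes back to indexed walks. *)
Inductive hol_rel (u : V) : V -> G -> Prop :=
| Hol_refl : hol_rel u u 1
| Hol_step v w a : hol_rel u v a -> adjacent K v w -> hol_rel u w (a * g v w).

Lemma hol_rel_trans u v w a b : hol_rel u v a -> hol_rel v w b -> hol_rel u w (a * b).
Proof.
move=> uv; elim=> [|w1 w2 b' _ IH adj]; first by rewrite mulg1.
by rewrite mulgA; apply: Hol_step.
Qed.

Lemma hol_rel_sym u v a : hol_rel u v a -> hol_rel v u a^-1.
Proof.
elim=> [|v' w a' _ IH [c Kc [vc wc]]]; first by rewrite invg1; constructor.
have gV : g w v' = (g v' w)^-1.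
  by apply: (mulgI (g v' w)); rewrite mulgV (gM Kc) // (cocycle1 Kc).
rewrite invgM -gV -[g w v']mul1g; apply: hol_rel_trans IH.
by apply: Hol_step; [constructor|exists c].
Qed.

Lemma hol_rel_walk u v a : hol_rel u v a -> exists (w : nat -> V) m,
  [/\ w 0%N = u, w m = v, holonomy w m = a
    & forall k, (k < m)%N -> adjacent K (w k) (w k.+1)].
Proof.
elim=> [|v' x a' _ [w [m [w0 wm wa wadj]]] adj].
  by exists (fun=> u), 0%N; split.
pose w' k := if (k <= m)%N then w k else x.
have w'w k : (k <= m)%N -> w' k = w k by rewrite /w' => ->.
have w'S : w' m.+1 = x by rewrite /w' ltnn.
exists w', m.+1; rewrite /= w'S !w'w //; split=> //.
  suff h k : (k <= m)%N -> holonomy w' k = holonomy w k by rewrite h // wa wm.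
  by elim: k => [//|k IH km] /=; rewrite IH 1?ltnW // !w'w // ltnW.
move=> k; rewrite ltnS leq_eqVlt => /orP[/eqP->|km].
  by rewrite w'S (w'w m (leqnn m)) wm.
by rewrite (w'w k (ltnW km)) (w'w k.+1 km); exact: wadj.
Qed.

End Cocycle.

(** A path is regarded as a map of the square that is constant in the second variable, so that
    [grid_labels] applies; consecutive labels share a support. *)
Lemma simply_connected_adjacent u v : simply_connected R T ->
  adjacent K u u -> adjacent K v v -> clos_refl_trans V (adjacent K) u v.
Proof.
move=> [_ pc _] [c Kc [uc _]] [d Kd [vd _]].
have [p pE] := vertex_point R Kc uc; have [p' pE'] := vertex_point R Kd vd.
have [f [cf f0 f1]] := pc p p'.
have cH : {within I01 `*` I01, continuous (fun x : R * R => f x.1)}.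
  apply/subspace_continuousP => -[a b] [/= aI bI] W /=.
  move/subspace_continuousP : cf => /(_ _ aI) /[apply].
  rewrite /within /= !nbhs_nearE => h.
  have : (fst : R * R -> R) @ (a, b) --> a by exact: cvg_fst.
  by move=> /(_ _ h); rewrite nbhs_simpl /=; apply: filterS => -[x y] hx [/= /hx].
have [n hn] := grid_labels cH; have [v' hv] := hn n (leqnn n).
pose w i := v' i 0%N.
have wf i : (i <= n)%N -> w i \in supp (f (i%:R / n.+1%:R)) /\
    w i \in supp (f (i.+1%:R / n.+1%:R)).
  move=> im; split; first by apply: (hv i 0%N i 0%N); rewrite ?leqnn ?leqnSn.
  by apply: (hv i 0%N i.+1 0%N); rewrite ?leqnn ?leqnSn.
have w0 : w 0%N = u.
  by have [] := wf 0%N (leq0n n); rewrite mul0r f0 /supp pE inE => /eqP.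
have wn : w n = v.
  have [_] := wf n (leqnn n); rewrite divff ?pnatr_eq0 // f1 /supp pE' inE.
  by move=> /eqP.
suff h i : (i <= n)%N -> clos_refl_trans V (adjacent K) (w 0%N) (w i).
  by rewrite -w0 -wn; exact: h.
elim: i => [_|i IH im]; first exact: rt_refl.
apply: rt_trans (IH (ltnW im)) _; apply: rt_step.
exists (supp (f (i.+1%:R / n.+1%:R))); first exact: rpoint_simplex.
by split; [apply: (wf i (ltnW im)).2|apply: (wf i.+1 im).1].
Qed.

(** The value of [h] at [u] is the holonomy of any walk from a base vertex to [u]; closed walks
    having trivial holonomy, the choice does not matter. *)
Lemma simply_connected_coboundary (G : groupType) (g : V -> V -> G) :
  simply_connected R T ->
  (forall c u v w, simplex K c -> u \in c -> v \in c -> w \in c ->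
    g u v * g v w = g u w)%g ->
  exists h : V -> G, forall u v, adjacent K u v -> h v = (h u * g u v)%g.
Proof.
move=> sc gM; have [[p _] _ _] := sc; have [v0 v0p] := supp_neq0 p.
have Ko := rpoint_simplex p.
have uniq u a b : hol_rel g v0 u a -> hol_rel g v0 u b -> a = b.
  move=> ha hb; have := hol_rel_trans ha (hol_rel_sym gM hb).
  (* The empty closed walk is apart, [closed_walk_holonomy] being about positive lengths. *)
  move=> /hol_rel_walk[w [[|m] [w0 wm wa wadj]]].
    by apply/eqP; rewrite -divg_eq1 -wa.
  by apply/eqP; rewrite -divg_eq1 -wa closed_walk_holonomy // w0 wm.
(* Elements of [V] that are not vertices of [K] get the default 1. *)
pose h u := xget 1%g [set a | hol_rel g v0 u a].
have hP u : adjacent K u u -> hol_rel g v0 u (h u).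
  move=> uu; have vv0 : adjacent K v0 v0 by exists (supp p).
  have [a ha] : exists a, hol_rel g v0 u a.
    elim/clos_refl_trans_ind_left: (simply_connected_adjacent sc vv0 uu).
      by exists 1%g; constructor.
    by move=> x y _ [a ha] xy; exists (a * g x y)%g; apply: Hol_step.
  exact: (xgetPex 1%g (ex_intro (fun a => hol_rel g v0 u a) a ha)).
exists h => u v uv; have [c Kc [uc vc]] := uv.
have uu : adjacent K u u by exists c.
have vv : adjacent K v v by exists c.
exact: uniq (hP v vv) (Hol_step (hP u uu) uv).
Qed.

End Holonomy.
(** * Permutations of tuples and groups given by a presentation *)

Section Permute.
Variables (T : Type) (i : nat).
Implicit Types (s : 'S_i) (A : seq T).

Lemma permuteE (u : T) s A : size A = i ->
  permute s A = [seq nth u A ((s^-1)%g k) | k : 'I_i <- enum 'I_i].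
Proof.
move=> sA; rewrite /permute; elim: (enum _) => //= k e ->.
by rewrite onthE (nth_map u) // sA.
Qed.

Lemma size_permute s A : size A = i -> size (permute s A) = i.
Proof.
case: A => [|u A] sA; last by rewrite (permuteE u) // size_map size_enum_ord.
apply/eqP; rewrite eqn_leq -[X in _ && (X <= _)%N]sA leq0n andbT size_pmap.
by rewrite (leq_trans (count_size _ _)) // size_enum_ord.
Qed.

Lemma nth_permute u s A (k : 'I_i) : size A = i ->
  nth u (permute s A) k = nth u A ((s^-1)%g k).
Proof.
by move=> sA; rewrite (permuteE u) // (nth_map k) ?size_enum_ord // nth_ord_enum.
Qed.

Lemma eq_from_nth_ord u A B : size A = i -> size B = i ->
  (forall k : 'I_i, nth u A k = nth u B k) -> A = B.
Proof.
move=> sA sB E; apply: (@eq_from_nth _ u); first by rewrite sA.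
by move=> k; rewrite sA => ki; exact: (E (Ordinal ki)).
Qed.

Lemma permuteM s1 s2 A : size A = i ->
  permute (s1 * s2)%g A = permute s2 (permute s1 A).
Proof.
case: (posnP i) => [i0 sA|i0 sA].
  have nil (C : seq T) : size C = i -> C = [::] by rewrite i0; exact: size0nil.
  by rewrite [LHS]nil ?[RHS]nil ?size_permute.
have [u _] : exists u : T, True by case: A sA i0 => [<-//|u _ _]; exists u.
apply: (@eq_from_nth_ord u); rewrite ?size_permute //.
by move=> k; rewrite !nth_permute ?size_permute // invMg permM.
Qed.

Lemma permute1 A : size A = i -> permute (1%g : 'S_i) A = A.
Proof.
case: A => [sA|u A sA]; first by apply: size0nil; rewrite size_permute // -sA.
apply: (@eq_from_nth_ord u); rewrite ?size_permute // => k.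
by rewrite nth_permute // invg1 perm1.
Qed.

End Permute.

Lemma permute_map (T T' : Type) i (s : 'S_i) (f : T -> T') (A : seq T) :
  permute s (map f A) = map f (permute s A).
Proof.
rewrite /permute; elim: (enum _) => //= k e ->.
by rewrite onth_map; case: (onth A _).
Qed.

Lemma permute_perm_eq (T : eqType) i (s : 'S_i) (A : seq T) : size A = i ->
  perm_eq (permute s A) A.
Proof.
case: A => [|u A] sA; first by rewrite (size0nil (etrans (size_permute s sA) (esym sA))).
have /eqP tA := sA; apply/(@tuple_permP _ _ _ (Tuple tA)); exists (s^-1)%g.
rewrite (permuteE u) //=; apply: eq_map => k.
by rewrite (tnth_nth u).
Qed.

Lemma perm_eq_permute (T : eqType) i (A B : seq T) : size A = i -> perm_eq B A ->
  exists s : 'S_i, B = permute s A.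
Proof.
move=> sA pe; case: A sA pe => [|u A] sA pe.
  by exists 1%g; rewrite (permute1 sA); apply: size0nil; rewrite (perm_size pe).
have /eqP tA := sA; move/(@tuple_permP _ _ _ (Tuple tA)): pe => [s ->].
exists (s^-1)%g; rewrite (permuteE u) //=; apply: eq_map => k.
by rewrite invgK (tnth_nth u).
Qed.

Section PresentedGroup.
Variables (Gam : Type) (W : set Gam) (Rel : set (word Gam * word Gam)).
Hypothesis RelW : forall p, Rel p -> word_over W p.1 /\ word_over W p.2.
Notation wd := (word Gam).
Notation eqv := (word_equiv W Rel).

(* The letters outside of W are not invertible for [word_equiv]: they are
   erased. *)
Definition restrict (w : wd) : wd := [seq l <- w | `[< W l.1 >]].
Definition word_inv (w : wd) : wd := rev (map (fun l => (l.1, ~~ l.2)) w).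
Definition related (w w' : wd) : Prop := eqv (restrict w) (restrict w').

Lemma restrict_id w : word_over W w -> restrict w = w.
Proof. exact: all_filterP. Qed.

Lemma word_equiv_ctx u v w w' : eqv w w' -> eqv (u ++ w ++ v) (u ++ w' ++ v).
Proof.
elim=> [w1|w1 w2 _ IH|w1 w2 w3 _ h1 _ h2|u1 v1 g b Wg|u1 v1 l1 l2 rl].
- exact: WE_refl.
- exact: WE_sym.
- exact: WE_trans h1 h2.
- have := WE_cancel Rel (u ++ u1) (v1 ++ v) b Wg.
  by rewrite -!catA.
- have := WE_rel W (u ++ u1) (v1 ++ v) rl.
  by rewrite -!catA.
Qed.

Lemma related_refl w : related w w. Proof. exact: WE_refl. Qed.

Lemma related_cat w1 w1' w2 w2' : related w1 w1' -> related w2 w2' ->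
  related (w1 ++ w2) (w1' ++ w2').
Proof.
rewrite /related /restrict !filter_cat => h1 h2.
apply: (@WE_trans _ _ _ _ (restrict w1' ++ restrict w2)).
  exact: (word_equiv_ctx [::] (restrict w2) h1).
by have := word_equiv_ctx (restrict w1') [::] h2; rewrite !cats0.
Qed.

Lemma related_inv w : related (word_inv w ++ w) [::].
Proof.
rewrite /related /restrict /=; elim: w => [|[g b] w IH] /=; first exact: WE_refl.
rewrite /word_inv /= rev_cons cat_rcons -/(word_inv w) filter_cat /=.
case: asboolP => Wg; last by rewrite -filter_cat.
apply: (@WE_trans _ _ _ _ (restrict (word_inv w) ++ restrict w)); last first.
  by rewrite /restrict -filter_cat.
by have := WE_cancel Rel (restrict (word_inv w)) (restrict w) (~~ b) Wg; rewrite negbK.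
Qed.

Lemma word_invK : involutive word_inv.
Proof.
move=> w; rewrite /word_inv map_rev revK -map_comp -[RHS]map_id.
by apply: eq_map => -[g b] /=; rewrite negbK.
Qed.

(** Classes are encoded as predicates on words, so that equality of classes is extensionality of
    predicates. *)
Definition presented : Type := {X : set wd | exists w, X = related w}.

Definition cls (w : wd) : presented := exist _ (related w) (ex_intro _ w erefl).

Definition representative (X : presented) : wd := projT1 (cid (svalP X)).

Lemma cls_eq w w' : cls w = cls w' <-> related w w'.
Proof.
split=> [[E]|h]; first by rewrite E; exact: related_refl.
have E : related w = related w'.
  apply/seteqP; split=> v; rewrite /= /related => h'.
    exact: WE_trans (WE_sym h) h'.
  exact: WE_trans h h'.
by apply: sval_eq.
Qed.

Lemma representativeK X : cls (representative X) = X.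
Proof. by apply: sval_eq; rewrite /representative /=; case: (cid _) => w /= E. Qed.

Lemma cls_surj (X : presented) : exists w, X = cls w.
Proof. by exists (representative X); rewrite representativeK. Qed.

HB.instance Definition _ := gen_eqMixin presented.
HB.instance Definition _ := gen_choiceMixin presented.

Definition presented_mul (X Y : presented) := cls (representative X ++ representative Y).
Definition presented_inv (X : presented) := cls (word_inv (representative X)).

Lemma presented_mulE w w' : presented_mul (cls w) (cls w') = cls (w ++ w').
Proof. by apply/cls_eq; apply: related_cat; apply/cls_eq; rewrite representativeK. Qed.

Lemma presented_mulA : associative presented_mul.
Proof.
move=> X Y Z; have [[u ->] [v ->] [w ->]] := And3 (cls_surj X) (cls_surj Y) (cls_surj Z).
by rewrite !presented_mulE catA.
Qed.

Lemma presented_mul1 : left_id (cls [::]) presented_mul.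
Proof. by move=> X; have [u ->] := cls_surj X; rewrite presented_mulE. Qed.

Lemma presented_mulr1 : right_id (cls [::]) presented_mul.
Proof. by move=> X; have [u ->] := cls_surj X; rewrite presented_mulE cats0. Qed.

Lemma presented_mulV : left_inverse (cls [::]) presented_inv presented_mul.
Proof.
move=> X; rewrite -{2}[X]representativeK presented_mulE; apply/cls_eq; exact: related_inv.
Qed.

Lemma presented_mulrV : right_inverse (cls [::]) presented_inv presented_mul.
Proof.
move=> X; rewrite -{1}[X]representativeK presented_mulE; apply/cls_eq.
by rewrite -{1}[representative X]word_invK; exact: related_inv.
Qed.

HB.instance Definition _ := isGroup.Build presented
  presented_mulA presented_mul1 presented_mulr1 presented_mulV presented_mulrV.

Local Open Scope group_scope.

Lemma cls_cat w w' : cls (w ++ w') = cls w * cls w'.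
Proof. by rewrite -presented_mulE. Qed.

Lemma word_eval_cat (G : groupType) (ev : Gam -> G) w w' :
  word_eval ev (w ++ w') = word_eval ev w * word_eval ev w'.
Proof. by rewrite /word_eval big_cat. Qed.

Lemma cls_word_eval w : cls w = word_eval (fun g => cls [:: (g, false)]) w.
Proof.
elim: w => [|[g b] w IH]; first by rewrite /word_eval big_nil.
rewrite -cat1s cls_cat word_eval_cat -IH /word_eval big_seq1 /=; congr mulg.
case: b => //; apply: (mulIg (cls [:: (g, false)])); rewrite mulVg -cls_cat.
by apply/cls_eq; exact: (related_inv [:: (g, false)]).
Qed.

Lemma cls_rel w w' : Rel (w, w') -> cls w = cls w'.
Proof.
move=> rel; have [/= h1 h2] := RelW rel; apply/cls_eq.
rewrite /related !restrict_id //.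
by have := WE_rel W [::] [::] rel; rewrite /= !cats0.
Qed.

Lemma cls_equiv w w' : word_over W w -> word_over W w' -> cls w = cls w' -> eqv w w'.
Proof. by move=> h1 h2 /cls_eq; rewrite /related !restrict_id. Qed.

Lemma word_eval_equiv (G : groupType) (ev : Gam -> G) w w' :
  (forall l1 l2, Rel (l1, l2) -> word_eval ev l1 = word_eval ev l2) ->
  eqv w w' -> word_eval ev w = word_eval ev w'.
Proof.
move=> hR; elim=> [//|//|w1 w2 w3 _ -> _ ->//|u v g b _|u v l1 l2 /hR E].
  rewrite !word_eval_cat; congr mulg.
  rewrite -[RHS]mul1g; congr mulg; rewrite /word_eval !big_cons big_nil /= mulg1.
  by case: b; rewrite /= ?mulVg ?mulgV.
by rewrite !word_eval_cat E.
Qed.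

End PresentedGroup.
(** * Bases and their expansions *)

Section Bases.
Variables (S : signature) (U : algebra S).
Notation colour := 'I_(colours S).
Notation letter := {t : colour & 'I_(arity t)}.
Hypothesis satU : satisfies U.
(* A nontrivial algebra used to separate the elements of U. *)
Variables (A0 : algebra S) (sat0 : satisfies A0) (a0 a1 : A0) (a01 : a0 <> a1).

(** The uniqueness half of freeness, [independent] being the existence half. Stated with maps on all
    of [U] they avoid subtypes, and each passes to expansions on its own. *)
Definition generates (B : set U) : Prop := forall C : algebra S, satisfies C ->
  forall phi psi : U -> C, is_hom phi -> is_hom psi ->
  (forall b, B b -> phi b = psi b) -> phi =1 psi.

Definition independent (B : set U) : Prop := forall C : algebra S, satisfies C ->
  forall h : U -> C, exists2 phi : U -> C, is_hom phi & forall b, B b -> phi b = h b.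

Lemma is_basisP (B : set U) : B !=set0 ->
  is_basis B <-> generates B /\ independent B.
Proof.
move=> [b Bb]; split=> [[_ fr]|[gen ind]].
  split=> [C satC phi psi hphi hpsi eqB u|C satC h].
    have [chi [_ _ uniq]] := fr C satC (fun b => phi (sval b)).
    rewrite (uniq phi) // (uniq psi) // => -[b' Bb'] /=.
    by rewrite eqB.
  have [phi [hphi eqB _]] := fr C satC (fun b => h (sval b)).
  by exists phi => // b' Bb'; have := eqB (exist _ b' Bb').
split=> // C satC h.
pose h' (u : U) : C := if pselect (B u) is left Bu then h (exist _ u Bu) else h (exist _ b Bb).
have h'E a : h' (sval a) = h a.
  by case: a => u Bu; rewrite /h' /=; case: pselect => // Bu'; congr h; congr exist;
    exact: Prop_irrelevance.
have [phi hphi eqB] := ind C satC h'; exists phi; split=> //.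
  by move=> a; rewrite eqB ?h'E //; exact: svalP.
move=> psi hpsi eqpsi; apply: gen => // u Bu.
by rewrite eqB // (h'E (exist _ u Bu)) (eqpsi (exist _ u Bu)).
Qed.

Definition act (A : algebra S) (u : A) (nu : seq letter) : A :=
  foldl (fun v (l : letter) => alp (tag l) (tagged l) v) u nu.

Lemma act_cat (A : algebra S) (u : A) nu nu' : act u (nu ++ nu') = act (act u nu) nu'.
Proof. exact: foldl_cat. Qed.

Lemma hom_act (A B : algebra S) (phi : A -> B) u nu : is_hom phi ->
  phi (act u nu) = act (phi u) nu.
Proof.
by move=> [_ h]; elim: nu u => [//|l nu IH] u; rewrite /= IH h.
Qed.

Lemma act_surj (A : algebra S) : satisfies A -> forall nu (v : A), exists u, act u nu = v.
Proof.
move=> [_ h _]; elim=> [|l nu IH] v; first by exists v.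
by have [u <-] := IH v; exists (lam (tag l) (fun=> u)); rewrite /= h.
Qed.

(** Descending words act surjectively. If [a] and [b] were distinct, a homomorphism to [A0] could be
    chosen so as to send the two descendants to [a0] and [a1]. *)
Lemma independent_act (B : set U) a b nu nu' : independent B -> B a -> B b ->
  act a nu = act b nu' -> a = b.
Proof.
move=> ind Ba Bb E; apply: contrapT => ab.
have [c cE] := act_surj sat0 nu a0; have [c' c'E] := act_surj sat0 nu' a1.
have [phi hphi eqB] := ind A0 sat0 (fun u => if u == a then c else c').
apply: a01; rewrite -cE -c'E.
have -> : c = phi a by rewrite eqB // eqxx.
have -> : c' = phi b by rewrite eqB // ifF //; apply/eqP => /esym.
by rewrite -!hom_act // E.
Qed.

Lemma independent_alp (B : set U) a t : independent B -> B a ->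
  injective (fun j : 'I_(arity t) => alp t j a).
Proof.
move=> ind Ba j j' E; apply: contrapT => /eqP jj'.
have [phi [_ hphi] eqB] := ind A0 sat0
  (fun=> lam t (fun i => if i == j then a0 else a1)).
have [_ h _] := sat0.
have := congr1 phi E; rewrite !hphi eqB // !h eqxx eq_sym (negPf jj').
exact: a01.
Qed.

(* Twisting an algebra by the exponents of the colours: the descending words
   acquire a multidegree, since the laws preserve the colours up to order. *)
Definition shift (z : colour -> int) (t : colour) (n : int) : colour -> int :=
  fun t' => if t' == t then (z t' + n)%R else z t'.

Definition twisted : algebra S := @Algebra S ((colour -> int) -> A0)
  (fun t fs z => lam t (fun j => fs j (shift z t (- 1)%R)))
  (fun t j f z => alp t j (f (shift z t 1%R))).

Hypothesis cplS : complete S.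

Lemma shiftK z t n : shift (shift z t n) t (- n) = z.
Proof.
by apply/funext => t'; rewrite /shift; case: eqP => // _; rewrite addrK.
Qed.

Lemma shiftC z t t' m n : t != t' -> shift (shift z t m) t' n = shift (shift z t' n) t m.
Proof.
move=> tt'; apply/funext => t''; rewrite /shift; case: (eqVneq t'' t) => [->|//].
by rewrite (negPf tt').
Qed.

(** By completeness each side of a law uses each of the two colours once, so both sides shift the
    exponents in the same way. *)
Lemma twisted_satisfies : satisfies twisted.
Proof.
have [h1 h2 h3] := sat0; split.
- move=> t f; apply/funext => z /=.
  under eq_fun do rewrite -[X in shift _ _ X]opprK shiftK.
  exact: h1.
- by move=> t fs j; apply/funext => z /=; rewrite h2 shiftK.
- move=> t t' L tt' sL p f; apply/funext => z /=.
  have [L' [sL' fE f'E]] := cplS tt'; move: sL'; rewrite sL => -[LL']; subst L'.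
  rewrite (h3 t t' L tt' sL p); congr (alp _ _ (alp _ _ (f _))).
  rewrite fE f'E shiftC //.
  by rewrite -val_eqE /= neq_ltn tt' orbT.
Qed.

Definition colouring (nu : seq letter) : seq colour := map tag nu.

Lemma twisted_act (f : twisted) nu z : exists2 z', act f nu z = act (f z') nu &
  forall t, z' t = (z t + (count_mem t (colouring nu))%:Z)%R.
Proof.
elim: nu f z => [|l nu IH] f z.
  by exists z => // t; rewrite /= addr0.
have [z' E zE] := IH (alp (a := twisted) (tag l) (tagged l) f) z.
exists (shift z' (tag l) 1); first by rewrite /= E.
move=> t; rewrite /shift zE /= eq_sym; case: eqP => _; rewrite ?add0n // PoszD.
by rewrite -addrA [(_ + 1)%R]addrC.
Qed.

Lemma independent_degree (B : set U) a nu nu' : independent B -> B a ->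
  act a nu = act a nu' -> perm_eq (colouring nu) (colouring nu').
Proof.
move=> ind Ba E; apply: contrapT => dne.
have [t ct] : exists t, count_mem t (colouring nu) <> count_mem t (colouring nu').
  apply: contrapT => h; apply: dne; rewrite /perm_eq; apply/allP => t _ /=.
  by apply/eqP; apply: contrapT => ct; apply: h; exists t.
have [c cE] := act_surj sat0 nu a0; have [c' c'E] := act_surj sat0 nu' a1.
pose d : int := (count_mem t (colouring nu))%:Z.
(* The image of [a] tests the exponent of [t]. Evaluated at 0 after a descending word, this exponent
   is the number of letters of colour [t], which is [d] for [nu] and not for [nu']. *)
have [phi hphi eqB] := ind twisted twisted_satisfies
  (fun=> fun z => if z t == d then c else c').
have := congr1 (fun u => phi u (fun=> 0%R)) E; rewrite !hom_act // eqB //.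
set f := (X in act X nu) => E'.
have [z zE zt] := @twisted_act f nu (fun=> 0%R).
have [z' z'E z't] := @twisted_act f nu' (fun=> 0%R).
move: E'; rewrite zE z'E /f zt z't !add0r eqxx ifF ?cE ?c'E; first exact: a01.
by apply/eqP => -[/esym].
Qed.

Lemma generates_expand (B : set U) a t : B a -> generates B ->
  generates (expand_at B a t).
Proof.
move=> Ba gen C satC phi psi hphi hpsi eqB; apply: gen => // b Bb.
have [->|/eqP ba] := eqVneq b a; last by apply: eqB; left.
have [h1 _ _] := satU; rewrite -[a](h1 t) hphi.1 hpsi.1; congr lam.
by apply/funext => j; apply: eqB; right; exists j.
Qed.

Lemma independent_expand (B : set U) a t : B a -> independent B ->
  independent (expand_at B a t).
Proof.
move=> Ba ind C satC h.
have [phi hphi eqB] := ind C satC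
  (fun u => if u == a then lam t (fun j => h (alp t j a)) else h u).
exists phi => // b [[Bb /= ba]|[j _ <-]].
  by rewrite eqB // ifF //; apply/eqP.
by rewrite hphi.2 eqB // eqxx; have [_ h2 _] := satC; rewrite h2.
Qed.

Lemma expand_cat t (p q : seq U) a : expand t (size p) (p ++ a :: q) =
  p ++ [seq alp t j a | j <- enum 'I_(arity t)] ++ q.
Proof. by rewrite /expand drop_size_cat // take_size_cat. Qed.

Lemma split_nth (A : seq U) k : (k < size A)%N ->
  exists p a q, A = p ++ a :: q /\ size p = k.
Proof.
case: A => // u A kA; exists (take k (u :: A)), (nth u (u :: A) k), (drop k.+1 (u :: A)).
by rewrite -drop_nth // cat_take_drop size_takel // ltnW.
Qed.

Lemma split_mem (A : seq U) a : a \in A -> exists p q, A = p ++ a :: q.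
Proof. by case/splitPr => p q; exists p, q. Qed.

Lemma set_expand t (p q : seq U) a : uniq (p ++ a :: q) ->
  [set` expand t (size p) (p ++ a :: q)] = expand_at [set` p ++ a :: q] a t.
Proof.
rewrite expand_cat cat_uniq /= negb_or => /and3P[_ /andP[ap _] /andP[aq _]].
apply/seteqP; split=> v; rewrite /= !mem_cat.
  move=> /or3P[vp|/mapP[j _ ->]|vq]; last 2 first.
  - by right; exists j.
  - by left; split; rewrite /= ?mem_cat ?inE ?vq ?orbT // => va; rewrite -va vq in aq.
  by left; split; rewrite /= ?mem_cat ?inE ?vp // => va; rewrite -va vp in ap.
case=> [[/= + va]|[j _ <-]]; last first.
  have -> : alp t j a \in [seq alp t i a | i <- enum 'I_(arity t)].
    by apply/mapP; exists j; rewrite ?mem_enum.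
  by rewrite orbT.
by rewrite mem_cat inE => /or3P[->//|/eqP//|->]; rewrite !orbT.
Qed.

Variable u0 : U.

(** The arities being positive, the empty set carries an algebra; if [B] were empty, [U] would map
    to it, which [u0] forbids. *)
Lemma basis_nonempty (B : set U) : is_basis B -> B !=set0.
Proof.
move=> [_ fr]; apply: contrapT => /nonemptyPn B0.
pose E := @Algebra S False (fun t us => us (Ordinal (ltnW (arity_gt1 t))))
  (fun t j u => u).
have satE : satisfies E by split=> // t us; case: (us (Ordinal (ltnW (arity_gt1 t)))).
have h : {b | B b} -> E by case=> b; rewrite B0.
by have [phi _] := fr E satE h; case: (phi u0).
Qed.

Lemma is_tupleP (A : seq U) : is_tuple A <->
  [/\ uniq A, A <> [::], generates [set` A] & independent [set` A]].
Proof.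
split=> [[uA bA]|[uA Ane gen ind]].
  have nA := basis_nonempty bA; have [gen ind] := (is_basisP nA).1 bA.
  by split=> // AE; move: nA; rewrite AE => -[].
by split=> //; apply/is_basisP => //; case: A Ane {uA gen ind} => // a A _; exists a;
  rewrite /= inE eqxx.
Qed.

Lemma tuple_expand (A : seq U) t k : is_tuple A -> (k < size A)%N ->
  is_tuple (expand t k A) /\ size (expand t k A) = up (size A) t.
Proof.
move=> /is_tupleP[uA _ gen ind] /split_nth[p [a [q [AE <-]]]]; split; last first.
  rewrite AE expand_cat up_add !size_cat size_map size_enum_ord /=.
  by have := arity_gt1 t; move: (arity t) (size p) (size q); clear; lia.
have Aa : [set` A] a by rewrite /= AE mem_cat mem_head orbT.
have uA' := uA; rewrite AE in uA'; apply/is_tupleP; split.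
- rewrite AE expand_cat.
  have notin b : b \in p ++ q -> b \notin [seq alp t j a | j <- enum 'I_(arity t)].
    move=> bpq; apply/negP => /mapP[j _ bE].
    have ba : b = a.
      apply: (@independent_act _ b a [::] [:: existT _ t j] ind) => //=.
      by move: bpq; rewrite AE !mem_cat inE => /orP[->//|->]; rewrite !orbT.
    move: uA' bpq; rewrite ba cat_uniq /= negb_or mem_cat.
    by move=> /and3P[_ /andP[/negPf-> _] /andP[/negPf-> _]].
  move: uA'; rewrite !cat_uniq /= negb_or => /and3P[-> /andP[_ npq] /andP[_ ->]].
  rewrite andbT /=; apply/and3P; split.
  + rewrite has_cat negb_or npq andbT -all_predC; apply/allP => b bch /=.
    by apply/negP => bp; move: (notin b); rewrite mem_cat bp bch => /(_ isT).
  + by rewrite map_inj_uniq ?enum_uniq //; exact: independent_alp ind Aa.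
  + rewrite -all_predC; apply/allP => b bq /=; apply: notin.
    by rewrite mem_cat bq orbT.
- rewrite AE expand_cat => /(congr1 size); rewrite !size_cat size_map size_enum_ord /=.
  by have := arity_gt1 t; move: (arity t) (size p) (size q); clear; lia.
- by rewrite AE set_expand // -AE; exact: generates_expand.
- by rewrite AE set_expand // -AE; exact: independent_expand.
Qed.

(** Contractions occur in the lifting of the tree, where edges may have to be followed downwards. *)
Lemma tuple_contract (p : seq U) t (bs : 'I_(arity t) -> U) :
  is_tuple (p ++ map bs (enum 'I_(arity t))) -> is_tuple (rcons p (lam t bs)).
Proof.
have [_ alpK _] := satU; move=> /is_tupleP[]; set A := p ++ _ => uA _ gen ind.
have Ab j : [set` A] (bs j) by rewrite /= mem_cat map_f ?orbT ?mem_enum.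
have Ap u : u \in p -> [set` A] u by move=> up; rewrite /= mem_cat up.
have pb u j : u \in p -> u <> bs j.
  move=> up ub; move: uA; rewrite cat_uniq => /and3P[_ /hasPn h _].
  have /h : bs j \in map bs (enum 'I_(arity t)) by rewrite map_f ?mem_enum.
  by rewrite /= -ub up.
have bsI : injective bs.
  move=> i j; move: uA; rewrite cat_uniq => /and3P[_ _ /injectiveP]; exact.
apply/is_tupleP; split; last 1 first.
- move=> C satC h.
  (* For [lam t bs] to have a prescribed image, each [bs j] is sent to the matching descendant of
     this image. *)
  have [phi hphi eqA] := ind C satC (fun u =>
    if [pick j | bs j == u] is Some j then alp t j (h (lam t bs)) else h u).
  exists phi => // u; rewrite /= mem_rcons inE => /orP[/eqP->|up].
    have [lamK _ _] := satC; rewrite -[RHS](lamK t) hphi.1; congr lam; apply/funext => j.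
    rewrite eqA //; case: pickP => [i /eqP/bsI->//|/(_ j)]; by rewrite eqxx.
  by rewrite eqA; [case: pickP => // j /eqP/esym/(pb _ _ up)|exact: Ap].
- rewrite rcons_uniq; move: (uA); rewrite cat_uniq => /andP[-> _]; rewrite andbT.
  apply/negP => up; pose j := Ordinal (ltnW (arity_gt1 t)).
  apply: (pb _ j up); apply: (@independent_act _ _ _ [:: existT _ t j] [::] ind (Ap _ up) (Ab j)).
  exact: alpK.
- by move/(congr1 size); rewrite size_rcons.
- move=> C satC phi psi hphi hpsi eqB; apply: gen => // u; rewrite /= mem_cat.
  case/orP => [up|/mapP[j _ ->]]; first by apply: eqB; rewrite /= mem_rcons inE up orbT.
  by rewrite -(alpK t bs j) hphi.2 hpsi.2 eqB //= mem_rcons mem_head.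
Qed.

(** * Expansions as forests *)

Inductive tree : Type := Leaf | Node (t : colour) of ('I_(arity t) -> tree).

Fixpoint leaves (T : tree) (u : U) : set U :=
  match T with
  | Leaf => [set u]
  | Node t Ts => [set v | exists j, leaves (Ts j) (alp t j u) v]
  end.

(** Records an expansion of [A] while forgetting the order of its simple steps, so that two
    expansions with the same end can be compared. *)
Definition forest (A : set U) (F : U -> tree) : set U :=
  [set v | exists2 a, A a & leaves (F a) a v].

Lemma leaves_act T u v : leaves T u v -> exists nu, v = act u nu.
Proof.
elim: T u => [|t Ts IH] u /=; first by move=> ->; exists [::].
by move=> [j /IH[nu ->]]; exists (existT _ t j :: nu).
Qed.

Lemma leaves_neq0 T u : exists v, leaves T u v.
Proof.
elim: T u => [|t Ts IH] u /=; first by exists u.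
pose j := Ordinal (ltnW (arity_gt1 t)).
by have [v hv] := IH j (alp t j u); exists v, j.
Qed.

Fixpoint graft (b : U) (t : colour) (T : tree) (u : U) : tree :=
  match T with
  | Leaf => if u == b then Node (fun _ : 'I_(arity t) => Leaf) else Leaf
  | Node t' Ts => Node (fun j => graft b t (Ts j) (alp t' j u))
  end.

Lemma leaves_graft b t T u v : leaves (graft b t T u) u v <->
  (leaves T u v /\ v <> b) \/ (leaves T u b /\ exists j : 'I_(arity t), alp t j b = v).
Proof.
elim: T u => [|t' Ts IH] u /=.
  case: eqVneq => [->|/eqP ub] /=.
    split=> [[j ->]|[[-> //]|[_ [j <-]]]]; last by exists j.
    by right; split=> //; exists j.
  by split=> [->|[[]//|[/esym]//]]; left.
split=> [[j /IH[[h1 h2]|[h1 h2]]]|[[[j h1] h2]|[[j h1] h2]]].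
- by left; split=> //; exists j.
- by right; split=> //; exists j.
- by exists j; apply/IH; left.
- by exists j; apply/IH; right.
Qed.

Lemma expands_forest (A B : set U) : expands A B -> exists F, B = forest A F.
Proof.
elim/clos_refl_trans_ind_left => [|C D _ [F ->] [b [t [[a Aa ab] ->]]]].
  by exists (fun=> Leaf); apply/seteqP; split=> v /=; [exists v|move=> [a Aa ->]].
exists (fun a => graft b t (F a) a); apply/seteqP; split=> v.
  move=> [[[c Ac cv] /= vb]|[j _ <-]].
    by exists c => //; apply/leaves_graft; left.
  by exists a => //; apply/leaves_graft; right; split=> //; exists j.
move=> [c Ac /leaves_graft[[h1 h2]|[h1 [j <-]]]]; last by right; exists j.
by left; split=> //; exists c.
Qed.

Lemma independent_expands (A B : set U) : expands A B -> independent A -> independent B.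
Proof.
elim=> [C D [b [t [Cb ->]]]|//|C D E _ h1 _ h2 /h1/h2//]; exact: independent_expand.
Qed.

Lemma generates_expands (A B : set U) : expands A B -> generates A -> generates B.
Proof.
elim=> [C D [b [t [Cb ->]]]|//|C D E _ h1 _ h2 /h1/h2//]; exact: generates_expand.
Qed.

Definition replace_leaves (A : set U) (l : seq U) (F : U -> tree) : set U :=
  [set v | (A v /\ v \notin l) \/ exists2 a, a \in l & leaves (F a) a v].

(** The trees are grown one after the other; independence keeps the descendants of one listed
    element away from the elements still to be expanded. *)
Lemma expands_replace (l : seq U) F :
  (forall a, a \in l -> forall B, independent B -> B a -> expands B (replace_leaves B [:: a] F)) ->
  uniq l -> forall A, independent A -> [set` l] `<=` A -> expands A (replace_leaves A l F).
Proof.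
elim: l => [|a l IH] hF ul A ind lA.
  rewrite (_ : replace_leaves A [::] F = A); first exact: rt_refl.
  by apply/seteqP; split=> v /=; [case=> -[]|left].
have {}IH : expands A (replace_leaves A l F).
  apply: IH => //; last by move=> b bl; apply: lA; rewrite /= in_cons bl orbT.
    by move=> b bl; apply: hF; rewrite in_cons bl orbT.
  by case/andP: ul.
have Aa : A a by apply: lA; rewrite /= mem_head.
move: ul => /= /andP[al _].
have ind' := independent_expands IH ind.
have h : replace_leaves A l F a by left.
have := hF a (mem_head _ _) _ ind' h; rewrite (_ : replace_leaves _ [:: a] F = replace_leaves A (a :: l) F).
  exact: rt_trans.
apply/seteqP; split=> v.
  move=> [[[[Av vl]|[b bl bv]]]|[b]]; rewrite mem_seq1.
  - by move=> va; left; rewrite in_cons negb_or va vl.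
  - by move=> _; right; exists b => //; rewrite in_cons bl orbT.
  - by move=> /eqP-> av; right; exists a; rewrite ?mem_head.
move=> [[Av]|[b]]; rewrite in_cons.
  by case/norP => va vl; left; split; [left|rewrite mem_seq1].
case/orP => [/eqP-> av|bl bv]; first by right; exists a; rewrite ?mem_head.
left; split; first by right; exists b.
rewrite mem_seq1; apply/eqP => va; have [nu E] := leaves_act bv.
have Ab : A b by apply: lA; rewrite /= in_cons bl orbT.
have ab : a = b by apply: (@independent_act _ _ _ [::] nu ind) => //; rewrite -E.
by rewrite ab bl in al.
Qed.

(** What is left of a forest after the first step at [a]: the children of [a] receive the
    subtrees. *)
Definition on_children (t : colour) (a : U) (Ts : 'I_(arity t) -> tree) (F : U -> tree) u : tree :=
  if [pick j | alp t j a == u] is Some j then Ts j else F u.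

Lemma on_childrenE (A : set U) t a (Ts : 'I_(arity t) -> tree) F j : independent A -> A a ->
  on_children a Ts F (alp t j a) = Ts j.
Proof.
move=> ind Aa; rewrite /on_children; case: pickP => [i|/(_ j)]; last by rewrite eqxx.
by move=> /eqP/(independent_alp ind Aa) ->.
Qed.

Lemma on_childrenN (A : set U) t a (Ts : 'I_(arity t) -> tree) F u :
  independent A -> A a -> A u -> u <> a -> on_children a Ts F u = F u.
Proof.
move=> ind Aa Au ua; rewrite /on_children; case: pickP => // j /eqP E.
by case: ua; symmetry; apply: (@independent_act _ a u [:: existT _ t j] [::] ind).
Qed.

Lemma expands_leaves T F (A : set U) a : F a = T -> independent A -> A a ->
  expands A (replace_leaves A [:: a] F).
Proof.
elim: T F A a => [|t Ts IH] F A a Fa ind Aa.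
  rewrite (_ : replace_leaves A [:: a] F = A); first exact: rt_refl.
  apply/seteqP; split=> v; rewrite /replace_leaves /=.
    by case=> [[]//|[b]]; rewrite mem_seq1 => /eqP->; rewrite Fa /= => ->.
  move=> Av; have [->|va] := eqVneq v a.
    by right; exists a; rewrite ?mem_head // Fa.
  by left; rewrite mem_seq1.
pose l := [seq alp t j a | j <- enum 'I_(arity t)].
pose F' := on_children a Ts F.
have ind1 := independent_expand t Aa ind.
have := @expands_replace l F' _ _ _ ind1 _; rewrite (_ : replace_leaves _ l F' = replace_leaves A [:: a] F).
  move=> h; apply: (@rt_trans _ _ _ (expand_at A a t)).
    by apply: rt_step; exists a, t.
  apply: h.
  - by move=> _ /mapP[j _ ->] B indB Bj; apply: (IH j) => //; exact: on_childrenE ind Aa.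
  - by rewrite map_inj_uniq ?enum_uniq //; exact: independent_alp ind Aa.
  - by move=> _ /= /mapP[j _ ->]; right; exists j.
apply/seteqP; split=> v.
  move=> [[[[Av /= va]|[j _ <-]] vl]|[_ /mapP[j _ ->]]].
  - by left; rewrite mem_seq1; split=> //; apply/eqP.
  - by case/negP: vl; apply/mapP; exists j; rewrite ?mem_enum.
  - rewrite /F' (on_childrenE _ _ _ ind Aa) => h; right; exists a; rewrite ?mem_head // Fa.
    by exists j.
move=> [[Av]|[b]]; rewrite mem_seq1.
  move=> /eqP va; left; split; first by left.
  apply/negP => /mapP[j _ E]; apply: va.
  by apply: (@independent_act _ v a [::] [:: existT _ t j] ind).
move=> /eqP->; rewrite Fa /= => -[j h]; right; exists (alp t j a).
  by apply/mapP; exists j; rewrite ?mem_enum.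
by rewrite /F' (on_childrenE _ _ _ ind Aa).
Qed.

Lemma forest_expands (s : seq U) F : uniq s -> independent [set` s] ->
  expands [set` s] (forest [set` s] F).
Proof.
move=> us ind; have := @expands_replace s F _ us _ ind (@subset_refl _ _).
rewrite (_ : replace_leaves _ s F = forest [set` s] F).
  by apply=> a _ B indB Ba; exact: expands_leaves.
apply/seteqP; split=> v.
  by move=> [[/= -> //]|[a sa av]]; exists a.
by move=> [a sa av]; right; exists a.
Qed.

Lemma forest_expand_at (A : set U) F b t (Ts : 'I_(arity t) -> tree) : independent A -> A b -> F b = Node Ts ->
  forest A F = forest (expand_at A b t) (on_children b Ts F).
Proof.
move=> ind Ab Fb; apply/seteqP; split=> v.
  move=> [a Aa]; have [->|/eqP ab] := eqVneq a b.
    rewrite Fb /= => -[j h]; exists (alp t j b); first by right; exists j.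
    by rewrite (on_childrenE _ _ _ ind Ab).
  by move=> h; exists a; [left|rewrite (on_childrenN _ _ ind Ab Aa ab)].
move=> [a [[Aa /= ab]|[j _ <-]]].
  by rewrite (on_childrenN _ _ ind Ab Aa ab) => h; exists a.
by rewrite (on_childrenE _ _ _ ind Ab) => h; exists b; rewrite // Fb; exists j.
Qed.

(** In the forest over A[a,t] the tree at [a'] is replaced by the one that the other forest
    provides, whose root has colour [t']. The leaves remain the same because both forests end in
    [B], and the descendants of distinct elements of [A] are distinct. *)
Lemma expand_join_disjoint (A B : set U) a t a' t' F F' : independent A ->
  A a -> A a' -> a <> a' -> B = forest (expand_at A a t) F ->
  B = forest (expand_at A a' t') F' ->
  exists G, B = forest (expand_at (expand_at A a t) a' t') G.
Proof.
move=> ind Aa Aa' aa' BF BF'.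
have ind1 := independent_expand t Aa ind.
have ind2 := independent_expand t' Aa' ind.
have A1a' : expand_at A a t a' by left; split=> //= /esym.
pose T' := Node (fun j : 'I_(arity t') => F' (alp t' j a')).
pose F2 u := if u == a' then T' else F u.
have F2a' : F2 a' = T' by rewrite /F2 eqxx.
have -> : B = forest (expand_at A a t) F2.
  apply/seteqP; split=> v.
    rewrite {1}BF => -[c A1c cv]; exists c => //; rewrite /F2; case: eqP => // ca'.
    have [nu vE] := leaves_act cv; rewrite ca' in vE.
    have : B v by rewrite BF; exists c.
    rewrite BF' => -[d A2d dv]; have [nu' vE'] := leaves_act dv.
    case: A2d dv vE' => [[Ad /= da']|[j _ <-]] dv vE'.
      by case: da'; apply: (@independent_act _ _ _ nu' nu ind) => //; rewrite -vE -vE'.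
    by rewrite /T' ca' /=; exists j.
  move=> [c A1c]; rewrite /F2; case: eqP => [->|_ h]; last by rewrite BF; exists c.
  by rewrite /T' /= => -[j h]; rewrite BF'; exists (alp t' j a') => //; right; exists j.
by exists (on_children a' (fun j => F' (alp t' j a')) F2); apply: forest_expand_at.
Qed.

Definition expand_twice (A : set U) (a : U) (t t' : colour) : set U :=
  [set v | (A v /\ v <> a) \/ exists j l, v = alp t' l (alp t j a)].

(* Comparing multidegrees, a common expansion of A[a,t] and A[a,t'] which lies
   below the double expansion is above it. *)
Lemma expand_join_same (A L : set U) a t t' F F' F'' : independent A -> A a ->
  t <> t' -> L = forest (expand_at A a t) F -> L = forest (expand_at A a t') F' ->
  expand_twice A a t t' = forest L F'' ->
  exists G, L = forest (expand_twice A a t t') G.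
Proof.
move=> ind Aa tt' LF LF' LF''.
have A1 j : expand_at A a t (alp t j a) by right; exists j.
have ind1 := independent_expand t Aa ind.
have /choice[Ts FTs] : forall j, exists Ts : 'I_(arity t') -> tree, F (alp t j a) = Node Ts.
  move=> j; case E : (F (alp t j a)) => [|t'' Ts].
    (* A child that is a leaf would also descend from some [alp t' j' a]: a word with the single
       colour [t] would equal one containing [t']. *)
    have : L (alp t j a) by rewrite LF; exists (alp t j a); rewrite ?E.
    rewrite LF' => -[c A2c /leaves_act[nu cE]].
    case: A2c cE => [[Ac /= ca]|[j' _ <-]] cE.
      by case: ca; apply: (@independent_act _ _ _ nu [:: existT _ t j] ind).
    have /perm_mem/(_ t') := @independent_degree _ _ [:: existT _ t j]
      (existT _ t' j' :: nu) ind Aa cE.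
    by rewrite /= mem_head mem_seq1 => /eqP/esym.
  (* Some element of the double expansion lies below this root. Its multidegree contains [t] and
     [t''], and the double expansion only has [t] and [t']. *)
  have [v] := leaves_neq0 (Node Ts) (alp t j a); move=> /[dup] vl [j'' /leaves_act[nu vE]].
  have Lv : L v by rewrite LF; exists (alp t j a); rewrite ?E.
  have [w wl] := leaves_neq0 (F'' v) v; have [nu' wE] := leaves_act wl.
  have : forest L F'' w by exists v.
  have {}wE : w = act a (existT _ t j :: existT _ t'' j'' :: nu ++ nu').
    by rewrite wE vE /= act_cat.
  rewrite -LF'' => -[[Aw wa]|[j' [l wE']]].
    by case: wa; apply: (@independent_act _ _ _ [::] _ ind Aw Aa wE).
  have := @independent_degree _ _ _ [:: existT _ t j'; existT _ t' l] ind Aa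
    (etrans (esym wE) wE').
  rewrite /= perm_cons => /perm_mem/(_ t''); rewrite mem_head mem_seq1 => /esym/eqP t''E.
  by subst t''; exists Ts.
pose G u := if [pick p : 'I_(arity t) * 'I_(arity t') | alp t' p.2 (alp t p.1 a) == u]
  is Some p then Ts p.1 p.2 else F u.
have GE j l : G (alp t' l (alp t j a)) = Ts j l.
  rewrite /G; case: pickP => [[j' l'] /= /eqP E|/(_ (j, l))]; last by rewrite eqxx.
  have jj' : j' = j.
    apply: (independent_alp ind Aa).
    exact: (@independent_act _ _ _ [:: existT _ t' l'] [:: existT _ t' l] ind1).
  by move: E; rewrite jj' => /(independent_alp ind1 (A1 j)) ->.
have GN u : A u -> u <> a -> G u = F u.
  move=> Au ua; rewrite /G; case: pickP => // -[j l] /= /eqP E; case: ua; symmetry.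
  exact: (@independent_act _ _ _ [:: existT _ t j; existT _ t' l] [::] ind).
exists G; rewrite {1}LF; apply/seteqP; split=> v.
  move=> [c [[Ac /= ca]|[j _ <-]]].
    by rewrite -GN // => h; exists c => //; left.
  rewrite FTs /= => -[l h]; exists (alp t' l (alp t j a)); first by right; exists j, l.
  by rewrite GE.
move=> [c [[Ac ca]|[j [l ->]]]]; first by rewrite GN // => h; exists c => //; left.
by rewrite GE => h; exists (alp t j a); [exact: A1|rewrite FTs; exists l].
Qed.

(** * Reordering descending words *)

Lemma swap_letters (l1 l2 : letter) : exists l1' l2' : letter,
  [/\ tag l1' = tag l1, tag l2' = tag l2
    & forall u : U, act u [:: l1; l2] = act u [:: l2'; l1']].
Proof.
have [_ _ laws] := satU.
pose arity_of t := 'I_(@arity S t).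
have law (t t' : colour) (L : law (@arity S) t t') : (t < t')%N -> sigma2 t t' = Some L ->
    forall j (l : arity_of (law_f L j)), let q := law_phi (existT _ j l) in forall u : U,
    act u [:: existT arity_of t j; existT arity_of _ l] =
    act u [:: existT arity_of t' (tag q); existT arity_of _ (tagged q)].
  by move=> tt' sL j l q u; exact: (laws t t' L tt' sL (existT _ j l) u).
have [lt|lt|eq] := ltngtP (tag l1) (tag l2).
- have [L [sL fE f'E]] := cplS lt.
  case: l1 l2 lt L sL fE f'E => t j [t' l] /= lt L sL fE f'E.
  (* The colour [law_f L j] is [t'] only up to the equation [fE], so the index is transported and
     compared as a letter. *)
  have [l' l'E] : exists l' : 'I_(arity (law_f L j)),
      existT arity_of _ l' = existT arity_of t' l.
    by case: _ / (esym (fE j)) l => l; exists l.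
  have := law _ _ L lt sL j l'; rewrite l'E => h.
  exists (existT arity_of _ (tagged (law_phi (existT _ j l')))),
    (existT arity_of t' (tag (law_phi (existT _ j l')))).
  by split=> //=; exact: f'E.
- have [L [sL fE f'E]] := cplS lt.
  case: l1 l2 lt L sL fE f'E => t j [t' l] /= lt L sL fE f'E.
  have [l' l'E] : exists l' : 'I_(arity (law_f' L j)),
      existT arity_of _ l' = existT arity_of t' l.
    by case: _ / (esym (f'E j)) l => l; exists l.
  have [psi phiK psiK] := law_phi_bij L.
  case: (psi (existT _ j l')) (psiK (existT _ j l')) => jq lq E.
  have h u := law _ _ L lt sL jq lq u; rewrite E in h.
  have l'A (v : U) : alp _ l' v = alp t' l v.
    exact: (congr1 (fun k : letter => alp (tag k) (tagged k) v) l'E).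
  exists (existT arity_of _ lq), (existT arity_of t' jq).
  by split=> // [|u /=]; [exact: fE|rewrite -l'A; exact: (esym (h u))].
(* With equal colours the letters stay in place and only exchange their names. *)
- by exists l2, l1; split=> //; apply: val_inj.
Qed.

Lemma bubble_letter (p : seq letter) (l : letter) : exists (l' : letter) p',
  [/\ tag l' = tag l, colouring p' = colouring p
    & forall u : U, act u (rcons p l) = act u (l' :: p')].
Proof.
elim: p => [|k p [l' [p' [tl cp h]]]]; first by exists l, [::].
have [k' [l'' [tk tl' h']]] := swap_letters k l'.
exists l'', (k' :: p'); split; rewrite ?tl' //= ?tk ?cp //.
by move=> u; rewrite h; have := h' u; rewrite /= => ->.
Qed.

Lemma reorder_word (nu : seq letter) cs : perm_eq cs (colouring nu) ->
  exists2 nu', colouring nu' = cs & forall u : U, act u nu = act u nu'.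
Proof.
elim: cs nu => [|c cs IH] nu pe.
  by case: nu pe => [|l nu /perm_size //]; exists [::].
have : c \in colouring nu by rewrite -(perm_mem pe) mem_head.
move=> /mapP[l lnu cE]; have [p [q nuE]] : exists p q, nu = p ++ l :: q.
  by case/splitPr: lnu => p q; exists p, q.
have [l' [p' [tl cp h]]] := bubble_letter p l.
have [nu' cnu' h'] : exists2 nu', colouring nu' = cs &
    forall u : U, act u (p' ++ q) = act u nu'.
  apply: IH; rewrite -(perm_cons c) (perm_trans pe) // nuE /colouring !map_cat.
  by rewrite -/(colouring p') cp cE /= -cat1s -[X in perm_eq _ X]cat1s perm_catCA.
exists (l' :: nu'); first by rewrite /= tl -cE cnu'.
by move=> u; rewrite nuE -cat_rcons act_cat h /= -h' act_cat.
Qed.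

(** The elements satisfying [P] form an algebra. Extending the inclusion of [X] gives a map from [U]
    to it which, composed with the projection to [U], fixes generators and hence is the identity. *)
Lemma basis_ind (X : set U) (P : U -> Prop) : X !=set0 -> generates X -> independent X ->
  (forall u, X u -> P u) -> (forall t us, (forall j, P (us j)) -> P (lam t us)) ->
  (forall t j u, P u -> P (alp t j u)) -> forall u, P u.
Proof.
move=> [x0 Xx0] gen ind PX Pl Pa.
pose B := @Algebra S {u | P u}
  (fun t us => exist _ (lam t (fun j => sval (us j))) (Pl t _ (fun j => svalP (us j))))
  (fun t j u => exist _ (alp t j (sval u)) (Pa t j _ (svalP u))).
have satB : satisfies B.
  have [h1 h2 h3] := satU; split=> [t u|t us j|t t' L tt' sL p u]; apply: sval_eq => /=.
  - exact: h1.
  - exact: h2.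
  - exact: h3.
pose h u : B := if pselect (P u) is left Pu then exist _ u Pu else exist _ x0 (PX _ Xx0).
have [phi hphi phiX] := ind B satB h.
suff E : (fun u => sval (phi u)) =1 id by move=> u; rewrite -(E u); exact: svalP.
apply: gen => //.
  by split=> [t us|t j u]; rewrite ?hphi.1 ?hphi.2.
by move=> b Xb; rewrite phiX // /h; case: pselect => // /(_ (PX _ Xb)).
Qed.

(** If [B'] had an element outside [B], two homomorphisms could agree on [B] and differ at that
    element. *)
Lemma basis_subset (B B' : set U) : generates B -> independent B' -> B `<=` B' -> B = B'.
Proof.
move=> gen ind BB'; apply/seteqP; split=> // b B'b; apply: contrapT => Bb.
have [phi hphi phiE] := ind A0 sat0 (fun=> a0).
have [psi hpsi psiE] := ind A0 sat0 (fun u => if u == b then a1 else a0).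
have E : phi =1 psi.
  apply: gen => // c Bc; rewrite phiE ?psiE ?ifF //; try exact: BB'.
  by apply/eqP => cb; rewrite -cb in Bb.
by apply: a01; have := E b; rewrite phiE // psiE // eqxx.
Qed.

Fixpoint full_tree (cs : seq colour) : tree :=
  if cs is t :: cs' then Node (fun _ : 'I_(arity t) => full_tree cs') else Leaf.

Lemma leaves_full cs u v : leaves (full_tree cs) u v <->
  exists2 nu, colouring nu = cs & v = act u nu.
Proof.
elim: cs u => [|t cs IH] u /=.
  by split=> [->|[[|//] _ ->//]]; exists [::].
split=> [[j /IH[nu <- ->]]|[[//|[t' j] nu] /= [t't cnu] vE]].
  by exists (existT _ t j :: nu).
by subst t'; exists j; apply/IH; exists nu.
Qed.

Lemma perm_flatten_mem (I : eqType) (T : eqType) (f : I -> seq T) (s : seq I) i : i \in s ->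
  exists rest, perm_eq (f i ++ rest) (flatten (map f s)).
Proof.
case/splitPr => p q; exists (flatten (map f p) ++ flatten (map f q)).
by rewrite map_cat flatten_cat /= perm_catCA.
Qed.

Definition descends (X : set U) (u : U) : Prop := exists2 x, X x & exists mu, u = act x mu.

(** By [reorder_word] only the colours of [nu] matter. A contraction of colour [t] is undone by one
    letter [t] brought to the front, and the concatenated lists of its arguments serve whichever
    argument is then selected. *)
Lemma eventually_descends (X : set U) : X !=set0 -> generates X -> independent X ->
  forall u, exists cs, forall nu ds, perm_eq (cs ++ ds) (colouring nu) ->
    descends X (act u nu).
Proof.
move=> X0 gen ind; apply: (basis_ind X0) => // [u Xu|t us /choice[cs hcs]|t j u [cs hcs]].
- by exists [::] => nu ds _; exists u => //; exists nu.
- exists (t :: flatten (map cs (enum 'I_(arity t)))) => nu ds.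
  move=> /reorder_word[[|l nu'] //= [lt cnu'] ->] /=; case: l lt => t' j /= t't; subst t'.
  have [_ -> _] := satU; have [rest pe] := perm_flatten_mem cs (mem_enum predT j).
  apply: (hcs j nu' (rest ++ ds)).
  by rewrite cnu' catA perm_cat2r.
- exists cs => nu ds pe; apply: (hcs (existT _ t j :: nu) (ds ++ [:: t])).
  by rewrite catA perm_sym /= -cat1s perm_sym perm_catC /= perm_cons.
Qed.

(** * Common expansions of two bases *)

Inductive grows (A : seq U) : seq U -> Prop :=
| grows0 : grows A A
| growsS B k t : grows A B -> (k < size B)%N -> grows A (expand t k B).

Lemma grows_tuple A B : grows A B -> is_tuple A -> is_tuple B.
Proof. by elim=> // C k t _ IH kC /IH tC; case: (tuple_expand t tC kC). Qed.

Lemma tuple_uniq (A : seq U) : is_tuple A -> uniq A.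
Proof. by move=> /is_tupleP[]. Qed.

Lemma tuple_ind (A : seq U) : is_tuple A -> independent [set` A].
Proof. by move=> /is_tupleP[]. Qed.

Lemma tuple_gen (A : seq U) : is_tuple A -> generates [set` A].
Proof. by move=> /is_tupleP[]. Qed.

Lemma tuple_neq0 (A : seq U) : is_tuple A -> [set` A] !=set0.
Proof. by move=> /is_tupleP[_ + _ _]; case: A => // a A _; exists a; rewrite /= mem_head. Qed.

Lemma tuple_set_expand (A : seq U) a t : is_tuple A -> a \in A -> exists2 k,
  (k < size A)%N & [set` expand t k A] = expand_at [set` A] a t.
Proof.
move=> tA /split_mem[p [q AE]]; have := tuple_uniq tA; rewrite AE => uA.
by exists (size p); [rewrite size_cat /= -addSnnS leq_addr|exact: set_expand].
Qed.

Lemma expands_grows (A : seq U) (Bs : set U) : is_tuple A -> expands [set` A] Bs ->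
  exists2 B, grows A B & [set` B] = Bs.
Proof.
move=> tA; elim/clos_refl_trans_ind_left => [|C D _ [B AB BC] [b [t [Cb ->]]]].
  by exists A => //; constructor.
have tB := grows_tuple AB tA; rewrite -BC in Cb *.
have [k kB <-] := tuple_set_expand t tB Cb; exists (expand t k B) => //.
exact: growsS.
Qed.

Lemma grows_mod A B : grows A B -> is_tuple A ->
  size A = size B %[mod \big[gcdn/0%N]_(t < colours S) (arity t).-1].
Proof.
elim=> // C k t AC IH kC tA; have [_ ->] := tuple_expand t (grows_tuple AC tA) kC.
rewrite IH // up_add -[RHS]modnDmr.
have /eqP -> : (\big[gcdn/0%N]_(t < colours S) (arity t).-1 %| (arity t).-1)%N.
  exact/biggcdn_inf/dvdnn.
by rewrite addn0.
Qed.

(** Full expansion along the colours [CS] makes each [b] a descendant of [X], by a word [mu b].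
    Expanding [b] by the colours that complete those of [mu b] to the fixed list [K] gives a basis
    inside the full expansion of [X] along [K]; the two are equal by [basis_subset]. *)
Lemma common_expansion (A X : seq U) : is_tuple A -> is_tuple X ->
  exists W, expands [set` A] W /\ expands [set` X] W.
Proof.
move=> tA tX.
have /choice[cs hcs] := eventually_descends (tuple_neq0 tX) (tuple_gen tX) (tuple_ind tX).
pose CS := flatten (map cs A).
have eA := forest_expands (fun=> full_tree CS) (tuple_uniq tA) (tuple_ind tA).
have [A1 AA1 A1E] := expands_grows tA eA; have tA1 := grows_tuple AA1 tA.
have /choice[mu hmu] : forall b, exists mu, b \in A1 -> exists2 x, x \in X & b = act x mu.
  move=> b; have [bA1|] := boolP (b \in A1); last by exists [::].
  have : [set` A1] b by [].
  rewrite A1E => -[a Aa /leaves_full[nu cnu ->]].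
  have [rest pe] := perm_flatten_mem cs Aa.
  have [|x Xx [m ->]] := hcs a nu rest; first by rewrite cnu.
  by exists m => _; exists x.
pose K := flatten (map (fun b => colouring (mu b)) A1).
have /choice[rest hrest] : forall b, exists rest, b \in A1 ->
    perm_eq (colouring (mu b) ++ rest) K.
  move=> b; have [bA1|] := boolP (b \in A1); last by exists [::].
  by have [s hs] := perm_flatten_mem (fun b => colouring (mu b)) bA1; exists s.
have eA1 := forest_expands (fun b => full_tree (rest b)) (tuple_uniq tA1) (tuple_ind tA1).
have eX := forest_expands (fun=> full_tree K) (tuple_uniq tX) (tuple_ind tX).
exists (forest [set` X] (fun=> full_tree K)); split=> //.
suff <- : forest [set` A1] (fun b => full_tree (rest b)) = forest [set` X] (fun=> full_tree K).
  by apply: rt_trans eA1; rewrite A1E.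
apply: basis_subset.
- exact: generates_expands eA1 (tuple_gen tA1).
- exact: independent_expands eX (tuple_ind tX).
- move=> v [b bA1 /leaves_full[nu cnu ->]].
  have [x Xx bE] := hmu b bA1; exists x => //; apply/leaves_full.
  have [|nu' cnu' E] := @reorder_word (mu b ++ nu) K.
    by rewrite perm_sym /colouring map_cat -/(colouring nu) cnu hrest.
  by exists nu' => //; rewrite -E act_cat -bE.
Qed.

Lemma tuple_size_mod (A X : seq U) : is_tuple A -> is_tuple X ->
  size A = size X %[mod \big[gcdn/0%N]_(t < colours S) (arity t).-1].
Proof.
move=> tA tX; have [W [eA eX]] := common_expansion tA tX.
have [A' gA A'W] := expands_grows tA eA; have [X' gX X'W] := expands_grows tX eX.
rewrite (grows_mod gA tA) (grows_mod gX tX); congr modn; apply: perm_size.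
apply: uniq_perm; first exact: tuple_uniq (grows_tuple gA tA).
  exact: tuple_uniq (grows_tuple gX tX).
move=> v; apply/idP/idP => h.
  by have : [set` A'] v by []; rewrite A'W -X'W.
by have : [set` X'] v by []; rewrite X'W -A'W.
Qed.

Lemma contract_expand (A B : set U) : independent A -> simple_expansion A B ->
  simple_contraction B A.
Proof.
have [lamK _ _] := satU; move=> ind [a [t [Aa ->]]].
exists t, (fun j => alp t j a); split.
- exact: independent_alp ind Aa.
- by move=> j; right; exists j.
rewrite lamK; apply/seteqP; split=> v.
  move=> Av; have [->|/eqP va] := eqVneq v a; first by right.
  left; split; first by left.
  move=> [j _ E]; apply: va; symmetry.
  exact: (@independent_act _ a v [:: existT _ t j] [::] ind).
by move=> [[[[Av _]|[j _ <-]] nr]|->] //; case: nr; exists j.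
Qed.

(** The free generators are expanded to a common expansion with [A], from which the steps leading up
    from [A] are undone by contractions. *)
Lemma tuple_admissible r (x : 'I_r -> U) (X A : seq U) : is_tuple X -> [set` X] = range x ->
  is_tuple A -> admissible x [set` A].
Proof.
move=> tX Xx tA; have [W [eA eX]] := common_expansion tA tX.
have xW : admissible x W.
  move: eX; rewrite Xx /admissible; elim=> [C D h|C|C D E _ h1 _ h2].
  - by apply: rt_step; left.
  - exact: rt_refl.
  - exact: rt_trans h1 h2.
apply: rt_trans xW _; move: (tuple_ind tA).
elim: eA => [C D h indC|C _|C D E CD h1 DE h2 indC].
- by apply: rt_step; right; exact: contract_expand.
- exact: rt_refl.
- exact: rt_trans (h2 (independent_expands CD indC)) (h1 indC).
Qed.

Lemma hom_map_expand (A B : algebra S) (g : A -> B) t k (s : seq A) : is_hom g ->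
  map g (expand t k s) = expand t k (map g s).
Proof.
move=> [_ hg]; rewrite /expand -map_drop; case: (drop k s) => [//|a q].
rewrite !map_cat map_take /= -[map g (map _ _)]map_comp.
by rewrite (@eq_map _ _ (g \o (fun j => alp t j a)) (fun j => alp t j (g a))) // => j;
  exact: hg.
Qed.

(** * Automorphisms and tuples *)

Lemma aut_inj (g : algebra_aut U) : injective g.
Proof. exact: can_inj (autK g). Qed.

Lemma tuple_map_aut (g : algebra_aut U) (A : seq U) : is_tuple A -> is_tuple (map g A).
Proof.
move=> /is_tupleP[uA A0' gen ind]; apply/is_tupleP; split.
- by rewrite (map_inj_uniq (@aut_inj g)).
- by case: A A0' {uA gen ind}.
- move=> C satC phi psi hphi hpsi eqA u; rewrite -[u](autVK g).
  apply: (gen C satC (phi \o g) (psi \o g)) => [||b Ab] /=; last first.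
  + by apply: eqA; rewrite /= map_f.
  + by have [h1 h2] := aut_hom g; split=> * /=; rewrite ?h1 ?h2 ?hpsi.1 ?hpsi.2.
  + by have [h1 h2] := aut_hom g; split=> * /=; rewrite ?h1 ?h2 ?hphi.1 ?hphi.2.
- move=> C satC h; have [phi hphi eqA] := ind C satC (h \o g).
  exists (phi \o autV g) => [|_ /= /mapP[b Ab ->]]; last by rewrite autK eqA.
  by have [h1 h2] := aut_inv_hom g; split=> * /=; rewrite ?h1 ?h2 ?hphi.1 ?hphi.2.
Qed.

Lemma tuple_aut_uniq (g h : algebra_aut U) (A : seq U) : is_tuple A ->
  map g A = map h A -> g = h.
Proof.
move=> /tuple_gen gen E; apply: aut_eq; apply: gen => //; try exact: aut_hom.
by move=> b /= Ab; move/eq_in_map: E => ->.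
Qed.

Lemma tuple_aut_exists (A B : seq U) : is_tuple A -> is_tuple B -> size A = size B ->
  exists g : algebra_aut U, map g A = B.
Proof.
move=> tA tB sAB.
have hom_between C D : is_tuple C -> is_tuple D -> size C = size D ->
    exists2 phi : U -> U, is_hom phi & map phi C = D.
  move=> tC tD sCD.
  have [phi hphi eqC] := tuple_ind tC satU (fun u => nth u0 D (index u C)).
  exists phi => //; apply: (@eq_from_nth _ u0); rewrite size_map // => i iC.
  by rewrite (nth_map u0) // eqC /= ?mem_nth // index_uniq // tuple_uniq.
have [phi hphi AB] := hom_between A B tA tB sAB.
have [psi hpsi BA] := hom_between B A tB tA (esym sAB).
have cancel_map (f g : U -> U) C D : is_hom f -> is_hom g -> is_tuple C ->
    map f C = D -> map g D = C -> cancel f g.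
  move=> hf hg tC CD DC; apply: (tuple_gen tC satU (phi := g \o f)) => //.
    by split=> * /=; rewrite ?hf.1 ?hf.2 ?hg.1 ?hg.2.
  move=> b /= Cb; move: DC; rewrite -CD -map_comp -[RHS]map_id => /eq_in_map; exact.
exists (Aut hphi (cancel_map _ _ _ _ hphi hpsi tA AB BA)
  (cancel_map _ _ _ _ hpsi hphi tB BA AB)).
exact: AB.
Qed.

Lemma map_tuple_aut (A B : seq U) : is_tuple A -> is_tuple B -> size A = size B ->
  map (tuple_aut A B) A = B.
Proof.
move=> tA tB sAB; have [g gE] := tuple_aut_exists tA tB sAB.
exact: (@xgetPex _ 1%g [set g : algebra_aut U | map g A = B] (ex_intro _ g gE)).
Qed.

(** * Chains of operations realising a law *)

Lemma chain_len_ge i (c : seq (nat * colour)) : (i <= chain_len i c)%N.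
Proof.
by elim: c i => [|[k t] c IH] i //=; apply: leq_trans (ltnW (up_gt i t)) (IH _).
Qed.

Fixpoint valid_chain (i : nat) (c : seq (nat * colour)) : bool :=
  if c is (k, t) :: c' then (k < i)%N && valid_chain (up i t) c' else true.

Lemma chain_tuple (A : seq U) c : is_tuple A -> valid_chain (size A) c ->
  is_tuple (chain_apply c A) /\ size (chain_apply c A) = chain_len (size A) c.
Proof.
elim: c A => [|[k t] c IH] A tA //= /andP[kA vc].
have [tA1 sA1] := tuple_expand t tA kA; rewrite -sA1 in vc *.
exact: IH.
Qed.

Lemma sum_before (d : nat) (F : 'I_d -> nat) m : (m <= d)%N ->
  (forall j : 'I_d, (j < m)%N -> F j = 1%N) -> (\sum_(j < d | (j < m)%N) F j = m)%N.
Proof.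
move=> md hF; rewrite (eq_bigr (fun=> 1%N)) => [|j /hF//].
by rewrite (big_ord_narrow md) sum_nat_const card_ord muln1.
Qed.

(** The children are expanded from the last to the first, so the ones before the current child are
    unexpanded and the sum in [children_chain] is just its index. *)
Lemma children_chain_rev t (f : 'I_(arity t) -> colour) (a : U) (p : seq U)
    (done : seq 'I_(arity t)) m (tail : seq U) :
  (m <= arity t)%N -> (forall j, j \in done -> (m <= j)%N) ->
  let c := children_chain f (size p) done (rev (take m (enum 'I_(arity t)))) in
  chain_apply c (p ++ [seq alp t j a | j <- take m (enum 'I_(arity t))] ++ tail) =
  p ++ flatten [seq [seq alp (f j) l (alp t j a) | l <- enum 'I_(arity (f j))]
               | j <- take m (enum 'I_(arity t))] ++ tail /\
  valid_chain (size p + m + size tail) c.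
Proof.
elim: m done tail => [|m IH] done tail mt hdone; first by rewrite take0.
pose jm := Ordinal mt.
have takeE : take m.+1 (enum 'I_(arity t)) = rcons (take m (enum 'I_(arity t))) jm.
  rewrite (take_nth jm) ?size_enum_ord //; congr rcons.
  by apply: val_inj; rewrite /= nth_enum_ord.
rewrite takeE rev_rcons /=; set s := take m _ in IH *.
have ss : size s = m by rewrite size_takel // size_enum_ord ltnW.
rewrite (@sum_before _ _ m) //; last 2 first.
- exact: ltnW.
- by move=> j jm'; case: ifP => // /hdone; rewrite leqNgt ltnS ltnW.
rewrite map_rcons cat_rcons.
have -> : expand (f jm) (size p + m) (p ++ [seq alp t j a | j <- s] ++ alp t jm a :: tail) =
    p ++ [seq alp t j a | j <- s] ++ ([seq alp (f jm) l (alp t jm a)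
      | l <- enum 'I_(arity (f jm))] ++ tail).
  by rewrite catA -{1}ss -(size_map (fun j => alp t j a)) -size_cat expand_cat -!catA.
have [|j|-> vc] := IH (jm :: done)
    ([seq alp (f jm) l (alp t jm a) | l <- enum 'I_(arity (f jm))] ++ tail).
- exact: ltnW.
- by rewrite in_cons => /orP[/eqP->//|/hdone/ltnW].
split.
  by rewrite map_rcons flatten_rcons -catA.
move: vc; rewrite size_cat size_map size_enum_ord => vc.
rewrite addnS ltnS leq_addr /=.
rewrite (_ : up _ _ = size p + m + (arity (f jm) + size tail))%N //.
by rewrite /up; have := arity_gt1 (f jm); move: (arity _) (size p) (size tail); clear; lia.
Qed.

Definition replace_law (A : set U) a t (f : 'I_(arity t) -> colour) : set U :=
  [set v | (A v /\ v <> a) \/ exists j (l : 'I_(arity (f j))), v = alp (f j) l (alp t j a)].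

Lemma law_chain_exists t (f : 'I_(arity t) -> colour) (A : seq U) k : is_tuple A ->
  (k < size A)%N -> exists a c, [/\ a = nth u0 A k, law_chain f k ((k, t) :: c),
    valid_chain (up (size A) t) c
  & [set` chain_apply c (expand t k A)] = replace_law [set` A] a f].
Proof.
move=> tA /split_nth[p [a [q [AE <-]]]]; have := tuple_uniq tA; rewrite {}AE => uA.
have [//|cE vc] := @children_chain_rev t f a p [::] (arity t) q (leqnn _).
rewrite take_oversize ?size_enum_ord // in cE vc.
exists a, (children_chain f (size p) [::] (rev (enum 'I_(arity t)))); split.
- by rewrite nth_cat ltnn subnn.
- by exists (rev (enum 'I_(arity t))); rewrite ?perm_rev.
- move: vc; rewrite up_add size_cat /=; congr valid_chain.
  by have := arity_gt1 t; move: (arity t) (size p) (size q); clear; lia.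
rewrite expand_cat cE; apply/seteqP; split=> v.
  rewrite /= !mem_cat => /or3P[vp|/flattenP[_ /mapP[j _ ->] /mapP[l _ ->]]|vq].
  - left; split; first by rewrite /= mem_cat vp.
    move=> va; move: uA; rewrite cat_uniq => /and3P[_ /hasPn/(_ a) + _].
    by rewrite mem_head /= -va vp => /(_ isT).
  - by right; exists j, l.
  - left; split; first by rewrite /= mem_cat in_cons vq !orbT.
    by move=> va; move: uA; rewrite cat_uniq /= -va vq !andbF.
move=> [[/= ]|[j [l ->]]]; rewrite /= !mem_cat.
  by rewrite in_cons => /or3P[->//|/eqP//|->]; rewrite !orbT.
apply/orP; right; apply/orP; left; apply/flattenP.
exists [seq alp (f j) l (alp t j a) | l <- enum 'I_(arity (f j))].
  by apply/mapP; exists j; rewrite ?mem_enum.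
by apply/mapP; exists l; rewrite ?mem_enum.
Qed.

Lemma replace_law_eq (A : set U) a t t' (L : law (@arity S) t t') : (t < t')%N ->
  sigma2 t t' = Some L -> replace_law A a (law_f L) = replace_law A a (law_f' L).
Proof.
have [_ _ laws] := satU; move=> tt' sL; apply/seteqP; split=> v; case=> [|[j [l ->]]].
- by left.
- right; have := laws t t' L tt' sL (existT _ j l) a => /= ->.
  by exists (tag (law_phi (existT _ j l))), (tagged (law_phi (existT _ j l))).
- by left.
- right; have [psi phiK psiK] := law_phi_bij L.
  have := laws t t' L tt' sL (psi (existT _ j l)) a; rewrite psiK /= => <-.
  by exists (tag (psi (existT _ j l))), (tagged (psi (existT _ j l))).
Qed.

Lemma replace_law_twice (A : set U) a t t' (f : 'I_(arity t) -> colour) :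
  (forall j, f j = t') -> replace_law A a f = expand_twice A a t t'.
Proof.
move=> /funext fE; by rewrite (_ : f = fun=> t').
Qed.

Lemma set_expand_nth (A : seq U) k t : uniq A -> (k < size A)%N ->
  [set` expand t k A] = expand_at [set` A] (nth u0 A k) t.
Proof.
move=> uA /split_nth[p [a [q [AE <-]]]]; rewrite AE in uA *.
by rewrite set_expand // nth_cat ltnn subnn.
Qed.

(** * The presentation *)

Section Coherence.
Variables (r : nat) (x : 'I_r -> U) (n : nat) (E : set (nat * colour)) (X : nat -> seq U).
Hypotheses (r0 : (0 < r)%N) (bdd : is_bounded x) (lift : is_lift x E X).
Local Notation W := (@truncated_gens S r n).
Local Notation Rel := (truncated_relators r E X n).
Local Notation Gam := (presented W Rel).
Local Open Scope group_scope.

Lemma Rel_word_over p : Rel p -> word_over W p.1 /\ word_over W p.2.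
Proof. by case. Qed.

Let lengths_r : lengths S r r. Proof. by []. Qed.

Lemma X_tuple i : lengths S r i -> is_tuple (X i) /\ size (X i) = i.
Proof. by case: lift => h _ _; exact: h. Qed.

Lemma tuple_lengths (A : seq U) : is_tuple A -> lengths S r (size A).
Proof.
move=> tA; have [tX sX] := X_tuple lengths_r; split; last first.
  by rewrite (tuple_size_mod tA tX) sX.
by have [a] := tuple_neq0 tA; case: (A).
Qed.

Lemma X_aut (A : seq U) : is_tuple A -> exists g : algebra_aut U, map g (X (size A)) = A.
Proof.
by move=> tA; have [tX sX] := X_tuple (tuple_lengths tA); exact: tuple_aut_exists.
Qed.

(** * Relations in the group of the truncated presentation *)

Definition gcls (g : gen S) : Gam := cls W Rel [:: (g, false)].

Lemma cls_cons g (w : seq (gen S)) : cls W Rel (pos (g :: w)) = gcls g * cls W Rel (pos w).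
Proof. by rewrite -cls_cat. Qed.

Lemma W_strict i k (t : colour) : lengths S r i -> (k < i)%N -> (up i t <= n)%N -> W (Strict i k t).
Proof. by move=> Li ki tn; split. Qed.

Lemma W_perm i (s : 'S_i) : lengths S r i -> (i <= n)%N -> W (Perm i s).
Proof. by move=> Li iN; split. Qed.

Lemma word_over_pos (w : seq (gen S)) : (forall g, List.In g w -> W g) -> word_over W (pos w).
Proof.
elim: w => //= g w IH h; apply/andP; split; first by apply/asboolP/h; left.
by apply: IH => g' hg'; apply: h; right.
Qed.

Lemma cls_relator w w' : relators r E X (pos w, pos w') ->
  (forall g, List.In g w -> W g) -> (forall g, List.In g w' -> W g) ->
  cls W Rel (pos w) = cls W Rel (pos w').
Proof.
move=> rel h h'; apply: (cls_rel Rel_word_over); split=> //.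
by split; exact: word_over_pos.
Qed.

Lemma gcls_permM i (s1 s2 : 'S_i) : lengths S r i -> (i <= n)%N ->
  gcls (Perm i (s1 * s2)) = gcls (Perm i s1) * gcls (Perm i s2).
Proof.
move=> Li iN; rewrite -cls_cat; apply: (@cls_relator [:: _] [:: _; _]).
- by right; constructor.
- by move=> g [<-|[]]; exact: W_perm.
- by move=> g [<-|[<-|[]]]; exact: W_perm.
Qed.

Lemma gcls_perm1 i : lengths S r i -> (i <= n)%N -> gcls (Perm i 1) = 1.
Proof.
move=> Li iN; apply: (mulgI (gcls (Perm i 1))).
by rewrite -gcls_permM // !mulg1.
Qed.

Lemma gcls_disjoint i k1 k2 (t t' : colour) : lengths S r i -> (k1 < k2)%N -> (k2 < i)%N ->
  (up (up i t) t' <= n)%N ->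
  gcls (Strict i k1 t) * gcls (Strict (up i t) (up k2 t) t') =
  gcls (Strict i k2 t') * gcls (Strict (up i t') k1 t).
Proof.
move=> Li k12 k2i tn; rewrite -!cls_cat; apply: (@cls_relator [:: _; _] [:: _; _]).
- by left; left; left; right; constructor.
- have k1i := ltn_trans k12 k2i.
  move=> g [<-|[<-|[]]]; apply: W_strict => //.
  + by apply: leq_trans tn; exact: ltnW (up_gt _ _).
  + exact: lengths_up.
  + by rewrite !up_add ltn_add2r.
- have tn' : (up (up i t') t <= n)%N by move: tn; rewrite !up_add addnAC.
  move=> g [<-|[<-|[]]]; apply: W_strict => //.
  + by apply: leq_trans tn'; exact: ltnW (up_gt _ _).
  + exact: lengths_up.
  + by apply: ltn_trans (ltn_trans k12 k2i) (up_gt _ _).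
Qed.

(** Relators speak of the chosen tuples [X i]; an automorphism carries [X i] to any tuple of the
    same length and commutes with the operations. *)
Lemma gcls_perm_strict (A : seq U) i (s : 'S_i) (k : 'I_i) (t : colour) (s' : 'S_(up i t)) :
  is_tuple A -> size A = i -> (up i t <= n)%N ->
  expand t (s k) (permute s A) = permute s' (expand t k A) ->
  gcls (Perm i s) * gcls (Strict i (s k) t) =
  gcls (Strict i k t) * gcls (Perm (up i t) s').
Proof.
move=> tA sA tn; have Li := tuple_lengths tA; have [g gA] := X_aut tA.
rewrite sA in Li gA; rewrite -gA !(permute_map, =^~ hom_map_expand _ _ _ (aut_hom g)).
move=> /(inj_map (@aut_inj g)) eqX; have iN : (i <= n)%N := leq_trans (ltnW (up_gt i t)) tn.
rewrite -!cls_cat; apply: (@cls_relator [:: _; _] [:: _; _]).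
- by left; right; constructor.
- by move=> h [<-|[<-|[]]]; [exact: W_perm|exact: W_strict].
- by move=> h [<-|[<-|[]]]; [exact: W_strict|apply: W_perm => //; exact: lengths_up].
Qed.

(** A chain of operations from [A] to [B], its strict operations staying within length [n], has a
    word of class [a]. *)
Inductive rep (A : seq U) : seq U -> Gam -> Prop :=
| rep0 : rep A A 1
| repS B a k t : rep A B a -> (k < size B)%N -> (up (size B) t <= n)%N ->
    rep A (expand t k B) (a * gcls (Strict (size B) k t))
| repP B a i (s : 'S_i) : rep A B a -> size B = i ->
    rep A (permute s B) (a * gcls (Perm i s)).

Lemma rep_trans A B C a b : rep A B a -> rep B C b -> rep A C (a * b).
Proof.
move=> AB; elim=> [|D c k t _ IH kD tn|D c i s _ IH sD]; first by rewrite mulg1.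
- by rewrite mulgA; exact: repS.
- by rewrite mulgA; exact: repP.
Qed.

Lemma tuple_permute i (s : 'S_i) (A : seq U) : is_tuple A -> size A = i ->
  is_tuple (permute s A).
Proof.
move=> [uA bA] sA; have pe := permute_perm_eq s sA; split; first by rewrite (perm_uniq pe).
by rewrite (_ : [set` permute s A] = [set` A]) //; apply/seteqP; split=> v;
  rewrite /= (perm_mem pe).
Qed.

Lemma rep_tuple A B a : rep A B a -> is_tuple A -> is_tuple B /\ (size A <= size B)%N.
Proof.
elim=> [//|C c k t _ IH kC _ /IH[tC sC]|C c i s _ IH sC /IH[tC AC]].
  have [tD sD] := tuple_expand t tC kC; split=> //; rewrite sD.
  by apply: leq_trans sC _; exact: ltnW (up_gt _ _).
by split; [exact: tuple_permute|rewrite size_permute // -sC].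
Qed.

Lemma rep_expands A B a : rep A B a -> is_tuple A -> expands [set` A] [set` B].
Proof.
elim=> [_|C c k t AC IH kC _ tA|C c i s _ IH sC tA]; first exact: rt_refl.
  apply: rt_trans (IH tA) _; apply: rt_step; have [tC _] := rep_tuple AC tA.
  have uC := tuple_uniq tC; have [p [b [q [CE <-]]]] := split_nth kC.
  rewrite CE in uC *; exists b, t; split; first by rewrite /= mem_cat mem_head orbT.
  exact: set_expand.
rewrite (_ : [set` permute s C] = [set` C]); first exact: IH.
by apply/seteqP; split=> v; rewrite /= (perm_mem (permute_perm_eq s sC)).
Qed.

Lemma rep_map A B a (g : algebra_aut U) : rep A B a -> rep (map g A) (map g B) a.
Proof.
elim=> [|C c k t _ IH kC tn|C c i s _ IH sC]; first exact: rep0.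
  rewrite (hom_map_expand _ _ _ (aut_hom g)) -(size_map g C).
  by apply: repS => //; rewrite size_map.
by rewrite -permute_map; apply: repP => //; rewrite size_map.
Qed.

Lemma rep_grows A B : grows A B -> is_tuple A -> (size B <= n)%N -> exists a, rep A B a.
Proof.
elim=> [_ _|C k t AC IH kC tA]; first by exists 1; exact: rep0.
have [_ sC] := tuple_expand t (grows_tuple AC tA) kC; rewrite sC => tn.
have [|a ha] := IH tA; first exact: leq_trans (ltnW (up_gt _ _)) tn.
by eexists; apply: repS ha kC tn.
Qed.

Lemma set_perm_eq (A B : seq U) : is_tuple A -> is_tuple B -> [set` A] = [set` B] ->
  perm_eq A B.
Proof.
move=> tA tB AB; apply: uniq_perm; [exact: tuple_uniq|exact: tuple_uniq|].
move=> v; apply/idP/idP => h; first by have : [set` A] v by []; rewrite AB.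
by have : [set` B] v by []; rewrite -AB.
Qed.

Lemma rep_exists (A B : seq U) : is_tuple A -> is_tuple B -> expands [set` A] [set` B] ->
  (size B <= n)%N -> exists a, rep A B a.
Proof.
move=> tA tB /(expands_grows tA)[C AC CB] Bn; have tC := grows_tuple AC tA.
have pe := set_perm_eq tC tB CB; have [|a ha] := rep_grows AC tA.
  by rewrite (perm_size pe).
rewrite perm_sym in pe; have [s ->] := perm_eq_permute erefl pe.
by eexists; apply: (repP s ha).
Qed.

(** Either the chain amounts to one permutation or it can be made to start with a strict operation:
    [R_PD] moves permutations behind strict operations, and [R_P] merges them. *)
Lemma rep_first A B a : rep A B a -> is_tuple A -> (size A <= n)%N ->
  (exists2 s : 'S_(size A), B = permute s A & a = gcls (Perm _ s)) \/
  (exists k t b, [/\ (k < size A)%N, (up (size A) t <= n)%N, rep (expand t k A) B b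
     & a = gcls (Strict (size A) k t) * b]).
Proof.
move=> rAB tA An; have Li := tuple_lengths tA.
elim: rAB => [|C c k t AC [[s CE cE]|[k' [t' [b [k'A t'n rb ->]]]]] kC tn|
    C c i s AC [[s' CE ->]|[k' [t' [b [k'A t'n rb ->]]]]] sC].
- by left; exists 1; rewrite ?permute1 ?gcls_perm1.
- right; have sC : size C = size A by rewrite CE size_permute.
  rewrite sC in kC tn *; pose k0 : 'I_(size A) := s^-1 (Ordinal kC).
  have kE : k = s k0 by rewrite permKV.
  have [tA1 sA1] := tuple_expand t tA (ltn_ord k0).
  have tC := tuple_permute s tA erefl.
  have kC' : (s k0 < size (permute s A))%N by rewrite size_permute.
  have [tC1 _] := tuple_expand t tC kC'.
  have [s' s'E] : exists s' : 'S_(up (size A) t),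
      expand t (s k0) (permute s A) = permute s' (expand t k0 A).
    apply: perm_eq_permute => //; apply: set_perm_eq => //.
    rewrite !set_expand_nth ?tuple_uniq // nth_permute // permK.
    congr expand_at; apply/seteqP; split=> v;
      by rewrite /= (perm_mem (permute_perm_eq s erefl)).
  exists k0, t, (gcls (Perm _ s')); split=> //.
    rewrite CE kE s'E -[X in rep _ _ X]mul1g; apply: repP sA1; exact: rep0.
  by rewrite cE kE (gcls_perm_strict tA erefl tn s'E).
- right; exists k', t', (b * gcls (Strict (size C) k t)); split=> //; last by rewrite mulgA.
  exact: repS.
- have iA : i = size A by rewrite -sC CE size_permute.
  move: s sC; rewrite iA => s sC; left; exists (s' * s); first by rewrite permuteM // CE.
  by rewrite gcls_permM.
- right; exists k', t', (b * gcls (Perm i s)); split=> //; last by rewrite mulgA.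
  exact: repP.
Qed.

Lemma join_disjoint (A B D : seq U) a a' t t' : is_tuple A -> is_tuple D ->
  a \in A -> a' \in A -> a <> a' ->
  expands (expand_at [set` A] a t) [set` B] -> expands (expand_at [set` A] a' t') [set` B] ->
  [set` D] = expand_at (expand_at [set` A] a t) a' t' -> expands [set` D] [set` B].
Proof.
move=> tA tD aA a'A aa' /expands_forest[F BF] /expands_forest[F' BF'] DE.
have [G ->] := expand_join_disjoint (tuple_ind tA) aA a'A aa' BF BF'.
by rewrite -DE; apply: forest_expands; [exact: tuple_uniq|exact: tuple_ind].
Qed.

(** Minimality of [L] is used twice: [L] lies below the double expansion [D], so that multidegrees
    can be compared and [L] is above [D]; and [L] lies below [B]. *)
Lemma join_same (A A1 A2 B D : seq U) a t t' :
  is_tuple A -> is_tuple A1 -> is_tuple A2 -> is_tuple B -> is_tuple D ->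
  a \in A -> t <> t' ->
  [set` A1] = expand_at [set` A] a t -> [set` A2] = expand_at [set` A] a t' ->
  [set` D] = expand_twice [set` A] a t t' ->
  expands [set` A1] [set` D] -> expands [set` A2] [set` D] ->
  expands [set` A1] [set` B] -> expands [set` A2] [set` B] ->
  expands [set` D] [set` B].
Proof.
move=> tA tA1 tA2 tB tD aA tt' A1E A2E DE A1D A2D A1B A2B.
have adm C : is_tuple C -> admissible x [set` C].
  by apply: (tuple_admissible (X_tuple lengths_r).1); case: lift.
have step C t0 : [set` C] = expand_at [set` A] a t0 -> expands [set` A] [set` C].
  by move=> ->; apply: rt_step; exists a, t0.
have [|L [[admL A1L A2L Lmin] _]] := bdd (adm _ tA1) (adm _ tA2).
  by exists [set` A]; split; [exact: adm|exact: step A1E|exact: step A2E].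
have LD := Lmin _ (adm _ tD) A1D A2D; have LB := Lmin _ (adm _ tB) A1B A2B.
apply: rt_trans LB; move: A1L A2L LD; rewrite A1E A2E.
move=> /expands_forest[F LF] /expands_forest[F' LF'] /expands_forest[F'' DF].
rewrite DE in DF; have [G ->] := expand_join_same (tuple_ind tA) aA tt' LF LF' DF.
by rewrite -DE; apply: forest_expands; [exact: tuple_uniq|exact: tuple_ind].
Qed.

Lemma grows_cons (A B : seq U) k t : (k < size A)%N -> grows (expand t k A) B -> grows A B.
Proof.
move=> kA; elim=> [|C k' t' _ IH kC]; last exact: growsS.
by apply: growsS => //; exact: grows0.
Qed.

Lemma chain_grows (A : seq U) c : is_tuple A -> valid_chain (size A) c ->
  grows A (chain_apply c A).
Proof.
elim: c A => [|[k t] c IH] A tA /=; first by move=> _; exact: grows0.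
move=> /andP[kA vc]; have [tA1 sA1] := tuple_expand t tA kA.
by apply: grows_cons kA _; apply: IH => //; rewrite sA1.
Qed.

Lemma grows_expands (A B : seq U) : grows A B -> is_tuple A -> expands [set` A] [set` B].
Proof.
elim=> [|C k t AC IH kC] tA; first exact: rt_refl.
apply: rt_trans (IH tA) _; apply: rt_step; exists (nth u0 C k), t.
split; first by rewrite /= mem_nth.
exact: set_expand_nth (tuple_uniq (grows_tuple AC tA)) kC.
Qed.

Lemma chain_gens_W i c : lengths S r i -> valid_chain i c -> (chain_len i c <= n)%N ->
  forall g, List.In g (chain_gens i c) -> W g.
Proof.
elim: c i => [|[k t] c IH] i //= Li /andP[ki vc] cn g [<-|].
  by apply: W_strict => //; apply: leq_trans cn; exact: chain_len_ge.
by apply: IH => //; exact: lengths_up.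
Qed.

Lemma rep_chain (A : seq U) c : is_tuple A -> valid_chain (size A) c ->
  (chain_len (size A) c <= n)%N ->
  rep A (chain_apply c A) (cls W Rel (pos (chain_gens (size A) c))).
Proof.
elim: c A => [|[k t] c IH] A tA; first by move=> _ _; exact: rep0.
move=> /andP[kA vc] cn; have [tA1 sA1] := tuple_expand t tA kA.
rewrite /= in cn *; rewrite cls_cons; apply: rep_trans (_ : rep _ (expand t k A) _) _.
  rewrite -[gcls _]mul1g; apply: repS => //; first exact: rep0.
  by apply: leq_trans cn; exact: chain_len_ge.
by rewrite -sA1 in vc cn *; exact: IH.
Qed.

Lemma map_chain_apply (g : algebra_aut U) c (A : seq U) :
  map g (chain_apply c A) = chain_apply c (map g A).
Proof.
by elim: c A => [//|[k t] c IH] A; rewrite /= IH (hom_map_expand _ _ _ (aut_hom g)).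
Qed.

Lemma In_rcons (T : Type) (w : seq T) g h : List.In g (rcons w h) -> List.In g w \/ g = h.
Proof.
elim: w => [[->|[]]|k w IH [->|/IH[]]]; [by right|by left; left|by left; right|by right].
Qed.

Lemma cls_law (A : seq U) i k (t t' : colour) (L : law (@arity S) t t') c c'
    (s : 'S_(chain_len i c')) :
  is_tuple A -> size A = i -> (k < i)%N -> (t < t')%N -> sigma2 t t' = Some L ->
  law_chain (law_f L) k c -> law_chain (law_f' L) k c' ->
  valid_chain i c -> valid_chain i c' ->
  (chain_len i c <= n)%N -> (chain_len i c' <= n)%N ->
  chain_apply c A = permute s (chain_apply c' A) ->
  cls W Rel (pos (chain_gens i c)) =
  cls W Rel (pos (chain_gens i c')) * gcls (Perm _ s).
Proof.
move=> tA sA ki tt' sL lc lc' vc vc' cn cn'; have Li := tuple_lengths tA.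
have [g gA] := X_aut tA; rewrite sA in Li gA.
rewrite -gA -!map_chain_apply permute_map => /(inj_map (@aut_inj g)) eqX.
rewrite -cls_cat; have -> : pos (chain_gens i c') ++ [:: (Perm _ s, false)] =
    pos (rcons (chain_gens i c') (Perm _ s)) by rewrite /pos map_rcons cats1.
apply: cls_relator; first by left; left; right; exact: (In_R_Sigma Li ki tt' sL lc lc' eqX).
  exact: chain_gens_W.
move=> h hin; have [hin'|->] := In_rcons hin; first by apply: chain_gens_W hin'.
apply: W_perm => //; rewrite -sA.
have [tC <-] : is_tuple (chain_apply c' A) /\
    size (chain_apply c' A) = chain_len (size A) c' by apply: chain_tuple; rewrite ?sA.
exact: tuple_lengths.
Qed.

Lemma permute_inj (A : seq U) i (s s' : 'S_i) : uniq A -> size A = i ->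
  permute s A = permute s' A -> s = s'.
Proof.
move=> uA sA sE; apply: invg_inj; apply/permP => k; apply: val_inj.
have := congr1 (fun B => nth u0 B k) sE; rewrite !nth_permute // => /eqP.
by rewrite nth_uniq ?sA // => /eqP.
Qed.

Lemma expand_disjoint (A : seq U) k k' t t' : (k < k')%N -> (k' < size A)%N ->
  expand t' (up k' t) (expand t k A) = expand t k (expand t' k' A) /\
  nth u0 (expand t k A) (up k' t) = nth u0 A k'.
Proof.
move=> kk' k'A; have [p [a [B [AE pk]]]] := split_nth (ltn_trans kk' k'A).
have [|m [a' [q [BE mk]]]] := @split_nth B (k' - k.+1).
  by move: kk' k'A; rewrite AE size_cat /= pk; clear; lia.
pose ch := [seq alp t j a | j <- enum 'I_(arity t)].
have k'E : k' = size (p ++ a :: m) by rewrite size_cat /= mk pk; move: kk'; clear; lia.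
have A1E : expand t k A = (p ++ ch ++ m) ++ a' :: q.
  by rewrite AE -pk expand_cat BE -!catA.
have A2E : expand t' k' A = p ++ a :: m ++ [seq alp t' j a' | j <- enum 'I_(arity t')] ++ q.
  by rewrite AE BE -[a :: m ++ _]cat_cons catA k'E expand_cat -catA.
have s1 : size (p ++ ch ++ m) = up k' t.
  rewrite k'E !size_cat size_map size_enum_ord up_add /=.
  by have := arity_gt1 t; move: (arity t) (size p) (size m); clear; lia.
rewrite A1E A2E -pk -s1 !expand_cat -!catA; split=> //.
rewrite !catA nth_cat ltnn subnn AE BE -[a :: m ++ _]cat_cons catA k'E.
by rewrite nth_cat ltnn subnn.
Qed.

Lemma rep_coherent (A B : seq U) a b : is_tuple A -> (size B <= n)%N ->
  rep A B a -> rep A B b -> a = b.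
Proof.
have [m] := ubnP (size B - size A); elim: m A a b => // m IH A a b sm tA Bn ra rb.
have [tB AB] := rep_tuple ra tA; have An := leq_trans AB Bn.
have Li := tuple_lengths tA.
have smaller (A1 : seq U) (t : colour) : is_tuple A1 -> size A1 = up (size A) t ->
    (size A1 <= size B)%N -> (size B - size A1 < m)%N.
  move=> tA1 -> le; have := up_gt (size A) t; move: sm le.
  by move: (up (size A) t) (size A) (size B); clear; lia.
(* The relators are oriented, so two different first steps are compared in one order only; the other
   order follows by symmetry. *)
have key k t c1 k' t' d1 :
    [/\ (k < size A)%N, (up (size A) t <= n)%N & rep (expand t k A) B c1] ->
    [/\ (k' < size A)%N, (up (size A) t' <= n)%N & rep (expand t' k' A) B d1] ->
    (k < k')%N \/ k = k' /\ (t < t')%N ->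
    gcls (Strict (size A) k t) * c1 = gcls (Strict (size A) k' t') * d1.
  move=> [kA tn r1] [k'A t'n r2].
  have [tA1 sA1] := tuple_expand t tA kA; have [tA2 sA2] := tuple_expand t' tA k'A.
  have [_ A1B] := rep_tuple r1 tA1; have [_ A2B] := rep_tuple r2 tA2.
  have e1 := rep_expands r1 tA1; have e2 := rep_expands r2 tA2.
  have E1 := set_expand_nth t (tuple_uniq tA) kA.
  have E2 := set_expand_nth t' (tuple_uniq tA) k'A.
  have m1 := smaller _ _ tA1 sA1 A1B; have m2 := smaller _ _ tA2 sA2 A2B.
  case=> [kk'|[kk' tt']].
    have k'1 : (up k' t < size (expand t k A))%N by rewrite sA1 !up_add ltn_add2r.
    have k2 : (k < size (expand t' k' A))%N by rewrite sA2; exact: ltn_trans kA (up_gt _ _).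
    pose D := expand t' (up k' t) (expand t k A).
    have [tD sD] := tuple_expand t' tA1 k'1.
    have [D2 nD] := expand_disjoint t t' kk' k'A.
    have DB : expands [set` D] [set` B].
      rewrite E1 in e1; rewrite E2 in e2; apply: (join_disjoint tA tD _ _ _ e1 e2).
      - exact: mem_nth.
      - exact: mem_nth.
      - move=> /eqP; rewrite nth_uniq ?tuple_uniq // => /eqP kE.
        by rewrite kE ltnn in kk'.
      - by rewrite set_expand_nth ?tuple_uniq // nD E1.
    have [d rd] := rep_exists tD tB DB Bn.
    (* As [D] expands to [B], it has at most [n] entries: the relator closing the diamond survives
       the truncation. *)
    have [_ Dn] := rep_tuple rd tD; have {}Dn := leq_trans Dn Bn; rewrite sD sA1 in Dn.
    have -> : c1 = gcls (Strict (up (size A) t) (up k' t) t') * d.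
      apply: (IH _ _ _ m1 tA1 Bn r1); apply: rep_trans rd.
      rewrite -[gcls _]mul1g -sA1; apply: repS => //; first exact: rep0.
      by rewrite sA1.
    have -> : d1 = gcls (Strict (up (size A) t') k t) * d.
      rewrite D2 in rd; apply: (IH _ _ _ m2 tA2 Bn r2); apply: rep_trans rd.
      rewrite -[gcls _]mul1g -sA2; apply: repS => //; first exact: rep0.
      by rewrite sA2; move: Dn; rewrite !up_add addnAC.
    by rewrite !mulgA gcls_disjoint.
  (* Two colours at one entry: the chains on the two sides of the law reach the same set, hence
     tuples that differ by a permutation [s]. *)
  subst k'; have [L [sL fE f'E]] := cplS tt'.
  have [v [c [vE lc vc cE]]] := law_chain_exists (law_f L) tA kA.
  have [v' [c' [v'E lc' vc' c'E]]] := law_chain_exists (law_f' L) tA kA.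
  rewrite v'E -vE -(replace_law_eq _ _ tt' sL) in c'E.
  rewrite -sA1 in vc; rewrite -sA2 in vc'.
  have [tC sC] := chain_tuple tA1 vc; have [tC' sC'] := chain_tuple tA2 vc'.
  have CC' := set_perm_eq tC tC' (etrans cE (esym c'E)).
  have A1C := grows_expands (chain_grows tA1 vc) tA1.
  have A2C := grows_expands (chain_grows tA2 vc') tA2.
  have CB : expands [set` chain_apply c (expand t k A)] [set` B].
    apply: (join_same tA tA1 tA2 tB tC (a := v) (t := t) (t' := t')) => //.
    - by rewrite vE mem_nth.
    - by move=> ttE; rewrite ttE ltnn in tt'.
    - by rewrite E1 vE.
    - by rewrite E2 vE.
    - by rewrite cE (replace_law_twice _ _ fE).
    - by rewrite cE -c'E.
  have [d rd] := rep_exists tC tB CB Bn.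
  have [_ Cn] := rep_tuple rd tC; have {}Cn := leq_trans Cn Bn.
  have Cn' := Cn; rewrite (perm_size CC') sC' in Cn'.
  have cn := Cn; rewrite sC in cn.
  have sC2 : size (chain_apply c' (expand t' k A)) = chain_len (up (size A) t') c'.
    by rewrite sC' sA2.
  have [s CE] := perm_eq_permute sC2 CC'.
  have -> : c1 = cls W Rel (pos (chain_gens (up (size A) t) c)) * d.
    apply: (IH _ _ _ m1 tA1 Bn r1); apply: rep_trans rd.
    by rewrite -sA1; exact: rep_chain.
  have -> : d1 = cls W Rel (pos (chain_gens (up (size A) t') c')) * gcls (Perm _ s) * d.
    apply: (IH _ _ _ m2 tA2 Bn r2); apply: rep_trans rd.
    rewrite CE; apply: repP => //; rewrite -sA2; exact: rep_chain.
  rewrite !mulgA -!cls_cons.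
  congr (_ * _); apply: (@cls_law A (size A) k t t' L ((k, t) :: c) ((k, t') :: c') s) => //=.
  - by rewrite kA -sA1.
  - by rewrite kA -sA2.
  - by rewrite -sA1.
  - by rewrite -sA2.
have [[s BE ->]|[k [t [c1 [kA tn r1 ->]]]]] := rep_first ra tA An;
  have [[s' BE' ->]|[k' [t' [d1 [k'A t'n r2 ->]]]]] := rep_first rb tA An.
- by congr (gcls (Perm _ _)); apply: (permute_inj (tuple_uniq tA) erefl); rewrite -BE.
- have [tA2 sA2] := tuple_expand t' tA k'A; have [_] := rep_tuple r2 tA2.
  by rewrite sA2 BE size_permute // leqNgt up_gt.
- have [tA1 sA1] := tuple_expand t tA kA; have [_] := rep_tuple r1 tA1.
  by rewrite sA1 BE' size_permute // leqNgt up_gt.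
- have [lt|lt|kk'] := ltngtP k k'.
  + by apply: key => //; left.
  + by symmetry; apply: key => //; left.
  + subst k'; have [lt|lt|/val_inj tt'] := ltngtP t t'.
    * by apply: key => //; right.
    * by symmetry; apply: key => //; right.
    * subst t'; congr mulg.
      have [tA1 sA1] := tuple_expand t tA kA.
      apply: (IH _ _ _ _ tA1 Bn r1 r2); apply: (smaller _ _ tA1 sA1).
      by case: (rep_tuple r1 tA1).
Qed.

(** * The cocycle on Z^n *)

Lemma coloured_expands (A B : set U) c : coloured_expansion A B c -> expands A B.
Proof.
elim=> [_ _|C d b i d' _ IH Cb _ _]; first exact: rt_refl.
by apply: rt_trans IH _; apply: rt_step; exists b, i.
Qed.

Definition small (A : seq U) : Prop := is_tuple A /\ (size A <= n)%N.

Lemma precedes_rep (A B : seq U) : small A -> small B -> precedes A B ->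
  exists a, rep A B a.
Proof.
move=> [tA _] [tB Bn] [c [/coloured_expands AB _]]; exact: rep_exists.
Qed.

Lemma precedes_refl (A B : seq U) : [set` A] = [set` B] -> precedes A B.
Proof. by rewrite /precedes => ->; exists (fun=> [::]); split=> //; constructor. Qed.

Lemma precedes_expand (A : seq U) k t : is_tuple A -> (k < size A)%N ->
  precedes A (expand t k A).
Proof.
move=> tA kA; rewrite /precedes set_expand_nth ?tuple_uniq //; set b := nth _ _ _.
have Ab : [set` A] b by rewrite /= mem_nth.
pose c' u := if `[< exists j : 'I_(arity t), alp t j b = u >] then [:: t] else [::].
exists c'; split; last by move=> u _; rewrite /c'; case: ifP.
apply: (@CE_step _ _ _ [set` A] (fun=> [::])) => //; first by constructor.
  by move=> j; rewrite /c' asboolT //; exists j.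
move=> u Au ub; rewrite /c' asboolF // => -[j jb]; apply: ub; symmetry.
exact: (@independent_act _ b u [:: existT _ t j] [::] (tuple_ind tA)).
Qed.

Local Notation K := (truncated_Z U n).

Lemma simplex_small c A : simplex K c -> A \in c -> small A.
Proof. by move=> Kc Ac; have [_ /allP/(_ _ Ac)/asboolP] := Kc. Qed.

Lemma edge_adjacent (A B : seq U) : small A -> small B -> precedes A B -> adjacent K A B.
Proof.
move=> sA sB AB; exists [:: A; B]; last by rewrite !inE !eqxx orbT.
by split=> //=; rewrite ?andbT; [apply/andP; split|]; apply/asboolP.
Qed.

Lemma simplex_rep c A B : simplex K c -> A \in c -> B \in c ->
  (exists a, rep A B a) \/ (exists a, rep B A a).
Proof.
move=> Kc Ac Bc; have sA := simplex_small Kc Ac; have sB := simplex_small Kc Bc.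
have [_ _] := Kc; elim: c {Kc} Ac Bc => [//|C c IH]; rewrite !in_cons pairwise_cons.
move=> + + /andP[/allP h1 h2].
case/orP => [/eqP AC|Ac]; case/orP => [/eqP BC|Bc].
- by left; exists 1; rewrite AC BC; exact: rep0.
- by left; apply: precedes_rep => //; rewrite AC; exact/asboolP/h1.
- by right; apply: precedes_rep => //; rewrite BC; exact/asboolP/h1.
- exact: IH.
Qed.

(* The two branches agree when both apply, by coherence. *)
Definition edge_class (A B : seq U) : Gam :=
  if pselect (exists a, rep A B a) then xget 1 (rep A B)
  else (xget 1 (rep B A))^-1.

Lemma edge_classE A B a : small A -> small B -> rep A B a -> edge_class A B = a.
Proof.
move=> [tA _] [_ Bn] AB; rewrite /edge_class; case: pselect => [h|]; last by case; exists a.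
by apply: (rep_coherent tA Bn _ AB); exact: (xgetPex 1 (ex_intro (rep A B) a AB)).
Qed.

Lemma edge_classV A B a : small A -> small B -> rep A B a -> edge_class B A = a^-1.
Proof.
move=> [tA An] [tB Bn] AB; rewrite /edge_class; case: pselect => /= [BA|_].
  (* If each tuple leads to the other, going there and back is a chain from [A] to itself, of class
     1 by coherence. *)
  have [b {}BA] := BA; have h := xgetPex 1 (ex_intro (rep B A) b BA); apply: (mulgI a); rewrite mulgV.
  by apply: (rep_coherent tA An (rep_trans AB h)); exact: rep0.
congr (_^-1); apply: (rep_coherent tA Bn _ AB).
exact: (xgetPex 1 (ex_intro (rep A B) a AB)).
Qed.

(** The three vertices come in any order; inverting suitable factors reduces each case to [key],
    where two chains compose. *)
Lemma edge_class_cocycle c A B C : simplex K c -> A \in c -> B \in c -> C \in c ->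
  edge_class A B * edge_class B C = edge_class A C.
Proof.
move=> Kc Ac Bc Cc; have sA := simplex_small Kc Ac; have sB := simplex_small Kc Bc.
have sC := simplex_small Kc Cc.
have key D F H a b : small D -> small F -> small H -> rep D F a -> rep F H b ->
    edge_class D F * edge_class F H = edge_class D H.
  move=> sD sF sH DF FH; rewrite (edge_classE sD sF DF) (edge_classE sF sH FH).
  by rewrite (edge_classE sD sH (rep_trans DF FH)).
have inv D F : small D -> small F -> (exists a, rep D F a) \/ (exists a, rep F D a) ->
    edge_class D F = (edge_class F D)^-1.
  move=> sD sF [[a h]|[a h]].
    by rewrite (edge_classE sD sF h) (edge_classV sD sF h) invgK.
  by rewrite (edge_classE sF sD h) (edge_classV sF sD h).
have AB := simplex_rep Kc Ac Bc; have BC := simplex_rep Kc Bc Cc.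
have AC := simplex_rep Kc Ac Cc.
have iAB := inv _ _ sA sB AB; have iBC := inv _ _ sB sC BC; have iAC := inv _ _ sA sC AC.
case: AB => [[a rAB]|[a rBA]]; case: BC => [[b rBC]|[b rCB]].
- exact: key rAB rBC.
- case: AC => [[d rAC]|[d rCA]].
    by rewrite -(key _ _ _ _ _ sA sC sB rAC rCB) iBC mulgK.
  by rewrite iBC -(key _ _ _ _ _ sC sA sB rCA rAB) iAC invgM mulKVg.
- case: AC => [[d rAC]|[d rCA]].
    by rewrite -(key _ _ _ _ _ sB sA sC rBA rAC) iAB mulKg.
  by rewrite iAB -(key _ _ _ _ _ sB sC sA rBC rCA) iAC invgM mulgKV.
- by rewrite iAC -(key _ _ _ _ _ sC sB sA rCB rBA) invgM iAB iBC.
Qed.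

(** * Evaluation of words and the truncated presentation *)

Section Presentation.
Variable R : realType.
Hypotheses (sc : simply_connected R (realization R K)) (treeE : truncated_tree r n E).
Local Notation ev := (gen_eval X : gen S -> algebra_aut U).

Lemma small_exists : exists A, small A.
Proof.
have [[p _] _ _] := sc; have [A Ap] := supp_neq0 p.
by exists A; exact: simplex_small (rpoint_simplex p) Ap.
Qed.

(** Connectedness of Z^n in the form of an induction principle. *)
Lemma small_connected (P : seq U -> Prop) A :
  (forall B C a, small B -> small C -> rep B C a -> P B <-> P C) ->
  small A -> P A -> forall B, small B -> P B.
Proof.
move=> hP sA PA B sB.
have adj C : small C -> adjacent K C C by move=> sC; apply: edge_adjacent => //; exact: precedes_refl.
elim/clos_refl_trans_ind_left: (simply_connected_adjacent sc (adj A sA) (adj B sB)) => //.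
move=> C D _ PC [c Kc [Cc Dc]].
have sC := simplex_small Kc Cc; have sD := simplex_small Kc Dc.
have [[a CD]|[a DC]] := simplex_rep Kc Cc Dc; first by apply/(hP C D a).
by apply/(hP D C a).
Qed.

Lemma small_X i : lengths S r i -> (i <= n)%N -> small (X i).
Proof. by move=> Li iN; have [tX sX] := X_tuple Li; split; rewrite ?sX. Qed.

Lemma small_map (g : algebra_aut U) A : small A -> small (map g A).
Proof. by move=> [tA An]; split; [exact: tuple_map_aut|rewrite size_map]. Qed.

(** The coboundary relation passes from edges to whole chains, whose ends need not be adjacent in
    Z^n. *)
Lemma potential : exists h : seq U -> Gam, forall A B a, small A -> (size B <= n)%N ->
  rep A B a -> h B = h A * a.
Proof.
have [h hE] := simply_connected_coboundary sc edge_class_cocycle; exists h.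
move=> A B a [tA An] Bn rAB; elim: rAB Bn => [|C c k t AC IH kC tn _|C c i s AC IH sC sn].
- by rewrite mulg1.
- have [tC _] := rep_tuple AC tA; have Cn : (size C <= n)%N := leq_trans (ltnW (up_gt _ _)) tn.
  have [tD sD] := tuple_expand t tC kC.
  have sm : small (expand t k C) by split; rewrite ?sD.
  rewrite (hE C); last by apply: edge_adjacent => //; exact: precedes_expand.
  by rewrite IH // -mulgA -[gcls _]mul1g (edge_classE (a := 1 * gcls (Strict (size C) k t))) //;
    apply: repS => //; exact: rep0.
- have [tC _] := rep_tuple AC tA; rewrite size_permute // in sn.
  have Cn : (size C <= n)%N by rewrite sC.
  have sm : small (permute s C) by split; [exact: tuple_permute|rewrite size_permute].
  rewrite (hE C); last first.
    apply: edge_adjacent => //; apply: precedes_refl; apply/seteqP; split=> v;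
      by rewrite /= (perm_mem (permute_perm_eq s sC)).
  by rewrite IH // -mulgA -[gcls _]mul1g (edge_classE (a := 1 * gcls (Perm i s))) //;
    apply: repP => //; exact: rep0.
Qed.

Lemma map_mulg (g h : algebra_aut U) (A : seq U) : map (g * h) A = map g (map h A).
Proof. by rewrite -map_comp. Qed.

Lemma eval_strict i k (t : colour) : lengths S r i -> (k < i)%N ->
  map (ev (Strict i k t)) (X (up i t)) = expand t k (X i).
Proof.
move=> Li ki; have [tX sX] := X_tuple Li; have [tY sY] := X_tuple (lengths_up t Li).
have kX : (k < size (X i))%N by rewrite sX.
have [tE sE] := tuple_expand t tX kX.
by apply: map_tuple_aut => //; rewrite sY sE sX.
Qed.

Lemma eval_perm i (s : 'S_i) : lengths S r i -> map (ev (Perm i s)) (X i) = permute s (X i).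
Proof.
move=> Li; have [tX sX] := X_tuple Li; apply: map_tuple_aut => //.
  exact: tuple_permute.
by rewrite size_permute.
Qed.

Lemma gcls_tree i t : E (i, t) -> lengths S r i -> (up i t <= n)%N ->
  gcls (Strict i i.-1 t) = 1.
Proof.
move=> Eit Li tn; apply: (@cls_relator [:: _] [::]).
- by left; left; left; left; constructor.
- move=> g [<-|[]]; apply: W_strict => //.
  by case: Li => i0 _; rewrite prednK.
- by [].
Qed.

Lemma class_hom : exists Psi : algebra_aut U -> Gam,
  (forall g h, Psi (g * h) = Psi g * Psi h) /\ (forall g, W g -> Psi (ev g) = gcls g).
Proof.
have [h hE] := potential; have [A0' sA0] := small_exists.
have [tA0 A0n] := sA0; have Lm := tuple_lengths tA0; set m := size A0' in A0n Lm.
have sm := small_X Lm A0n.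
(* Moving by [g] does not change the class of a chain, so the quotient of h(g A) by h(A) is constant
   on the connected complex. *)
have hmap (g : algebra_aut U) A : small A -> h (map g A) = h (map g (X m)) * (h (X m))^-1 * h A.
  move: A; apply: (small_connected _ sm) => [B C a sB sC BC|]; last by rewrite mulgKV.
  have -> := hE _ _ _ sB sC.2 BC.
  have -> := hE _ _ _ (small_map g sB) (small_map g sC).2 (rep_map g BC).
  by rewrite mulgA; split=> [->//|/mulIg].
(* The truncated tree joins [i] to [m] without exceeding [n], and its edges have class 1 by
   [R_T]. *)
have hX i : lengths S r i -> (i <= n)%N -> h (X i) = h (X m).
  move=> Li iN; have [VE tree] := treeE.
  have [p [[wp _] _]] := tree i m (conj Li iN) (conj Lm A0n).
  apply: (walk_constant (chi := fun j => h (X j)) _ wp) => -[j t] _ [Ejt /= tn].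
  have [[Lj jn] _] := VE (j, t) (conj Ejt tn); have [_ _ lE] := lift.
  have [tX sX] := X_tuple Lj; have j0 : (0 < j)%N by case: Lj.
  rewrite /top (lE _ Ejt) /= (hE (X j) (expand t j.-1 (X j)) (1 * gcls (Strict (size (X j)) j.-1 t))).
  - by rewrite mul1g sX (gcls_tree Ejt Lj tn) mulg1.
  - exact: small_X.
  - by have [|_ ->] := @tuple_expand (X j) t j.-1 tX; rewrite sX /= ?prednK.
  - by apply: repS; [exact: rep0|rewrite sX prednK|rewrite sX].
exists (fun g => (h (X m))^-1 * h (map g (X m))); split=> [g g'|].
  by rewrite map_mulg (hmap g) ?mulgA //; exact: small_map.
case=> [i k t|i s] [Lg gn].
  have [Li ki] := Lg; have iN : (i <= n)%N := leq_trans (ltnW (up_gt i t)) gn.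
  have [tX sX] := X_tuple Li; have kX : (k < size (X i))%N by rewrite sX.
  have := hmap (ev (Strict i k t)) _ (small_X (lengths_up t Li) gn).
  rewrite eval_strict // (hX (up i t)) ?mulgKV //; last exact: lengths_up.
  move=> <-; rewrite (hE (X i) (expand t k (X i)) (1 * gcls (Strict (size (X i)) k t))).
  - by rewrite mul1g sX hX // mulKg.
  - exact: small_X.
  - by have [_ ->] := tuple_expand t tX kX; rewrite sX.
  - by apply: repS; [exact: rep0|exact: kX|rewrite sX].
have Li : lengths S r i by []; have [tX sX] := X_tuple Li.
have := hmap (ev (Perm i s)) _ (small_X Li gn).
rewrite eval_perm // (hX i) // mulgKV.
move=> <-; rewrite (hE (X i) (permute s (X i)) (1 * gcls (Perm i s))).
- by rewrite mul1g hX // mulKg.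
- exact: small_X.
- by rewrite size_permute.
- by apply: repP => //; exact: rep0.
Qed.

Lemma word_eval_inv (G : groupType) (f : gen S -> G) (w : word (gen S)) :
  word_eval f (word_inv w) = (word_eval f w)^-1.
Proof.
elim: w => [|[g b] w IH]; first by rewrite /word_eval big_nil invg1.
have -> : word_inv ((g, b) :: w) = word_inv w ++ [:: (g, ~~ b)].
  by rewrite /word_inv /= rev_cons cats1.
rewrite -[(g, b) :: w]cat1s !word_eval_cat IH invgM.
by congr (_ * _); rewrite /word_eval !big_seq1 /=; case: b; rewrite /= ?invgK.
Qed.

Lemma word_eval1 (G : groupType) (f : gen S -> G) g : word_eval f (pos [:: g]) = f g.
Proof. by rewrite /word_eval big_seq1. Qed.

(** Operations commute with automorphisms, so a further operation multiplies on the right by its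
    generator: this is why a chain is read as a product in the same order. *)
Lemma rep_word A B a (g : algebra_aut U) : rep A B a -> is_tuple A -> (size B <= n)%N ->
  A = map g (X (size A)) ->
  exists2 w, word_over W w & B = map (g * word_eval ev w) (X (size B)).
Proof.
move=> rAB tA + AE; elim: rAB => [_|C c k t AC IH kC tn _|C c i s AC IH sC sn].
- by exists [::] => //; rewrite /word_eval big_nil mulg1.
- have [tC _] := rep_tuple AC tA; have LC := tuple_lengths tC.
  have [|w ow CE] := IH; first exact: leq_trans (ltnW (up_gt _ _)) tn.
  have [_ sD] := tuple_expand t tC kC.
  exists (w ++ pos [:: Strict (size C) k t]).
    rewrite /word_over all_cat; apply/andP; split => //.
    by apply: word_over_pos => _ [<-|[]]; exact: W_strict.
  rewrite sD word_eval_cat mulgA map_mulg word_eval1 eval_strict //.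
  by rewrite (hom_map_expand _ _ _ (aut_hom _)) -CE.
- have [tC _] := rep_tuple AC tA; have LC := tuple_lengths tC.
  rewrite size_permute // in sn *; have [|w ow CE] := IH; first by rewrite sC.
  rewrite sC in LC CE; exists (w ++ pos [:: Perm i s]).
    rewrite /word_over all_cat; apply/andP; split => //.
    by apply: word_over_pos => _ [<-|[]]; exact: W_perm.
  rewrite word_eval_cat mulgA map_mulg word_eval1 eval_perm //.
  by rewrite -permute_map -CE.
Qed.

Lemma word_over_cat (w w' : word (gen S)) : word_over W w -> word_over W w' ->
  word_over W (w ++ w').
Proof. by rewrite /word_over all_cat => -> ->. Qed.

Lemma word_over_inv (w : word (gen S)) : word_over W w -> word_over W (word_inv w).
Proof. by rewrite /word_over /word_inv all_rev all_map. Qed.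

Lemma eval_surj (g : algebra_aut U) : exists2 w, word_over W w & word_eval ev w = g.
Proof.
have [A [tA An]] := small_exists; have Lm := tuple_lengths tA; set m := size A in An Lm.
have sm := small_X Lm An; have [tX sX] := X_tuple Lm.
(* The property carried through Z^n is that some truncated word takes the chosen tuple of the right
   length to the given one. *)
have [w ow wE] : exists2 w, word_over W w &
    map g (X m) = map (word_eval ev w) (X (size (map g (X m)))).
  move: (map g (X m)) (small_map g sm); apply: (small_connected _ sm); last first.
    exists [::] => //; rewrite sX /word_eval big_nil.
    by rewrite -[LHS]map_id.
  move=> B C a [tB Bn] [tC Cn] BC; split=> -[w ow BE].
    have [w' ow' CE] := rep_word BC tB Cn BE.
    exists (w ++ w'); first exact: word_over_cat.
    by rewrite word_eval_cat.
  have [g' g'B] := X_aut tB; have [w' ow' CE] := rep_word BC tB Cn (esym g'B).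
  exists (w ++ word_inv w'); first exact/word_over_cat/word_over_inv.
  rewrite word_eval_cat word_eval_inv -[LHS]g'B.
  have [tY _] := X_tuple (tuple_lengths tC).
  have -> : word_eval ev w = g' * word_eval ev w'.
    by apply: (tuple_aut_uniq tY); rewrite -BE.
  by rewrite mulgK.
exists w => //; apply: (tuple_aut_uniq tX).
by rewrite wE size_map sX.
Qed.

Lemma map_aut1 (A : seq U) : map (1 : algebra_aut U) A = A.
Proof. exact: map_id. Qed.

Lemma eval_pos_cons g (w : seq (gen S)) :
  word_eval ev (pos (g :: w)) = ev g * word_eval ev (pos w).
Proof. by rewrite /word_eval big_cons. Qed.

Lemma word_over_pos_cons g (w : seq (gen S)) : word_over W (pos (g :: w)) ->
  W g /\ word_over W (pos w).
Proof. by rewrite /word_over /= => /andP[/asboolP]. Qed.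

Lemma eval_chain i c : lengths S r i -> word_over W (pos (chain_gens i c)) ->
  [/\ map (word_eval ev (pos (chain_gens i c))) (X (chain_len i c)) = chain_apply c (X i),
    lengths S r (chain_len i c) & size (chain_apply c (X i)) = chain_len i c].
Proof.
elim: c i => [|[k t] c IH] i Li.
  by move=> _; rewrite /word_eval big_nil; split=> //; [rewrite -[RHS]map_id|have [] := X_tuple Li].
move=> owc; have [[[_ ki] _] oc] := word_over_pos_cons owc; have Lu := lengths_up t Li.
have [cE Lc sc'] := IH _ Lu oc; have eS := eval_strict t Li ki.
split=> //=; first by rewrite eval_pos_cons map_mulg cE map_chain_apply eS.
by rewrite -eS -map_chain_apply size_map.
Qed.

Lemma relators_hold p : Rel p -> word_eval ev p.1 = word_eval ev p.2.
Proof.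
have uniqX i (g h : algebra_aut U) : lengths S r i -> map g (X i) = map h (X i) -> g = h.
  by move=> Li; apply: tuple_aut_uniq; have [] := X_tuple Li.
case=> -[[[[]|]|]|] h [ow ow']; move: ow ow'; case: h; cbn [fst snd].
- move=> i t Eit o _; have [[[Li ki] tn] _] := word_over_pos_cons o.
  rewrite word_eval1 /word_eval big_nil; apply: (uniqX (up i t)); first exact: lengths_up.
  by rewrite eval_strict // map_aut1; case: lift => _ _ /(_ _ Eit).
- move=> i k1 k2 t t' Li k12 k2i o o'.
  have [E1 L1 _] := @eval_chain i [:: (k1, t); (up k2 t, t')] Li o.
  have [E2 _ _] := @eval_chain i [:: (k2, t'); (k1, t)] Li o'.
  apply: (uniqX _ _ _ L1); rewrite E1.
  have upC : up (up i t) t' = up (up i t') t by rewrite !up_add addnAC.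
  rewrite /chain_len upC; rewrite /chain_len in E2; rewrite E2 /=.
  have [tX sX] := X_tuple Li; rewrite -sX in k2i.
  by have [-> _] := expand_disjoint t t' k12 k2i.
- move=> i k t t' L c c' s Li _ _ _ _ _ cE o o'.
  have [E1 L1 s1] := @eval_chain i c Li o.
  move: o'; rewrite /pos -cats1 map_cat => o'.
  have oc' : word_over W (pos (chain_gens i c')).
    by move: o'; rewrite /word_over all_cat => /andP[].
  have [E2 L2 s2] := @eval_chain i c' Li oc'.
  have lE : chain_len i c = chain_len i c' by rewrite -s1 cE size_permute.
  apply: (uniqX _ _ _ L1); rewrite E1 cE lE.
  rewrite (_ : [seq (g, false) | g <- [:: Perm _ s]] = pos [:: Perm _ s]) //.
  by rewrite word_eval_cat word_eval1 map_mulg eval_perm // -permute_map E2.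
- move=> i s k t s' Li eqX _ _; have Lu := lengths_up t Li.
  apply: (uniqX (up i t)) => //; rewrite !eval_pos_cons !map_mulg.
  rewrite [word_eval _ (pos [::])](_ : _ = 1); last by rewrite /word_eval big_nil.
  rewrite !map_aut1 eval_strict // eval_perm // (hom_map_expand _ _ _ (aut_hom _)) eval_perm //.
  by rewrite -permute_map eval_strict.
- move=> i s1 s2 Li _ _; have [tX sX] := X_tuple Li; apply: (uniqX i) => //.
  rewrite !eval_pos_cons !map_mulg.
  rewrite [word_eval _ (pos [::])](_ : _ = 1); last by rewrite /word_eval big_nil.
  by rewrite !map_aut1 !eval_perm // -permute_map eval_perm // permuteM.
Qed.

Lemma presentation : presents ev W Rel.
Proof.
have [Psi [PsiM PsiE]] := class_hom.
have Psi1 : Psi 1 = 1 by apply: (mulgI (Psi 1)); rewrite -PsiM !mulg1.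
have PsiV g : Psi g^-1 = (Psi g)^-1.
  by apply: (mulgI (Psi g)); rewrite -PsiM !mulgV.
have Psi_word w : word_over W w -> Psi (word_eval ev w) = cls W Rel w.
  elim: w => [_|[g b] w IH]; first by rewrite /word_eval big_nil Psi1.
  move=> /andP[/asboolP Wg ow]; rewrite -[(g, b) :: w]cat1s word_eval_cat PsiM IH // cls_cat.
  congr mulg; rewrite [RHS]cls_word_eval /word_eval !big_seq1.
  by clear -Wg PsiV PsiE; case: b Wg => /= Wg; rewrite ?PsiV PsiE.
split; [exact: Rel_word_over|exact: eval_surj|move=> w w' ow ow'; split=> [eqw|]].
  by apply: (cls_equiv ow ow'); rewrite -!Psi_word // eqw.
by apply: word_eval_equiv => l1 l2 /relators_hold.
Qed.

Lemma finite_W : finite_set W.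
Proof.
pose T := ('I_n.+1 * 'I_n.+1 * colour)%type.
pose f (p : T) : gen S := Strict p.1.1 p.1.2 p.2.
apply: (@sub_finite_set _ _ (f @` setT `|` \bigcup_(i in `I_n.+1) [set Perm i s | s in setT])).
  move=> [i k t|i s] [Lg gn].
    have iN : (i < n.+1)%N by rewrite ltnS; exact: leq_trans (ltnW (up_gt i t)) gn.
    have kN : (k < n.+1)%N by exact: ltn_trans Lg.2 iN.
    by left; exists (Ordinal iN, Ordinal kN, t).
  by right; exists i; [|exists s].
rewrite finite_setU; split; first exact/finite_image/finite_finset.
by apply: bigcup_finite => [|i _]; [exact: finite_II|exact/finite_image/finite_finset].
Qed.

Lemma finite_words (N : nat) : finite_set [set w : word (gen S) | word_over W w /\ (size w <= N)%N].
Proof.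
elim: N => [|N IH].
  apply: (@sub_finite_set _ _ [set [::]]); last exact: finite_set1.
  by move=> [|l w] [_].
pose F := [set w : word (gen S) | word_over W w /\ (size w <= N)%N].
apply: (@sub_finite_set _ _ ([set [::]] `|`
    [set l :: w | l in W `*` [set: bool] & w in F])).
  move=> [|[g b] w] [ow sw]; [by left|right].
  by move: ow => /andP[/asboolP Wg ow]; exists (g, b) => //; exists w.
rewrite finite_setU; split; first exact: finite_set1.
apply: finite_image2 => //; apply: finite_setX; [exact: finite_W|exact: finite_finset].
Qed.

Lemma finite_Rel : finite_set Rel.
Proof.
(* A law chain has one step for the entry and one for each child, and a permutation may follow; the
   other relators have at most two letters on each side. *)
pose N := (\max_(t < colours S) arity t + 3)%N.
pose F := [set w : word (gen S) | word_over W w /\ (size w <= N)%N].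
apply: (@sub_finite_set _ _ (F `*` F)); last by apply: finite_setX; exact: finite_words.
have sch i c : size (chain_gens i c) = size c.
  by elim: c i => [|[k t] c IH] i //=; rewrite IH.
have sl t (f : 'I_(arity t) -> colour) k c : law_chain f k c -> (size c <= N.-2)%N.
  move=> [todo pe ->] /=.
  have -> : size (children_chain f k [::] todo) = arity t.
    rewrite -[RHS](size_enum_ord (arity t)) -(perm_size pe).
    by elim: (todo) [::] => //= j s IH d; rewrite IH.
  by rewrite /N addn3 /= ltnS; exact: leq_bigmax.
have N3 : (2 < N)%N by rewrite /N addn3.
have N2 := ltnW N3; have N1 := ltnW N2.
suff h p : Rel p -> (size p.1 <= N)%N /\ (size p.2 <= N)%N.
  by move=> p Rp; have [h1 h2] := h p Rp; case: Rp => _ [].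
move=> [h _]; case: h => [[[[h|h]|h]|h]|h]; case: h => /=.
- by [].
- by [].
- move=> i k t t' L c c' s _ _ _ _ lc lc' _.
  rewrite /pos !size_map size_rcons !sch; have := sl _ _ _ _ lc; have := sl _ _ _ _ lc'.
  by move: (N) N3 => N0; clear; lia.
- by [].
- by [].
Qed.

Lemma finite_presentation : finitely_presents ev W Rel.
Proof. by split; [exact: finite_W|exact: finite_Rel|exact: presentation]. Qed.

Lemma rep_conn A B a : rep A B a -> is_tuple A -> (size B <= n)%N ->
  conn S r n.+1 (size A) (size B).
Proof.
move=> + tA; elim=> [_|C c k t AC IH kC tn _|C c i s AC IH sC].
- exact: conn_refl.
- have [tC _] := rep_tuple AC tA; have [_ ->] := tuple_expand t tC kC.
  apply: conn_trans (IH _) (conn_edge (e := (size C, t)) _ _) => //.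
    exact: leq_trans (ltnW (up_gt _ _)) tn.
  exact: tuple_lengths.
- by rewrite size_permute // -sC.
Qed.

(** A walk in Z^n from [X u] to [X v] projects to lengths at most [n]; this is what makes Kruskal's
    truncated tree connected. *)
Lemma lengths_small_conn u v : lengths S r u -> lengths S r v -> (u <= n)%N -> (v <= n)%N ->
  conn S r n.+1 u v.
Proof.
move=> Lu Lv un vn; have su := small_X Lu un; have sv := small_X Lv vn.
have := @small_connected (fun A => conn S r n.+1 u (size A)) (X u).
rewrite (X_tuple Lu).2 -[in X in _ -> X](X_tuple Lv).2; apply=> //; last exact: conn_refl.
move=> B C a [tB _] [_ Cn] BC; have h := rep_conn BC tB Cn.
by split=> h'; [exact: conn_trans h' h|exact: conn_trans h' (conn_sym h)].
Qed.

End Presentation.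
End Coherence.

(** * Lifting the tree *)

Definition contract_last (t : colour) (A : seq U) : seq U :=
  let k := (size A - arity t)%N in
  rcons (take k A) (lam t (fun j => nth u0 (drop k A) j)).

Lemma contract_lastP t i (A : seq U) : is_tuple A -> (0 < i)%N -> size A = up i t ->
  [/\ is_tuple (contract_last t A), size (contract_last t A) = i
    & expand t i.-1 (contract_last t A) = A].
Proof.
move=> tA i0 sA; have a1t := arity_gt1 t.
have kE : (size A - arity t = i.-1)%N.
  by rewrite sA /up; move: (arity t) a1t i0; clear; lia.
have kA : (i.-1 <= size A)%N by rewrite -kE leq_subr.
have sd : size (drop i.-1 A) = arity t.
  by rewrite size_drop sA /up; move: (arity t) a1t i0; clear; lia.
pose bs (j : 'I_(arity t)) := nth u0 (drop i.-1 A) j.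
have dE : map bs (enum 'I_(arity t)) = drop i.-1 A.
  apply: (@eq_from_nth _ u0); first by rewrite size_map size_enum_ord sd.
  move=> j; rewrite size_map size_enum_ord => jt.
  by rewrite (nth_map (Ordinal jt)) ?size_enum_ord // /bs nth_enum_ord.
have AE : take i.-1 A ++ map bs (enum 'I_(arity t)) = A by rewrite dE cat_take_drop.
rewrite /contract_last kE -/bs; split.
- by apply: tuple_contract; rewrite AE.
- by rewrite size_rcons size_takel // prednK.
- have sp : size (take i.-1 A) = i.-1 by rewrite size_takel.
  rewrite -{1}sp -cats1 expand_cat cats0 -[RHS]AE; congr cat.
  by apply: eq_map => j; have [_ -> _] := satU.
Qed.

Section Lift.
Variables (r : nat) (x : 'I_r -> U) (E : set (nat * colour)) (X0 : seq U).
Hypotheses (r0 : (0 < r)%N) (tX0 : is_tuple X0) (sX0 : size X0 = r) (xX0 : [set` X0] = range x).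
Hypothesis treeE : is_tree (lengths S r) E.

Definition lift_step (A : seq U) (a : nat * colour * bool) : seq U :=
  if a.2 then expand a.1.2 a.1.1.-1 A else contract_last a.1.2 A.

Lemma follow_tuple u p v A : walk E u p v -> is_tuple A -> size A = u ->
  is_tuple (foldl lift_step A p) /\ size (foldl lift_step A p) = v.
Proof.
elim: p u A => [|[[i t] b] p IH] u A; first by move=> /= ->.
move=> /walk_cons[/= Ee uE w] tA sA; have [VE _] := treeE.
have [[i0 _] _] := VE _ Ee; apply: IH w _ _; rewrite /lift_step /=; case: b uE => uE.
- by have [] := @tuple_expand A t i.-1 tA; rewrite // sA uE /src /= prednK.
- by have [] := contract_lastP tA i0 (etrans sA uE).
- by have [] := @tuple_expand A t i.-1 tA; rewrite sA uE /src /= ?prednK.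
- by have [] := contract_lastP tA i0 (etrans sA uE).
Qed.

Lemma reduced_rcons (q : seq (nat * colour * bool)) a b :
  reduced (rcons (rcons q b) a) = reduced (rcons q b) && turn b a.
Proof. by case: q => [|c q]; rewrite /reduced /= ?andbT // rcons_path last_rcons. Qed.

(** The tuple [X i] results from following the reduced walk from [r] to [i], with contractions on
    the descents. An edge [e] either prolongs the walk to its bottom or, reversed, is the last step
    of that walk; in the second case the expansion undoes the contraction. *)
Lemma lift_exists : exists X, is_lift x E X.
Proof.
have Lr : lengths S r r by [].
have [VE tree] := treeE.
have /choice[p hp] : forall i, exists p : seq (nat * colour * bool), lengths S r i ->
    (walk E r p i /\ reduced p) /\ forall q, walk E r q i /\ reduced q -> p = q.
  move=> i; have [Li|nLi] := pselect (lengths S r i); last by exists [::].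
  by have [p hp] := tree r i Lr Li; exists p.
pose X i := foldl lift_step X0 (p i).
have hX i : lengths S r i -> is_tuple (X i) /\ size (X i) = i.
  by move=> Li; have [[w _] _] := hp i Li; exact: follow_tuple w tX0 sX0.
exists X; split=> //.
  by rewrite -xX0 /X; have [_ uniq] := hp r Lr; rewrite (uniq [::]).
move=> e Ee; have [Li Lj] := VE e Ee; have i0 : (0 < e.1)%N by case: Li.
have [[wi ri] ui] := hp _ Li; have [[wj rj] uj] := hp _ Lj.
have [tj sj] := hX _ Lj.
have [red|nred] := boolP (reduced (rcons (p e.1) (e, true))).
  have pE : p (up e.1 e.2) = rcons (p e.1) (e, true).
    apply: uj; split=> //; rewrite -cats1; apply/walk_cat; exists e.1; split=> //.
  by rewrite /X pE foldl_rcons.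
have [q qE] : exists q, p e.1 = rcons q (e, false).
  case/lastP: (p e.1) ri nred => [//|q b] ri; rewrite reduced_rcons ri /= negbK.
  by move=> /andP[/eqP be b2]; exists q; case: b be b2 {ri} => b [] //= ->.
have pj : p (up e.1 e.2) = q.
  apply: uj; split.
    move: wi; rewrite qE -cats1 => /walk_cat[w [wq /walk_cons[_ wE _]]].
    by rewrite wE in wq.
  by move: ri; rewrite qE /reduced -cats1 => /cat_sorted2[].
have [_ _ cE] := contract_lastP tj i0 sj.
by rewrite -[LHS]cE /X qE foldl_rcons pj.
Qed.

End Lift.
End Bases.

(** If [U] had a single element, an expansion of the free generators, which has at least two
    elements, would have an image of one element, against validity. Without colours the laws are
    void and any set with two elements serves. *)
Lemma nontrivial_algebra (S : signature) (r : nat) (U : algebra S) (x : 'I_r -> U) :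
  (0 < r)%N -> satisfies U -> valid x ->
  exists2 A : algebra S, satisfies A & exists a b : A, a <> b.
Proof.
move=> r0 satU vx; have [[t _]|nt] := pselect (exists t : 'I_(colours S), True); last first.
  exists (@Algebra S bool (fun _ _ => true) (fun _ _ u => u)); last by exists true, false.
  by split=> [t|t|t]; case: nt; exists t.
exists U => //; apply: contrapT => triv.
have U1 (u v : U) : u = v by apply: contrapT => uv; apply: triv; exists u, v.
pose a : word_algebra S r := Var (Ordinal r0).
pose Y := expand_at (range (fun a : 'I_r => Var a : word_algebra S r)) a t.
have := vx Y; have -> : interp x @` Y = [set x (Ordinal r0)].
  apply/seteqP; split=> u; first by move=> _; exact: U1.
  move=> _; pose j := Ordinal (ltnW (arity_gt1 t)).
  by exists (Alp t j (Var (Ordinal r0))); [right; exists j|exact: U1].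
have admY : admissible (fun a : 'I_r => Var a : word_algebra S r) Y.
  by apply: rt_step; left; exists a, t; split=> //; exists (Ordinal r0).
move=> /(_ admY); rewrite card_eq_sym card_eq_le => /andP[/card_leP[f] _].
have Yj (j : 'I_(arity t)) : Y (Alp t j a) by right; exists j.
pose y (j : 'I_(arity t)) : Y := SigSub (mem_set (Yj j)).
pose j0 := Ordinal (ltnW (arity_gt1 t)); pose j1 := Ordinal (arity_gt1 t).
have fE : f (y j0) = f (y j1).
  by apply: val_inj; rewrite (set_valP (f (y j0))) (set_valP (f (y j1))).
have : y j0 = y j1 by apply: 'inj_f; rewrite ?inE.
(* Reading off the index avoids inverting an equality of dependently typed terms. *)
pose index (w : term S r) := if w is Alp _ j _ then nat_of_ord j else 0%N.
by move=> /(congr1 (fun w => index (val w))).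
Qed.

Theorem theorem6p2 (R : realType) (S : signature) (r : nat) (U : algebra S)
    (x : 'I_r -> U) (n : nat) :
  (0 < r)%N -> (1 <= n)%N ->
  is_free x -> valid x -> is_bounded x -> complete S ->
  simply_connected R (realization R (truncated_Z U n)) ->
  (exists (E : set (nat * 'I_(colours S))) (X : nat -> seq U),
     [/\ maximal_tree r E, truncated_tree r n E & is_lift x E X]) /\
  (forall (E : set (nat * 'I_(colours S))) (X : nat -> seq U),
     maximal_tree r E -> truncated_tree r n E -> is_lift x E X ->
     finitely_presents (gen_eval X : gen S -> algebra_aut U)
       (truncated_gens r n) (truncated_relators r E X n)).
Proof.
move=> r0 _ [satU fr] vx bdd cplS sc.
have [A0 sat0 [a0 [a1 a01]]] := nontrivial_algebra r0 satU vx.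
pose u0 := x (Ordinal r0).
have gen : generates (range x).
  move=> C satC phi psi hphi hpsi eqX u.
  have [chi [_ _ uniq]] := fr C satC (phi \o x).
  rewrite (uniq phi) // (uniq psi) // => a /=.
  by rewrite eqX //; exists a.
have ind : independent (range x).
  move=> C satC h; have [phi [hphi eqX _]] := fr C satC (h \o x).
  by exists phi => // _ [a _ <-]; exact: eqX.
have xI : injective x.
  move=> a b E; apply: contrapT => ab.
  have [phi [_ eqX _]] := fr A0 sat0 (fun c => if c == a then a0 else a1).
  apply: a01; have := congr1 phi E; rewrite !eqX eqxx ifF //.
  by apply/eqP => ba; rewrite ba in ab.
pose X0 := [seq x a | a <- enum 'I_r].
have sX0 : size X0 = r by rewrite size_map size_enum_ord.
have xX0 : [set` X0] = range x.
  apply/seteqP; split=> u /=; first by move=> /mapP[a _ ->]; exists a.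
  by move=> [a _ <-]; rewrite map_f // mem_enum.
have tX0 : is_tuple X0.
  apply/(is_tupleP satU u0); rewrite xX0; split=> //; first by rewrite map_inj_uniq ?enum_uniq.
  by move/(congr1 size); rewrite sX0 => r0'; move: (r0); rewrite r0'.
split=> [|E X maxE truncE lift].
  have [treeK _ _] := kruskal_maximal S r0.
  have [X lift] := lift_exists satU sat0 a01 u0 r0 tX0 sX0 xX0 treeK.
  exists (kruskal r), X; split=> //; first exact: kruskal_maximal.
  apply: kruskal_truncated => u v Lu Lv un vn.
  exact: (lengths_small_conn satU sat0 a01 cplS u0 r0 lift sc).
exact: (finite_presentation satU sat0 a01 cplS u0 r0 bdd lift sc truncE).
Qed.
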